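(* Assume the elliptical model and asymptotic regime described in the context. Let $$FE(X_1,\dots,X_k)=\sum_{i=1}^k\frac{p}{\operatorname{tr}[(X_i^\top X_i)^{-1}X^\top X]}.$$ Then, almost surely, $$FE(X_1,\dots,X_k)\to\sum_{i=1}^k\frac{1}{1+\left(\frac{1}{\gamma}\mathbb{E}_GT-\frac{1}{\gamma_i}\mathbb{E}_{G_i}T\right)f(\gamma_i,G_i)}.$$ In the special case of Marchenko-Pastur models ($\Gamma=I_n$ for all $n$), the almost sure limit of $FE(X_1,\dots,X_k)$ equals $$\frac{\gamma}{1-\gamma}\sum_{i=1}^k\frac{1-\gamma_i}{\gamma_i}.$$
   Context: Model. The $n\times p$ random data matrix is $X=\Gamma^{1/2}Z\Sigma^{1/2}$, where $Z$ is $n\times p$, $\Gamma$ is a deterministic $n\times n$ diagonal matrix with nonnegative entries and $\Sigma$ is a deterministic $p\times p$ positive definite matrix. The rows of $X$ are partitioned into $k$ blocks ($k$ fixed), $X=[X_1;\dots;X_k]$ stacked vertically, where $X_i=\Gamma_i^{1/2}Z_i\Sigma^{1/2}$ is $n_i\times p$, $Z_i$ and $\Gamma_i$ are the corresponding submatrices of $Z$ and $\Gamma$, and $n=\sum_i n_i$. Assumptions. (1) The entries of $Z$ are iid (from a fixed distribution) with mean zero, unit variance and finite $(8+c)$-th moment for some $c>0$. (2) The eigenvalues of $\Sigma$ and the entries of $\Gamma$ are uniformly bounded away from zero and infinity. (3) $n_i\to\infty$, $p\to\infty$ with $p/n_i\to\gamma_i\in(0,1)$ for each $i$; consequently $p/n\to\gamma$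 with $1/\gamma=\sum_i 1/\gamma_i$. (4) The empirical spectral distribution (uniform distribution on the eigenvalues) of $\Gamma$ converges weakly to $G$, that of each $\Gamma_i$ converges weakly to $G_i$, and that of $\Sigma$ converges weakly to $H$. $H$ is compactly supported away from the origin; $G$ is compactly supported and has no point mass at the origin. Notation. $\mathbb{E}_GT$ is the mean of $T\sim G$. $\eta_G(x)=\mathbb{E}_{T\sim G}\frac{1}{1+xT}$ (the $\eta$-transform), and $f(\gamma,G)=\eta_G^{-1}(1-\gamma)$, where $\eta_G^{-1}$ is the functional inverse of $\eta_G$ on $[0,\infty)$. Interpretation: in the linear model $Y=X\beta+\varepsilon$, $FE$ is the ratio of $\mathbb{E}\|X(\hat\beta-\beta)\|^2$ for full-data least squares to that of the optimally weighted average of local least squares estimators. *)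

(* Defs.v *)
From HB Require Import structures.
From mathcomp Require Import all_boot all_order all_algebra.
From mathcomp Require Import all_classical all_reals all_analysis.

Set Implicit Arguments.
Unset Strict Implicit.
Unset Printing Implicit Defensive.

Import Order.TTheory GRing.Theory Num.Theory.
Import numFieldNormedType.Exports.

Local Open Scope classical_set_scope.
Local Open Scope ring_scope.

Section matrices.
Context {R : realType} {n : nat}.
Implicit Types A S : 'M[R]_n.

Definition possemidefmx A :=
  A^T = A /\ forall x : 'rV[R]_n, 0 <= (x *m A *m x^T) 0 0.

Definition posdefmx A :=
  A^T = A /\ forall x : 'rV[R]_n, x != 0 -> 0 < (x *m A *m x^T) 0 0.

(* A^{1/2}: the unique positive semidefinite square root when A is positive
   semidefinite (a junk value 0 when there is none). *)
Definition sqrtmx A : 'M[R]_n :=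
  xget 0 [set S | possemidefmx S /\ S *m S = A].

(* The eigenvalues listed with multiplicity, in an unspecified order; this is
   meaningful when the characteristic polynomial splits over R, in particular
   when A is symmetric. *)
Definition eigenvals A : seq R :=
  xget [::] [set s : seq R | char_poly A = \prod_(a <- s) ('X - a%:P)].

Definition esd A : {measure set R -> \bar R} :=
  mscale (n%:R^-1)%:nng (msum (fun i => \d_((eigenvals A)`_i)) n).

End matrices.

Section measures_on_the_line.
Context {R : realType}.

Definition weak_cvg (mu_ : nat -> {measure set R -> \bar R})
    (mu : {measure set R -> \bar R}) :=
  forall f : R -> R, continuous f -> (exists M, forall x, `|f x| <= M) ->
    \int[mu_ t]_x f x @[t --> \oo] --> \int[mu]_x f x.

Definition msupport (mu : {measure set R -> \bar R}) : set R :=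
  [set x | forall U : set R, open U -> U x -> (0 < mu U)%E].

Definition mean (mu : {measure set R -> \bar R}) : R := \int[mu]_x x.

Definition eta (mu : {measure set R -> \bar R}) (x : R) : R :=
  \int[mu]_T (1 + x * T)^-1.

(* Functional inverse of eta on [0, +oo[. When mu is a probability measure
   concentrated on ]0, +oo[, eta mu is a decreasing bijection from [0, +oo[
   onto ]0, 1], so every y in ]0, 1] has exactly one preimage. *)
Definition eta_inv (mu : {measure set R -> \bar R}) (y : R) : R :=
  xget 0 [set x | 0 <= x /\ eta mu x = y].

Definition eta_f (gamma : R) (mu : {measure set R -> \bar R}) : R :=
  eta_inv mu (1 - gamma).

End measures_on_the_line.

Definition mutual_independence d (Omega : measurableType d) (R : realType)
    (P : probability Omega R) (I : finType) (X : I -> {RV P >-> R}) :=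
  forall (J : {set I}) (B : I -> set R), (forall i, measurable (B i)) ->
    P (\bigcap_(i in [set` J]) (X i @^-1` B i)) =
    (\prod_(i in J) P (X i @^-1` B i))%E.

(* The row index type 'I_(\sum_i n_ i) carries the splitting of X into k
   vertically stacked blocks; submxcol X i is the i-th one, with n_ i rows. *)
Definition FE (R : realType) k (n_ : 'I_k -> nat) p
    (X : 'M[R]_(\sum_(i < k) n_ i, p)) : R :=
  \sum_(i < k)
    let Xi := submxcol X i in
    p%:R / \tr (invmx (Xi^T *m Xi) *m (X^T *m X)).

(* Main.v *)
(** Sigma cancels from FE, whose i-th summand becomes 1 / (1 + tr (A^-1 C) / p):
    A is the sum of Gamma_r z_r^T z_r over the rows r of block i, and C the same
    sum over the other rows. With n rows in total, fix kappa > 0 and let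
    B = (A + kappa n)^-1.

    Removing one row at a time gives p - kappa n tr B = sum_r w_r q_r / (1 + w_r q_r),
    where q_r = z_r B_r z_r^T and B_r does not involve z_r. As q_r concentrates
    around tr B_r, which is close to tr B, and tr B around its mean x by bounded
    differences, p / n = kappa x + n^-1 sum_r w_r x / (1 + w_r x) up to O(n^-1/2).
    At kappa = 0 the limit of this equation reads eta_{G_i} (x) = 1 - gamma_i, so
    tr B is eventually within O(kappa) of f (gamma_i, G_i). Since C is independent
    of B, Chebyshev's inequality shows that tr (B C) is close to tr B times the
    sum of the weights in C.

    Removing the regularization amounts to a bound A >= c n with c > 0, because
    then B <= A^-1 <= (1 + kappa / c) B. It comes from the barrier function
    tr (A - l)^-1 of Batson, Spielman and Srivastava: each additional row has a
    probability bounded below of allowing l to grow by a fixed amount without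
    the barrier increasing. *)

Require Import Defs.
From HB Require Import structures.
From mathcomp Require Import all_boot all_order all_algebra.
From mathcomp Require Import all_classical all_reals all_analysis.
From mathcomp Require Import measurable_realfun.
From mathcomp Require Import ring lra.

Set Implicit Arguments.
Unset Strict Implicit.
Unset Printing Implicit Defensive.

Import Order.TTheory GRing.Theory Num.Theory.
Import numFieldNormedType.Exports.

Local Open Scope classical_set_scope.
Local Open Scope ring_scope.

(** * Quadratic forms, resolvents and weighted Gram matrices *)

(** The obstacle is that moment bounds on the entries give no direct control of the smallest
    eigenvalue of [A]. The term [kappa n] bounds [B] by [1 / (kappa n)], so replacing a single row
    moves [tr B] by at most that amount however large its entries are; all probabilistic estimates
    are made with [kappa] fixed, and [kappa] tends to 0 only after [n]. The lower bound on [A] is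
    not circular: the equation for the mean trace already bounds it uniformly in [kappa], because
    [p / n_i] stays below 1, and this bound starts the barrier. Conditional expectations are
    replaced by the operation of redrawing some entries while the others are frozen. Independence
    enters only through the fact that redrawing preserves the law of the matrix. Almost sure
    statements come from the Borel-Cantelli lemma. The sample sizes increase strictly with the index
    of the problem, so [n^-2] is summable; the weakest estimate, Chebyshev's inequality for
    [tr (B C)], is of exactly this order, since the variance stays bounded while the deviation
    tested is of order [n]. *)

Section quadratic_forms.
Context {R : realType} {p : nat}.
Implicit Types (A B D : 'M[R]_p) (x y z : 'rV[R]_p).

Definition qform A x : R := (x *m A *m x^T) 0 0.

Lemma mx11_tr (M : 'M[R]_1) : M 0 0 = \tr M.
Proof. by rewrite /mxtrace big_ord1. Qed.

Lemma qformE A x : qform A x = \sum_i \sum_j x 0 i * A i j * x 0 j.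
Proof.
rewrite /qform mxE exchange_big; apply: eq_bigr => j _ /=.
by rewrite !mxE mulr_suml.
Qed.

Lemma qform_tr A x : qform A x = \tr (A *m (x^T *m x)).
Proof. by rewrite /qform mx11_tr -mulmxA mxtrace_mulC -mulmxA. Qed.

Lemma qformD A B x : qform (A + B) x = qform A x + qform B x.
Proof. by rewrite /qform mulmxDr mulmxDl mxE. Qed.

Lemma qformN A x : qform (- A) x = - qform A x.
Proof. by rewrite /qform mulmxN mulNmx mxE. Qed.

Lemma qformB A B x : qform (A - B) x = qform A x - qform B x.
Proof. by rewrite qformD qformN. Qed.

Lemma qformZ a A x : qform (a *: A) x = a * qform A x.
Proof. by rewrite /qform -scalemxAr -scalemxAl mxE. Qed.

Lemma qform_scalar a x : qform a%:M x = a * qform 1%:M x.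
Proof. by rewrite -[a%:M]scalemx1 qformZ. Qed.

Lemma qform1 x : qform 1%:M x = \sum_i x 0 i ^+ 2.
Proof.
by rewrite /qform mulmx1 mxE; apply: eq_bigr => i _; rewrite mxE expr2.
Qed.

Lemma qform1_ge0 x : 0 <= qform 1%:M x.
Proof. by rewrite qform1 sumr_ge0// => i _; exact: sqr_ge0. Qed.

Lemma qform1_gt0 x : x != 0 -> 0 < qform 1%:M x.
Proof.
move=> x0; rewrite lt0r qform1_ge0 andbT qform1; apply: contra x0 => /eqP h.
apply/eqP/rowP => i; rewrite mxE; apply/eqP; rewrite -sqrf_eq0; apply/eqP.
by move: (psumr_eq0P (fun i _ => sqr_ge0 (x 0 i)) h) => ->.
Qed.

Lemma qform0 A : qform A 0 = 0.
Proof. by rewrite /qform !mul0mx mxE. Qed.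

(** Restriction of the form to two coordinate vectors. It yields the inequalities for 2 x 2
    principal minors and, by polarization, the entries of a symmetric matrix. *)
Lemma qform_lin2 A s t i j : A^T = A ->
  qform A (s *: delta_mx 0 i + t *: delta_mx 0 j) =
  s ^+ 2 * A i i + 2 * (s * t) * A i j + t ^+ 2 * A j j.
Proof.
move=> sA; have Aji : A j i = A i j by rewrite -[in LHS]sA mxE.
rewrite /qform linearD/= !linearZ/= !trmx_delta mulmxDl !mulmxDr -!scalemxAl.
by rewrite -!scalemxAr !mulmxDl -!scalemxAl -!rowE -!colE !mxE Aji; ring.
Qed.

Lemma qform_delta A i : qform A (delta_mx 0 i) = A i i.
Proof. by rewrite /qform -rowE trmx_delta -colE !mxE. Qed.

Lemma qform_congr q (C : 'M[R]_(q, p)) A (v : 'rV[R]_q) :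
  (v *m (C *m A *m C^T) *m v^T) 0 0 = qform A (v *m C).
Proof. by rewrite /qform trmx_mul !mulmxA. Qed.

Lemma qform_rank1 x z : qform (z^T *m z) x = (x *m z^T) 0 0 ^+ 2.
Proof.
rewrite /qform !mulmxA -mulmxA mxE big_ord1 expr2; congr (_ * _).
by rewrite !mxE; apply: eq_bigr => i _; rewrite !mxE mulrC.
Qed.

Lemma posdef_psd A : posdefmx A -> possemidefmx A.
Proof.
move=> [sA pA]; split => // x; have [->|/pA/ltW//] := eqVneq x 0.
by rewrite -/(qform A 0) qform0.
Qed.

Lemma psdE A : possemidefmx A -> forall x, 0 <= qform A x.
Proof. by case. Qed.

Lemma psd_diag_ge0 A i : possemidefmx A -> 0 <= A i i.
Proof. by move=> /psdE/(_ (delta_mx 0 i)); rewrite qform_delta. Qed.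

Lemma psd_trace_ge0 A : possemidefmx A -> 0 <= \tr A.
Proof. by move=> pA; apply: sumr_ge0 => i _; exact: psd_diag_ge0. Qed.

Lemma psd_trace_le A B : possemidefmx (B - A) -> \tr A <= \tr B.
Proof. by move/psd_trace_ge0; rewrite raddfB/= subr_ge0. Qed.

Lemma psd_qform_le A B x : possemidefmx (B - A) -> qform A x <= qform B x.
Proof. by move/psdE/(_ x); rewrite qformB subr_ge0. Qed.

Lemma psdD A B : possemidefmx A -> possemidefmx B -> possemidefmx (A + B).
Proof.
move=> [sA pA] [sB pB]; split; first by rewrite linearD/= sA sB.
by move=> x; rewrite -/(qform _ _) qformD addr_ge0//; [exact: pA|exact: pB].
Qed.

Lemma psdZ a A : 0 <= a -> possemidefmx A -> possemidefmx (a *: A).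
Proof.
move=> a0 [sA pA]; split; first by rewrite linearZ/= sA.
by move=> x; rewrite -/(qform _ _) qformZ mulr_ge0//; exact: pA.
Qed.

Lemma psd0 : possemidefmx (0 : 'M[R]_p).
Proof. by split=> [|x]; rewrite ?trmx0// mulmx0 mul0mx mxE. Qed.

Lemma psd_sum I (r : seq I) (P : pred I) (F : I -> 'M[R]_p) :
  (forall i, P i -> possemidefmx (F i)) -> possemidefmx (\sum_(i <- r | P i) F i).
Proof. by move=> h; apply: big_ind => //; [exact: psd0|exact: psdD]. Qed.

Lemma psd_rank1 z : possemidefmx (z^T *m z).
Proof.
split=> [|x]; first by rewrite trmx_mul trmxK.
by rewrite -/(qform _ _) qform_rank1 sqr_ge0.
Qed.

Lemma posdef_scalar a : 0 < a -> posdefmx (a%:M : 'M[R]_p).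
Proof.
move=> a0; split; first by rewrite tr_scalar_mx.
by move=> x x0; rewrite -/(qform _ _) qform_scalar mulr_gt0// qform1_gt0.
Qed.

Lemma posdefDl A B : posdefmx A -> possemidefmx B -> posdefmx (A + B).
Proof.
move=> [sA pA] [sB pB]; split; first by rewrite linearD/= sA sB.
by move=> x x0; rewrite -/(qform _ _) qformD ltr_pwDl//; [exact: pA|exact: pB].
Qed.

Lemma posdefDr A B : possemidefmx A -> posdefmx B -> posdefmx (A + B).
Proof. by move=> pA pB; rewrite addrC; exact: posdefDl. Qed.

Lemma posdef_unit A : posdefmx A -> A \in unitmx.
Proof.
move=> [_ pA]; rewrite -row_free_unit -kermx_eq0; apply/eqP/row_matrixP => i.
rewrite row0; apply/eqP/negP => /negP /pA.
have /sub_kermxP -> : (row i (kermx A) <= kermx A)%MS by exact: row_sub.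
by rewrite mul0mx mxE ltxx.
Qed.

Lemma posdef_inv A : posdefmx A -> posdefmx (invmx A).
Proof.
move=> pdA; have uA := posdef_unit pdA; case: pdA => sA pA.
have sI : (invmx A)^T = invmx A by rewrite trmx_inv sA.
split => // x x0; have := pA (x *m invmx A).
rewrite mulmxKV// trmx_mul sI mulmxA; apply; apply: contra x0 => /eqP h.
by rewrite -(mulmxKV uA x) h mul0mx.
Qed.

(* [qform (invmx A) x] is the maximum over y of [2 x y^T - qform A y], attained
   at [y = x A^-1]; this makes it antitone in [A]. *)
Lemma inv_antitone A D : posdefmx A -> posdefmx D -> possemidefmx (D - A) ->
  possemidefmx (invmx A - invmx D).
Proof.
move=> pA pD pDA; have [[sAi pAi] [sDi _]] := (posdef_inv pA, posdef_inv pD).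
have [uA uD] := (posdef_unit pA, posdef_unit pD).
split; first by rewrite linearB/= sAi sDi.
move=> x; rewrite -/(qform _ _).
pose y := x *m invmx D - x *m invmx A.
have yE : qform A y = qform A (x *m invmx D) - 2 * qform (invmx D) x + qform (invmx A) x.
  have e1 : y *m A = x *m invmx D *m A - x by rewrite /y mulmxBl mulmxKV.
  have e2 : y^T = invmx D *m x^T - invmx A *m x^T.
    by rewrite /y linearB/= !trmx_mul sDi sAi.
  have e3 : x *m invmx D *m A *m (invmx A *m x^T) = x *m invmx D *m x^T.
    by rewrite mulmxA mulmxK.
  rewrite /qform e1 e2 mulmxBl !mulmxBr e3 trmx_mul sDi !mulmxA !mxE; lra.
have DE : qform D (x *m invmx D) = qform (invmx D) x.
  by rewrite /qform mulmxKV// trmx_mul sDi mulmxA.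
have := psdE (posdef_psd pA) y; have := psdE pDA (x *m invmx D).
by rewrite !qformB DE yE; lra.
Qed.

(** The trace stands in for the largest eigenvalue in all later bounds. Nonnegativity on
    [x_j e_i - x_i e_j], summed over all pairs of indices, gives twice the inequality. *)
Lemma psd_qform_le_trace A x : possemidefmx A ->
  qform A x <= \tr A * qform 1%:M x.
Proof.
move=> pA; have [sA _] := pA.
have h i j : 2 * (x 0 i * A i j * x 0 j) <= x 0 j ^+ 2 * A i i + x 0 i ^+ 2 * A j j.
  have [->|ij] := eqVneq i j; first by rewrite le_eqVlt; apply/orP; left; apply/eqP; ring.
  have /psdE/(_ (x 0 j *: delta_mx 0 i + (- x 0 i) *: delta_mx 0 j)) := pA.
  by rewrite qform_lin2//; lra.
rewrite -(ler_pM2l (_ : 0 < 2))// qformE mulr_sumr.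
under eq_bigr do rewrite mulr_sumr.
apply: (le_trans (ler_sum _ (fun i _ => ler_sum _ (fun j _ => h i j)))).
rewrite le_eqVlt; apply/orP; left; apply/eqP.
under eq_bigr do rewrite big_split/=.
rewrite big_split/= qform1.
under eq_bigr do rewrite -mulr_suml.
rewrite -mulr_sumr -/(\tr A).
under [X in _ + X]eq_bigr do rewrite -mulr_sumr.
by rewrite -mulr_suml -/(\tr A); ring.
Qed.

(** Nonnegativity of a 2 x 2 principal minor, obtained by minimizing the form over [s] with
    [t = A i i]; a vanishing [A i i] forces [A i j = 0]. *)
Lemma psd_entry_sqr_le A i j : possemidefmx A -> A i j ^+ 2 <= A i i * A j j.
Proof.
move=> pA; have [sA _] := pA.
have h s t : 0 <= s ^+ 2 * A i i + 2 * (s * t) * A i j + t ^+ 2 * A j j.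
  by rewrite -qform_lin2//; exact: psdE.
have Ai := psd_diag_ge0 i pA; have Aj := psd_diag_ge0 j pA.
have [A0|Ap] := eqVneq (A i i) 0.
  have [->|n0] := eqVneq (A i j) 0; first by rewrite A0 expr2 !mul0r.
  (* With [A i i = 0] the form is affine in [s]; at [t = 1] this [s] gives it the value -1. *)
  have := h (- (A j j + 1) / (2 * A i j)) 1; rewrite A0.
  rewrite (_ : _ + _ = -1); first by rewrite lerNr oppr0 ler10.
  by field.
have {}Ap : 0 < A i i by rewrite lt0r Ap.
rewrite -subr_ge0 -(pmulr_rge0 _ Ap); have := h (- A i j) (A i i).
by congr (0 <= _); ring.
Qed.

Lemma mxtrace_sqr A : A^T = A -> \tr (A *m A) = \sum_i \sum_j A i j ^+ 2.
Proof.
move=> sA; apply: eq_bigr => i _; rewrite mxE; apply: eq_bigr => j _.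
by rewrite expr2; congr (_ * _); rewrite -[in LHS]sA mxE.
Qed.

Lemma mxtrace_sqr_ge0 A : A^T = A -> 0 <= \tr (A *m A).
Proof. by move=> sA; rewrite mxtrace_sqr//; do 2!apply: sumr_ge0 => ? _; exact: sqr_ge0. Qed.

Lemma psd_trace_sqr_le A : possemidefmx A -> \tr (A *m A) <= \tr A ^+ 2.
Proof.
move=> pA; rewrite mxtrace_sqr; last by case: pA.
rewrite expr2 /mxtrace mulr_suml; apply: ler_sum => i _.
by rewrite mulr_sumr; apply: ler_sum => j _; exact: psd_entry_sqr_le.
Qed.

Lemma psd_congr q (C : 'M[R]_(q, p)) A :
  possemidefmx A -> possemidefmx (C *m A *m C^T).
Proof.
move=> [sA pA]; split; first by rewrite !trmx_mul sA trmxK mulmxA.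
by move=> v; rewrite qform_congr; exact: pA.
Qed.

End quadratic_forms.

(** * Resolvents under rank-one updates *)

Section resolvent.
Context {R : realType} {p : nat}.
Implicit Types (A B D : 'M[R]_p) (x z : 'rV[R]_p).

Lemma mulmx1_inv A B : A *m B = 1%:M -> invmx A = B.
Proof.
move=> AB; have [uA _] := mulmx1_unit AB.
by rewrite -[LHS]mulmx1 -AB mulKmx.
Qed.

Lemma qform_mul11 D x z : x *m D *m z^T = ((x *m D *m z^T) 0 0)%:M.
Proof. exact: mx11_scalar. Qed.

(** Sherman-Morrison formula, checked by multiplication; [w >= 0] keeps the denominator at least
    1. *)
Lemma inv_rank1_update D z w : posdefmx D -> 0 <= w ->
  invmx (D + w *: (z^T *m z)) =
  invmx D - (w / (1 + w * qform (invmx D) z)) *: (invmx D *m z^T *m (z *m invmx D)).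
Proof.
move=> pD w0; have uD := posdef_unit pD; apply: mulmx1_inv.
set B := invmx D; set u := qform B z.
have u0 : 0 <= u by exact/psdE/posdef_psd/posdef_inv.
have h : 1 + w * u != 0 by rewrite gt_eqF// ltr_pwDl// mulr_ge0.
rewrite mulmxDl !mulmxBr -!scalemxAl -!scalemxAr !mulmxA mulmxV// mul1mx.
have -> : z^T *m z *m B *m z^T *m z *m B = u *: (z^T *m z *m B).
  have -> : z^T *m z *m B *m z^T *m z *m B = z^T *m (z *m B *m z^T) *m (z *m B).
    by rewrite !mulmxA.
  by rewrite qform_mul11 mul_mx_scalar -scalemxAl mulmxA.
rewrite [z^T *m z *m invmx D](_ : _ = z^T *m z *m B)// scalerA scalerA.
rewrite -addrA -scaleNr -scalerBl -scalerDl [X in X *: _](_ : _ = 0) ?scale0r ?addr0//.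
by field.
Qed.

Lemma qform_rank1_update D z w : posdefmx D -> 0 <= w ->
  qform (invmx (D + w *: (z^T *m z))) z =
  qform (invmx D) z / (1 + w * qform (invmx D) z).
Proof.
move=> pD w0; rewrite inv_rank1_update//; set u := qform (invmx D) z.
have u0 : 0 <= u by exact/psdE/posdef_psd/posdef_inv.
have h : 1 + w * u != 0 by rewrite gt_eqF// ltr_pwDl// mulr_ge0.
rewrite qformB qformZ -/u.
have -> : qform (invmx D *m z^T *m (z *m invmx D)) z = u ^+ 2.
  rewrite /qform; have -> : z *m (invmx D *m z^T *m (z *m invmx D)) *m z^T =
    (z *m invmx D *m z^T) *m (z *m invmx D *m z^T) by rewrite !mulmxA.
  by rewrite mxE big_ord1 expr2.
by field.
Qed.

Lemma mxtrace_rank1_update D z w : posdefmx D -> 0 <= w ->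
  \tr (invmx (D + w *: (z^T *m z))) =
  \tr (invmx D) - w * qform (invmx D *m invmx D) z / (1 + w * qform (invmx D) z).
Proof.
move=> pD w0; rewrite inv_rank1_update// linearB/= linearZ/=; congr (_ - _).
rewrite mxtrace_mulC -mulmxA [_ *m (invmx D *m z^T)]mulmxA mulmxA.
by rewrite -mx11_tr mulrAC.
Qed.

Lemma psd_sqr A : A^T = A -> possemidefmx (A *m A).
Proof.
move=> sA; rewrite -{1}[A]mulmx1 -{2}sA; apply: psd_congr.
exact/posdef_psd/posdef_scalar.
Qed.

Lemma psd_mxtrace_rank1_update_le D z w : posdefmx D -> 0 <= w ->
  \tr (invmx (D + w *: (z^T *m z))) <= \tr (invmx D).
Proof.
move=> pD w0; have [sI _] := posdef_inv pD.
rewrite mxtrace_rank1_update// lerBlDr lerDl divr_ge0//.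
  by rewrite mulr_ge0//; exact/psdE/psd_sqr.
by rewrite addr_ge0// mulr_ge0//; exact/psdE/posdef_psd/posdef_inv.
Qed.

Section ridge.
Variables (A : 'M[R]_p) (e : R).
Hypotheses (psdA : possemidefmx A) (e0 : 0 < e).
Let B : 'M[R]_p := invmx (A + e%:M).

Lemma ridge_posdef : posdefmx (A + e%:M).
Proof. exact: posdefDr (posdef_scalar e0). Qed.

Lemma ridge_inv_posdef : posdefmx B.
Proof. exact/posdef_inv/ridge_posdef. Qed.

Lemma ridge_inv_le : possemidefmx (e^-1%:M - B).
Proof.
rewrite -invmx_scalar; apply: inv_antitone (posdef_scalar e0) ridge_posdef _.
by rewrite addrK.
Qed.

(** Multiply [A >= 0] by [B] on both sides: [B A B = B - e B^2]. *)
Lemma ridge_inv_sqr_le : possemidefmx (e^-1 *: B - B *m B).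
Proof.
have [sB _] := ridge_inv_posdef; have uD := posdef_unit ridge_posdef.
have /(psdZ (ltW (_ : 0 < e^-1))) := psd_congr B psdA.
rewrite invr_gt0 => /(_ e0).
rewrite sB (_ : B *m A *m B = B - e *: (B *m B)); last first.
  rewrite -[in LHS](addrK e%:M A) mulmxBr mulVmx// mulmxBl mul1mx.
  by rewrite mul_mx_scalar scalemxAl.
by rewrite scalerBr scalerA mulVf ?gt_eqF// scale1r.
Qed.

Lemma ridge_trace_le : \tr B <= p%:R / e.
Proof.
have := psd_trace_le ridge_inv_le.
by rewrite mxtrace_scalar mulr_natl.
Qed.

Lemma ridge_trace_sqr_le : \tr (B *m B) <= p%:R / e ^+ 2.
Proof.
apply: (le_trans (psd_trace_le ridge_inv_sqr_le)).
rewrite linearZ/= expr2 invfM mulrA mulrC ler_wpM2r ?invr_ge0 ?(ltW e0)//.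
exact: ridge_trace_le.
Qed.

Lemma ridge_trace_ge0 : 0 <= \tr B.
Proof. exact/psd_trace_ge0/posdef_psd/ridge_inv_posdef. Qed.

(** By Sherman-Morrison the drop is [w z B^2 z^T / (1 + w z B z^T)], and [B^2 <= e^-1 B] bounds it
    by [e^-1] uniformly in [z] and [w]. This uniformity makes bounded differences available for
    unbounded entries. *)
Lemma ridge_trace_rank1_update z w : 0 <= w ->
  0 <= \tr B - \tr (invmx (A + w *: (z^T *m z) + e%:M)) <= e^-1.
Proof.
move=> w0; have pD := ridge_posdef.
rewrite [A + _ + e%:M]addrAC mxtrace_rank1_update// opprB addrCA subrr addr0 -/B.
have u0 : 0 <= qform B z by exact/psdE/posdef_psd/ridge_inv_posdef.
have h : 0 < 1 + w * qform B z by rewrite ltr_pwDl// mulr_ge0.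
rewrite divr_ge0 ?(ltW h)//=; last first.
  rewrite mulr_ge0//; apply/psdE/psd_sqr.
  by case: ridge_inv_posdef.
rewrite ler_pdivrMr//.
have := psd_qform_le z ridge_inv_sqr_le; rewrite qformZ => h1.
apply: (le_trans (ler_wpM2l w0 h1)).
rewrite mulrCA ler_wpM2l ?invr_ge0 ?(ltW e0)//.
by rewrite lerDr.
Qed.

End ridge.

(** * One deterministic step of the barrier argument *)

Section barrier.
Variables (D : 'M[R]_p) (phi delta : R).
Hypotheses (pD : posdefmx D) (phi0 : 0 < phi) (trD : \tr (invmx D) <= phi).
Hypotheses (delta0 : 0 < delta) (deltaphi : 2 * phi * delta <= 1).
Let M : 'M[R]_p := invmx (D - delta%:M).

Lemma psd_inv_trace : possemidefmx (phi%:M - invmx D).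
Proof.
have pI := posdef_inv pD; split; first by rewrite linearB/= tr_scalar_mx; case: pI => ->.
move=> x; rewrite -/(qform _ _) qformB subr_ge0 qform_scalar.
apply: (le_trans (psd_qform_le_trace x (posdef_psd pI))).
by rewrite ler_wpM2r// qform1_ge0.
Qed.

(** The trace bound gives [D >= phi^-1 >= 2 delta]. The matrix is the sum of [(D - phi^-1) / 2] and
    the nonnegative scalar [phi^-1 / 2 - delta]. *)
Lemma barrier_half : possemidefmx ((D - delta%:M) - 2^-1 *: D).
Proof.
have h : possemidefmx (D - (phi^-1)%:M).
  rewrite -invmx_scalar -[D in D - _]invmxK.
  exact: inv_antitone (posdef_inv pD) (posdef_scalar phi0) psd_inv_trace.
have := psdD (psdZ (_ : 0 <= 2^-1) h) (psdZ (_ : 0 <=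
  2^-1 * phi^-1 - delta) (posdef_psd (posdef_scalar ltr01))).
rewrite (_ : _ + _ = D - delta%:M - 2^-1 *: D); first apply.
- by rewrite invr_ge0 ler0n.
- rewrite subr_ge0 -invfM -(ler_pM2l (_ : 0 < 2 * phi)) ?mulr_gt0//.
  by rewrite mulfV// mulf_neq0// ?gt_eqF// pnatr_eq0.
apply/matrixP => i j; rewrite !mxE; case: (i == j); rewrite ?mulr1n ?mulr0n.
  by field; rewrite gt_eqF.
by field; rewrite gt_eqF.
Qed.

Lemma barrier_posdef : posdefmx (D - delta%:M).
Proof.
rewrite -(subrK (2^-1 *: D) (D - delta%:M)); apply: posdefDr barrier_half _.
have [sD qD] := pD; split; first by rewrite linearZ/= sD.
by move=> x x0; rewrite -/(qform _ _) qformZ mulr_gt0 ?invr_gt0//; exact: qD.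
Qed.

Lemma barrier_trace_ge0 : 0 <= \tr M.
Proof. exact/psd_trace_ge0/posdef_psd/posdef_inv/barrier_posdef. Qed.

Lemma barrier_trace_le : \tr M <= 2 * phi.
Proof.
have pH : posdefmx (2^-1 *: D).
  have [sD qD] := pD; split; first by rewrite linearZ/= sD.
  by move=> x x0; rewrite -/(qform _ _) qformZ mulr_gt0 ?invr_gt0//; exact: qD.
have := psd_trace_le (inv_antitone pH barrier_posdef barrier_half).
rewrite invmxZ ?unitfE ?invr_eq0 ?pnatr_eq0// ?posdef_unit// invrK linearZ/=.
by move=> h; apply: (le_trans h); rewrite ler_wpM2l.
Qed.

Lemma barrier_trace_sqr_le : \tr (M *m M) <= (2 * phi) ^+ 2.
Proof.
apply: (le_trans (psd_trace_sqr_le (posdef_psd (posdef_inv barrier_posdef)))).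
by rewrite ler_sqr ?nnegrE ?barrier_trace_ge0 ?mulr_ge0 ?(ltW phi0)// barrier_trace_le.
Qed.

(** Resolvent identity [M - D^-1 = delta M D^-1]; multiplied by [M] once more, it shows that
    [tr (M D^-1) <= tr M^2]. *)
Lemma barrier_trace_shift : \tr M <= \tr (invmx D) + delta * \tr (M *m M).
Proof.
have [sM _] := posdef_inv barrier_posdef; have pI := posdef_psd (posdef_inv pD).
have uD := posdef_unit pD; have uM := posdef_unit barrier_posdef.
have e : M - invmx D = delta *: (M *m invmx D).
  transitivity (M *m D *m invmx D - M *m (D - delta%:M) *m invmx D).
    by rewrite mulmxK// mulVmx// mul1mx.
  rewrite -mulmxBl -mulmxBr opprB addrC subrK mul_mx_scalar.
  by rewrite scalemxAl.
have := psd_trace_ge0 (psdZ (ltW delta0) (psd_congr M pI)).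
rewrite sM scalemxAl -e mulmxBl linearB/= subr_ge0 mxtrace_mulC -/M => h.
have := congr1 mxtrace e; rewrite mxtraceZ linearB/= => e'.
by have := ler_wpM2l (ltW delta0) h; lra.
Qed.

(** The shift raises the barrier by at most [delta tr M^2], while the new row lowers it by
    [w z M^2 z^T / (1 + w z M z^T)], which is at least [a / (1 + a K)] times [tr M^2 / 2]. The bound
    on [delta] balances the two. *)
Lemma barrier_step z w a K : 0 < a -> a <= w -> 0 <= K ->
  delta <= a / (2 * (1 + a * K)) ->
  qform M z <= K -> \tr (M *m M) / 2 <= qform (M *m M) z ->
  \tr (invmx (D - delta%:M + w *: (z^T *m z))) <= phi.
Proof.
move=> a0 aw K0 dK uK vM; have pM := barrier_posdef; have w0 := le_trans (ltW a0) aw.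
have [sM _] := posdef_inv pM.
rewrite mxtrace_rank1_update// -/M.
have u0 : 0 <= qform M z by exact/psdE/posdef_psd/posdef_inv.
have t0 : 0 <= \tr (M *m M) by exact: mxtrace_sqr_ge0.
have hw : 0 < 1 + w * qform M z by rewrite ltr_pwDl// mulr_ge0.
have ha : 0 < 1 + a * K by rewrite ltr_pwDl// mulr_ge0// ltW.
apply: (le_trans _ trD); rewrite lerBlDr.
apply: (le_trans barrier_trace_shift); rewrite lerD2l.
have h1 : a / (2 * (1 + a * K)) * \tr (M *m M) <= a / (1 + a * K) * qform (M *m M) z.
  have -> : a / (2 * (1 + a * K)) * \tr (M *m M) = a / (1 + a * K) * (\tr (M *m M) / 2).
    by field; rewrite gt_eqF.
  by rewrite ler_wpM2l// divr_ge0 ?(ltW a0) ?(ltW ha).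
apply: (le_trans (ler_wpM2r t0 dK)); apply: (le_trans h1).
rewrite [w * _ / _]mulrAC ler_wpM2r//; first exact/psdE/psd_sqr.
rewrite ler_pdivrMr// mulrAC ler_pdivlMr// !mulrDr !mulr1.
by rewrite lerD// mulrCA ler_wpM2l// ler_wpM2l// ltW.
Qed.

End barrier.

End resolvent.

(** * Gram matrices with weighted rows *)

Section weighted_gram.
Context {R : realType} {n p : nat}.
Implicit Types (w : 'I_n -> R) (Z : 'M[R]_(n, p)).

(** Weights may vanish: a block, its complement and any other subset of the rows are all given by
    weights on one and the same matrix [Z]. *)
Definition wgram w Z : 'M[R]_p := \sum_i w i *: ((row i Z)^T *m row i Z).

Definition wgram_but w Z r : 'M[R]_p :=
  \sum_(i | i != r) w i *: ((row i Z)^T *m row i Z).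

Lemma psd_wgram w Z : (forall i, 0 <= w i) -> possemidefmx (wgram w Z).
Proof. by move=> w0; apply: psd_sum => i _; apply: psdZ => //; exact: psd_rank1. Qed.

Lemma psd_wgram_but w Z r : (forall i, 0 <= w i) -> possemidefmx (wgram_but w Z r).
Proof. by move=> w0; apply: psd_sum => i _; apply: psdZ => //; exact: psd_rank1. Qed.

Lemma wgramD1 w Z r :
  wgram w Z = wgram_but w Z r + w r *: ((row r Z)^T *m row r Z).
Proof. by rewrite /wgram (bigD1 r)//= addrC. Qed.

Lemma mxtrace_mul_wgram B w Z :
  \tr (B *m wgram w Z) = \sum_i w i * qform B (row i Z).
Proof.
rewrite mulmx_sumr raddf_sum; apply: eq_bigr => i _ /=.
by rewrite -scalemxAr linearZ/= qform_tr.
Qed.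

(* Each row is compared with the resolvent in which it does not enter. *)
Lemma ridge_trace_identity w Z e : (forall i, 0 <= w i) -> 0 < e ->
  p%:R - e * \tr (invmx (wgram w Z + e%:M)) =
  \sum_i (let q := qform (invmx (wgram_but w Z i + e%:M)) (row i Z) in
          w i * q / (1 + w i * q)).
Proof.
move=> w0 e0; have pD := ridge_posdef (psd_wgram Z w0) e0.
transitivity (\tr (invmx (wgram w Z + e%:M) *m wgram w Z)).
  rewrite -{3}(addrK e%:M (wgram w Z)) mulmxBr mulVmx ?posdef_unit// linearB/=.
  by rewrite mxtrace1 mul_mx_scalar mxtraceZ.
rewrite mxtrace_mul_wgram; apply: eq_bigr => i _ /=.
rewrite {1}(wgramD1 _ _ i) addrAC qform_rank1_update//; first by rewrite mulrA.
exact/ridge_posdef/e0/psd_wgram_but.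
Qed.

End weighted_gram.

(** * Measurable functions of matrices *)

Section measurable_matrices.
Context {R : realType}.

(** [1 / f] is written as [f] times the real power -1 of the nonnegative [f^2]; where [f] vanishes
    both sides are 0. *)
Lemma measurable_inv d (T : measurableType d) (f : T -> R) :
  measurable_fun setT f -> measurable_fun setT (fun x => (f x)^-1).
Proof.
move=> mf; rewrite (_ : (fun _ => _) = (fun x => f x * (f x ^+ 2) `^ (-1))).
  apply: measurable_funM => //.
  exact: measurableT_comp (@measurable_powR R (-1)) (measurable_funX 2 mf).
apply/funext => x; rewrite powR_inv1 ?sqr_ge0//.
have [->|f0] := eqVneq (f x) 0; first by rewrite invr0 mul0r.
by rewrite expr2 invfM mulrA divff// mul1r.
Qed.

(** These rectangles form a pi-system, and independence of the entries determines the law of the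
    matrix on them. Hence the choice of the sigma-algebra [mxspace]. *)
Definition mxrect n p : set (set 'M[R]_(n, p)) :=
  [set A | exists2 B : 'I_n -> 'I_p -> set R, (forall i j, measurable (B i j)) &
     A = [set M : 'M[R]_(n, p) | forall i j, B i j (M i j)]].

Arguments mxrect : clear implicits.

Lemma mxrectT n p : mxrect n p setT.
Proof. by exists (fun _ _ => setT) => //; apply/seteqP; split. Qed.

Lemma mxrectI n p : setI_closed (mxrect n p).
Proof.
move=> _ _ [B mB ->] [C mC ->]; exists (fun i j => B i j `&` C i j).
  by move=> i j; exact: measurableI.
apply/seteqP; split=> M /=; first by move=> [hB hC] i j; split.
by move=> h; split => i j; case: (h i j).
Qed.

Definition mxspace n p := g_sigma_algebraType (mxrect n p).
Arguments mxspace : clear implicits.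

Section entries.
Context d (T : measurableType d) {n p : nat}.

Definition mxmeas (f : T -> 'M[R]_(n, p)) :=
  forall i j, measurable_fun setT (fun x => f x i j).

Lemma mxmeasP (f : T -> 'M[R]_(n, p)) :
  mxmeas f -> measurable_fun setT (f : T -> mxspace n p).
Proof.
move=> mf; apply: (measurability (mxrect n p : set (set (mxspace n p)))) => // _ [_ [B mB ->]] <-.
rewrite setTI (_ : _ @^-1` _ = \bigcap_i \bigcap_j ((fun x => f x i j) @^-1` B i j)).
  apply: fin_bigcap_measurable => // i _; apply: fin_bigcap_measurable => // j _.
  by rewrite -[X in measurable X]setTI; exact: mf.
by apply/seteqP; split => x /= h; [move=> i _ j _|move=> i j]; exact: h.
Qed.

End entries.

Lemma mxmeas_id n p : @mxmeas _ (mxspace n p) n p id.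
Proof.
move=> i j _ B mB; rewrite setTI; apply: sub_sigma_algebra.
exists (fun i' j' => if (i' == i) && (j' == j) then B else setT).
  by move=> i' j'; case: ifP.
apply/seteqP; split=> M /=; last by move/(_ i j); rewrite !eqxx.
by move=> h i' j'; case: ifP => // /andP[/eqP -> /eqP ->].
Qed.

Section operations.
Context d (T : measurableType d).

Lemma mxmeas_comp d' (U : measurableType d') n p (f : T -> 'M[R]_(n, p)) (g : U -> T) :
  mxmeas f -> measurable_fun setT g -> mxmeas (f \o g).
Proof. by move=> mf mg i j; exact: (measurableT_comp (mf i j) mg). Qed.

Lemma mxmeas_cst n p (A : 'M[R]_(n, p)) : mxmeas (fun _ : T => A).
Proof. by move=> i j; exact: measurable_cst. Qed.

Lemma mxmeasD n p (f g : T -> 'M[R]_(n, p)) : mxmeas f -> mxmeas g ->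
  mxmeas (fun x => f x + g x).
Proof.
move=> mf mg i j; under [X in measurable_fun _ X]eq_fun do rewrite mxE.
exact: measurable_funD.
Qed.

Lemma mxmeasZ n p (a : T -> R) (f : T -> 'M[R]_(n, p)) :
  measurable_fun setT a -> mxmeas f -> mxmeas (fun x => a x *: f x).
Proof.
move=> ma mf i j; under [X in measurable_fun _ X]eq_fun do rewrite mxE.
exact: measurable_funM.
Qed.

Lemma mxmeasN n p (f : T -> 'M[R]_(n, p)) : mxmeas f -> mxmeas (fun x => - f x).
Proof.
move=> mf i j; under [X in measurable_fun _ X]eq_fun do rewrite mxE.
exact: measurableT_comp.
Qed.

Lemma mxmeasM n m p (f : T -> 'M[R]_(n, m)) (g : T -> 'M[R]_(m, p)) :
  mxmeas f -> mxmeas g -> mxmeas (fun x => f x *m g x).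
Proof.
move=> mf mg i j; under [X in measurable_fun _ X]eq_fun do rewrite mxE.
by apply: measurable_sum => l; exact: measurable_funM.
Qed.

Lemma mxmeas_tr n p (f : T -> 'M[R]_(n, p)) : mxmeas f -> mxmeas (fun x => (f x)^T).
Proof.
by move=> mf i j; under [X in measurable_fun _ X]eq_fun do rewrite mxE; exact: mf.
Qed.

Lemma mxmeas_row n p i (f : T -> 'M[R]_(n, p)) : mxmeas f ->
  mxmeas (fun x => row i (f x)).
Proof.
by move=> mf i0 j; under [X in measurable_fun _ X]eq_fun do rewrite mxE; exact: mf.
Qed.

Lemma mxmeas_sum n p I (s : seq I) (P : pred I) (f : I -> T -> 'M[R]_(n, p)) :
  (forall i, P i -> mxmeas (f i)) -> mxmeas (fun x => \sum_(i <- s | P i) f i x).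
Proof.
move=> mf; elim: s => [|a s IH].
  by under [X in mxmeas X]eq_fun do rewrite big_nil; exact: mxmeas_cst.
under [X in mxmeas X]eq_fun do rewrite big_cons.
by have [Pa|//] := boolP (P a); apply: mxmeasD => //; exact: mf.
Qed.

Lemma measurable_mxtrace p (f : T -> 'M[R]_p) : mxmeas f ->
  measurable_fun setT (fun x => \tr (f x)).
Proof. by move=> mf; rewrite /mxtrace; exact: measurable_sum. Qed.

Lemma measurable_det p (f : T -> 'M[R]_p) : mxmeas f ->
  measurable_fun setT (fun x => \det (f x)).
Proof.
move=> mf; rewrite /determinant; apply: measurable_sum => s.
apply: measurable_funM => //; apply: measurable_prod => i _; exact: mf.
Qed.

(** Cramer's rule. On a singular matrix [invmx] returns its argument, whence the distinction on the
    determinant. *)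
Lemma mxmeas_inv p (f : T -> 'M[R]_p) : mxmeas f -> mxmeas (fun x => invmx (f x)).
Proof.
move=> mf i j; have md := measurable_det mf.
have -> : (fun x => invmx (f x) i j) =
  (fun x => if \det (f x) == 0 then f x i j else (\det (f x))^-1 * cofactor (f x) j i).
  apply/funext => x; rewrite /invmx unitmxE unitfE.
  by case: eqP => //= _; rewrite !mxE.
apply: measurable_fun_ifT; [exact: measurable_fun_eqr|exact: mf|].
apply: measurable_funM; first exact: measurable_inv.
rewrite /cofactor; apply: measurable_funM => //; apply: measurable_det => i' j'.
by under [X in measurable_fun _ X]eq_fun do rewrite !mxE; exact: mf.
Qed.

Lemma measurable_qform p (f : T -> 'M[R]_p) (g : T -> 'rV[R]_p) :
  mxmeas f -> mxmeas g -> measurable_fun setT (fun x => qform (f x) (g x)).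
Proof.
move=> mf mg; have := mxmeasM (mxmeasM mg mf) (mxmeas_tr mg).
exact.
Qed.

Lemma mxmeas_wgram n p (w : 'I_n -> R) (f : T -> 'M[R]_(n, p)) :
  mxmeas f -> mxmeas (fun x => wgram w (f x)).
Proof.
move=> mf; apply: mxmeas_sum => i _; apply: mxmeasZ => //.
by apply: mxmeasM; [apply: mxmeas_tr|]; exact: mxmeas_row.
Qed.

Lemma mxmeas_wgram_but n p (w : 'I_n -> R) r (f : T -> 'M[R]_(n, p)) :
  mxmeas f -> mxmeas (fun x => wgram_but w (f x) r).
Proof.
move=> mf; apply: mxmeas_sum => i _; apply: mxmeasZ => //.
by apply: mxmeasM; [apply: mxmeas_tr|]; exact: mxmeas_row.
Qed.

End operations.

End measurable_matrices.
Arguments mxrect R n p _ : clear implicits.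
Arguments mxspace R n p : clear implicits.

(** * Expectations of bounded measurable functions *)

Section bounded_measurable.
Context d (T : measurableType d) {R : realType}.
Implicit Types f g : T -> R.

(** An algebra of functions that are all integrable, so that linearity of [Ex] requires no
    integrability argument at each use. *)
Definition bmeas f := measurable_fun setT f /\ exists K, forall x, `|f x| <= K.

Lemma bmeas_cst (c : R) : bmeas (fun=> c).
Proof. by split=> //; exists `|c|. Qed.

Lemma bmeasD f g : bmeas f -> bmeas g -> bmeas (fun x => f x + g x).
Proof.
move=> [mf [K hK]] [mg [L hL]]; split; first exact: measurable_funD.
by exists (K + L) => x; apply: (le_trans (ler_normD _ _)); exact: lerD.
Qed.

Lemma bmeasM f g : bmeas f -> bmeas g -> bmeas (fun x => f x * g x).
Proof.
move=> [mf [K hK]] [mg [L hL]]; split; first exact: measurable_funM.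
by exists (K * L) => x; rewrite normrM ler_pM.
Qed.

Lemma bmeasZ (c : R) f : bmeas f -> bmeas (fun x => c * f x).
Proof. by move=> bf; apply: bmeasM => //; exact: bmeas_cst. Qed.

Lemma bmeasB f g : bmeas f -> bmeas g -> bmeas (fun x => f x - g x).
Proof.
move=> bf /(bmeasZ (-1)) bg; have := bmeasD bf bg.
by under [X in bmeas X]eq_fun do rewrite mulN1r.
Qed.

Lemma bmeas_sum I (s : seq I) (f : I -> T -> R) :
  (forall i, bmeas (f i)) -> bmeas (fun x => \sum_(i <- s) f i x).
Proof.
move=> bf; elim: s => [|a s IH].
  by under [X in bmeas X]eq_fun do rewrite big_nil; exact: bmeas_cst.
by under [X in bmeas X]eq_fun do rewrite big_cons; exact: bmeasD.
Qed.

Lemma bmeas_expR f : bmeas f -> bmeas (fun x => expR (f x)).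
Proof.
move=> [mf [K hK]]; split; first exact: measurableT_comp mf.
exists (expR K) => x; rewrite ger0_norm ?expR_ge0// ler_expR.
exact: le_trans (ler_norm _) (hK x).
Qed.

Variable P : probability T R.

Definition Ex f : R := \int[P]_x f x.

Lemma bmeas_integrable f : bmeas f -> P.-integrable setT (EFin \o f).
Proof.
move=> [mf [K hK]]; apply: measurable_bounded_integrable => //.
  by rewrite [X in (X < _)%E](_ : _ = 1%E) ?ltry//; exact: probability_setT.
by exists K; split; [exact: num_real|move=> M KM x _; apply: le_trans (hK x) (ltW KM)].
Qed.

Lemma ExD f g : bmeas f -> bmeas g -> Ex (fun x => f x + g x) = Ex f + Ex g.
Proof. by move=> bf bg; rewrite /Ex RintegralD//; exact: bmeas_integrable. Qed.

Lemma ExZ (c : R) f : bmeas f -> Ex (fun x => c * f x) = c * Ex f.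
Proof. by move=> bf; rewrite /Ex RintegralZl//; exact: bmeas_integrable. Qed.

Lemma ExB f g : bmeas f -> bmeas g -> Ex (fun x => f x - g x) = Ex f - Ex g.
Proof. by move=> bf bg; rewrite /Ex RintegralB//; exact: bmeas_integrable. Qed.

Lemma Ex_cst (c : R) : Ex (fun=> c) = c.
Proof. by rewrite /Ex Rintegral_cst// [X in fine X](_ : _ = 1%E) ?mulr1//;
  exact: probability_setT. Qed.

Lemma Ex_le f g : bmeas f -> bmeas g -> (forall x, f x <= g x) -> Ex f <= Ex g.
Proof.
by move=> bf bg fg; apply: le_Rintegral => //; exact: bmeas_integrable.
Qed.

Lemma Ex_sum I (s : seq I) (f : I -> T -> R) : (forall i, bmeas (f i)) ->
  Ex (fun x => \sum_(i <- s) f i x) = \sum_(i <- s) Ex (f i).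
Proof.
move=> bf; elim: s => [|a s IH].
  by rewrite big_nil -[RHS]Ex_cst; congr Ex; apply/funext => x; rewrite big_nil.
rewrite big_cons -IH -ExD//; last exact: bmeas_sum.
by congr Ex; apply/funext => x; rewrite big_cons.
Qed.

Lemma Ex_norm_le f : bmeas f -> `|Ex f| <= Ex (fun x => `|f x|).
Proof. by move=> bf; apply: le_normr_Rintegral => //; exact: bmeas_integrable. Qed.

Lemma Ex_ge0_EFin f : bmeas f -> (Ex f)%:E = (\int[P]_x (f x)%:E)%E.
Proof.
by move=> /bmeas_integrable/integrable_fin_num h; rewrite /Ex /Rintegral fineK//; exact: h.
Qed.

Lemma bmeas_norm f : bmeas f -> bmeas (fun x => `|f x|).
Proof.
move=> [mf [K hK]]; split; first exact: measurableT_comp.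
by exists K => x; rewrite normr_id.
Qed.

Lemma probability_le_Ex (A : set T) f : measurable A -> bmeas f ->
  (forall x, 0 <= f x) -> (forall x, A x -> 1 <= f x) -> (P A <= (Ex f)%:E)%E.
Proof.
move=> mA bf f0 fA; rewrite Ex_ge0_EFin// -[X in (P X <= _)%E]setIT -integral_indic//.
apply: ge0_le_integral => //.
- exact/measurable_EFinP/measurable_indic.
- by apply/measurable_EFinP; case: bf.
move=> x _; rewrite lee_fin indicE; have [|] := boolP (x \in A); last by rewrite f0.
by rewrite inE => /fA.
Qed.

End bounded_measurable.

(** * Decoupling of independent entries *)

Section law_determined_by_rectangles.
Context {R : realType} {n p : nat}.

(** Uniqueness of measures on a pi-system, applied to the two image laws. The source spaces differ
    because a matrix on [Omega] is to be compared with one on its square. *)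
Lemma integral_eq_on_rect d1 d2 (X1 : measurableType d1) (X2 : measurableType d2)
    (mu1 : {measure set X1 -> \bar R}) (mu2 : {measure set X2 -> \bar R})
    (f1 : X1 -> mxspace R n p) (f2 : X2 -> mxspace R n p) :
  measurable_fun setT f1 -> measurable_fun setT f2 -> (mu1 setT < +oo)%E ->
  (forall A, mxrect R n p A -> mu1 (f1 @^-1` A) = mu2 (f2 @^-1` A)) ->
  forall F : mxspace R n p -> \bar R, measurable_fun setT F -> (forall M, 0 <= F M)%E ->
  (\int[mu1]_x F (f1 x) = \int[mu2]_x F (f2 x))%E.
Proof.
move=> mf1 mf2 fin12 h12 F mF F0.
pose m1 := measure_function_pushforward__canonical__measure_function_Measure mu1 mf1.
pose m2 := measure_function_pushforward__canonical__measure_function_Measure mu2 mf2.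
transitivity (\int[m1]_M F M)%E.
  by rewrite (ge0_integral_pushforward mf1)//= => y _; exact: F0.
transitivity (\int[m2]_M F M)%E; last first.
  by rewrite (ge0_integral_pushforward mf2)//= => y _; exact: F0.
apply: eq_measure_integral => A mA _.
apply: (measure_unique (mxrect R n p : set (set (mxspace R n p))) (fun=> setT)) => //.
- exact: mxrectI.
- by move=> _; exact: mxrectT.
- by rewrite bigcup_const//; exists 0%N.
Qed.

End law_determined_by_rectangles.

Section decoupling.
Context d (Omega : measurableType d) {R : realType} (P : probability Omega R).
Context {n p : nat} (Z : 'I_n -> 'I_p -> {RV P >-> R}).
Hypothesis Zind : mutual_independence (fun ij : 'I_n * 'I_p => Z ij.1 ij.2).

Definition mxrv w : 'M[R]_(n, p) := \matrix_(i, j) Z i j w.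

Definition resample (S : {set 'I_n * 'I_p}) (M N : 'M[R]_(n, p)) : 'M[R]_(n, p) :=
  \matrix_(i, j) if (i, j) \in S then N i j else M i j.

Lemma mxmeas_mxrv : mxmeas mxrv.
Proof.
move=> i j; under [X in measurable_fun _ X]eq_fun do rewrite mxE.
exact: measurable_funP.
Qed.

Lemma measurable_mxrv : measurable_fun setT (mxrv : Omega -> mxspace R n p).
Proof. exact/mxmeasP/mxmeas_mxrv. Qed.

Lemma mxmeas_resample d' (T : measurableType d') S (f g : T -> 'M[R]_(n, p)) :
  mxmeas f -> mxmeas g -> mxmeas (fun x => resample S (f x) (g x)).
Proof.
move=> mf mg i j; under [X in measurable_fun _ X]eq_fun do rewrite mxE.
by case: ((i, j) \in S); [exact: mg|exact: mf].
Qed.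

Lemma measurable_resample S : measurable_fun setT
  (fun x : mxspace R n p * Omega => resample S x.1 (mxrv x.2) : mxspace R n p).
Proof.
apply: mxmeasP; apply: mxmeas_resample.
  exact: mxmeas_comp (@mxmeas_id _ _ _) measurable_fst.
exact: mxmeas_comp mxmeas_mxrv measurable_snd.
Qed.

Lemma mxrv_rect (J : {set 'I_n * 'I_p}) (B : 'I_n -> 'I_p -> set R) :
  (forall i j, measurable (B i j)) ->
  P [set w | forall i j, (i, j) \in J -> B i j (Z i j w)] =
  (\prod_(ij in J) P (Z ij.1 ij.2 @^-1` B ij.1 ij.2))%E.
Proof.
move=> mB; rewrite -(Zind J (B := fun ij => B ij.1 ij.2))//.
congr (P _); apply/seteqP; split => w /= h; first by move=> [i j] /= ijJ; exact: h.
by move=> i j ijJ; exact: (h (i, j)).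
Qed.

Lemma measurable_mxrv_rect (J : {set 'I_n * 'I_p}) (B : 'I_n -> 'I_p -> set R) :
  (forall i j, measurable (B i j)) ->
  measurable [set w | forall i j, (i, j) \in J -> B i j (Z i j w)].
Proof.
move=> mB; rewrite (_ : [set _ | _] =
  \bigcap_(ij in [set` J]) (Z ij.1 ij.2 @^-1` B ij.1 ij.2)).
  by apply: fin_bigcap_measurable => // ij _; exact: measurable_funPTI.
apply/seteqP; split => w /= h; first by move=> [i j] /= ijJ; exact: h.
by move=> i j ijJ; exact: (h (i, j)).
Qed.

(* Redrawing the entries in [S] independently of the others does not change the
   law of the matrix. *)
Lemma decoupling_ge0 S (F : mxspace R n p -> \bar R) :
  measurable_fun setT F -> (forall M, 0 <= F M)%E ->
  (\int[P]_w F (mxrv w) =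
   \int[P]_w \int[P]_w' F (resample S (mxrv w) (mxrv w')))%E.
Proof.
move=> mF F0.
pose g := fun x : Omega * Omega => resample S (mxrv x.1) (mxrv x.2) : mxspace R n p.
have mg : measurable_fun setT g.
  apply: mxmeasP; apply: mxmeas_resample.
    exact: mxmeas_comp mxmeas_mxrv measurable_fst.
  exact: mxmeas_comp mxmeas_mxrv measurable_snd.
rewrite -(fubini_tonelli1 (F \o g)); first last.
- by move=> x; exact: F0.
- exact: measurableT_comp mF mg.
apply: (integral_eq_on_rect measurable_mxrv mg _ _ mF F0).
  by rewrite [X in (X < _)%E](_ : _ = 1%E) ?ltry//; exact: probability_setT.
move=> _ [B mB ->].
rewrite (_ : mxrv @^-1` _ = [set w | forall i j, (i, j) \in [set: 'I_n * 'I_p]%SET ->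
    B i j (Z i j w)]); last first.
  apply/seteqP; split=> w /= h i j; first by move=> _; have := h i j; rewrite mxE.
  by have := h i j (finset.in_setT _); rewrite mxE.
rewrite (_ : g @^-1` _ =
    [set w | forall i j, (i, j) \in ~: S -> B i j (Z i j w)] `*`
    [set w | forall i j, (i, j) \in S -> B i j (Z i j w)]); last first.
  apply/seteqP; split=> -[w w'] /=.
    move=> h; split=> i j; have := h i j; rewrite !mxE ?inE.
      by case: ifP.
    by case: ifP.
  by move=> [h1 h2] i j; rewrite !mxE; case: ifPn => ijS; [exact: h2|apply: h1; rewrite inE].
apply: esym; apply: etrans.
  by apply: product_measure1E; exact: measurable_mxrv_rect.
pose q ij := P (Z ij.1 ij.2 @^-1` B ij.1 ij.2).
transitivity ((\prod_(ij in ~: S) q ij) * (\prod_(ij in S) q ij))%E.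
  by congr (_ * _)%E; exact: mxrv_rect.
apply: esym; apply: (etrans (mxrv_rect [set: 'I_n * 'I_p]%SET mB)).
rewrite muleC (bigID (mem S))/=; congr (_ * _)%E; apply: eq_bigl => ij.
  by rewrite inE.
by rewrite !inE.
Qed.

(** A version of the conditional expectation given the entries outside [S], defined at every matrix
    and not only almost everywhere. *)
Definition redraw S (F : 'M[R]_(n, p) -> R) (M : 'M[R]_(n, p)) : R :=
  Ex P (fun w => F (resample S M (mxrv w))).

Lemma bmeas_resample S (F : mxspace R n p -> R) (M : 'M[R]_(n, p)) : bmeas F ->
  bmeas (fun w => F (resample S M (mxrv w))).
Proof.
move=> [mF [K hK]]; split; last by exists K.
apply: measurableT_comp mF _; apply: mxmeasP; apply: mxmeas_resample.
  exact: mxmeas_cst.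
exact: mxmeas_mxrv.
Qed.

Lemma bmeas_mxrv (F : mxspace R n p -> R) : bmeas F -> bmeas (fun w => F (mxrv w)).
Proof.
by move=> [mF [K hK]]; split; [exact: measurableT_comp mF measurable_mxrv|exists K].
Qed.

Lemma bmeas_redraw S (F : mxspace R n p -> R) : bmeas F ->
  bmeas (redraw S F : mxspace R n p -> R).
Proof.
move=> bF; have [mF [K hK]] := bF; split; last first.
  exists K => M; apply: (le_trans (Ex_norm_le _ (bmeas_resample S M bF))).
  rewrite -[leRHS](Ex_cst P); apply: Ex_le; [|exact: bmeas_cst|by []].
  exact/bmeas_norm/bmeas_resample.
(* Adding the bound [K] makes the integrand nonnegative, as Tonelli's theorem requires. *)
pose G := fun x : mxspace R n p * Omega => (F (resample S x.1 (mxrv x.2)) + K)%:E.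
have mG : measurable_fun setT G.
  apply/measurable_EFinP; apply: measurable_funD => //.
  exact: measurableT_comp mF (measurable_resample S).
have G0 x : (0 <= G x)%E.
  by rewrite lee_fin -lerBlDr sub0r; have := hK (resample S x.1 (mxrv x.2));
    rewrite ler_norml => /andP[].
have := measurable_fun_fubini_tonelli_F (m2 := P) G mG G0.
rewrite (_ : fubini_F P G = fun M => (redraw S F M + K)%:E); last first.
  apply/funext => M; rewrite /fubini_F /G /redraw -{2}(Ex_cst P K) -ExD ?Ex_ge0_EFin//.
  - by apply: bmeasD; [exact: bmeas_resample|exact: bmeas_cst].
  - exact: bmeas_resample.
  - exact: bmeas_cst.
move/measurable_EFinP => h.
rewrite (_ : redraw S F = fun M => redraw S F M + K - K); first exact: measurable_funB.
by apply/funext => M; rewrite addrK.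
Qed.

Lemma decoupling S (F : mxspace R n p -> R) : bmeas F ->
  Ex P (fun w => F (mxrv w)) = Ex P (fun w => redraw S F (mxrv w)).
Proof.
move=> bF; have [mF [K hK]] := bF.
have mG : measurable_fun setT (fun M : mxspace R n p => (F M + K)%:E).
  by apply/measurable_EFinP; exact: measurable_funD.
have G0 M : (0 <= (F M + K)%:E)%E.
  by rewrite lee_fin -lerBlDr sub0r; have := hK M; rewrite ler_norml => /andP[].
have := decoupling_ge0 S mG G0.
have bK f : bmeas f -> (\int[P]_w (f w + K)%:E = (Ex P f + K)%:E)%E.
  move=> bf; rewrite -{2}(Ex_cst P K) -ExD//; last exact: bmeas_cst.
  by rewrite Ex_ge0_EFin//; apply: bmeasD => //; exact: bmeas_cst.
rewrite bK; last exact: bmeas_mxrv.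
rewrite (eq_integral (fun w => (redraw S F (mxrv w) + K)%:E)); last first.
  by move=> w _; rewrite bK//; exact: bmeas_resample.
rewrite bK; last exact/bmeas_mxrv/bmeas_redraw.
by move=> [] /addIr.
Qed.

End decoupling.

(** * Bounded differences *)

Section bounded_differences.
Context d (Omega : measurableType d) {R : realType} (P : probability Omega R).
Context {n p : nat} (Z : 'I_n -> 'I_p -> {RV P >-> R}).
Hypothesis Zind : mutual_independence (fun ij : 'I_n * 'I_p => Z ij.1 ij.2).

Definition rowset (r : 'I_n) : {set 'I_n * 'I_p} := [set ij | ij.1 == r].

Lemma row_resample r i (M N : 'M[R]_(n, p)) :
  row i (resample (rowset r) M N) = row i (if i == r then N else M).
Proof. by apply/rowP => j; rewrite !mxE inE/=; case: eqP. Qed.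

(** [S] and [T] may overlap: on [S] the entries of [W] win on both sides. The identity moves a
    change of one row inside the redrawing of another. *)
Lemma resampleC S T (M N W : 'M[R]_(n, p)) :
  resample S (resample T M N) W = resample T (resample S M W) (resample S N W).
Proof. by apply/matrixP => i j; rewrite !mxE; do 2!case: ifP. Qed.

(** From [exp (-x) >= 1 - x] and [(1 - x) (1 + x + 2 x^2) = 1 + x^2 (1 - 2 x)]. *)
Lemma expR_le_quadratic (x : R) : x <= 2^-1 -> expR x <= 1 + x + 2 * x ^+ 2.
Proof.
move=> x2; have h := expR_ge1Dx (- x); have x1 : 0 < 1 - x by lra.
have : expR x <= (1 - x)^-1.
  by rewrite -[expR x]invrK -expRN lef_pV2 ?posrE ?expR_gt0.
move/le_trans; apply; rewrite -[leLHS]mul1r ler_pdivrMr//.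
have : 0 <= x ^+ 2 * (1 - 2 * x) by rewrite mulr_ge0 ?sqr_ge0//; lra.
by rewrite !mulrDl !mulrDr; lra.
Qed.

Variables (F : mxspace R n p -> R) (c : R).
Hypotheses (bF : bmeas F).
Hypothesis Fc : forall r M N N',
  `|F (resample (rowset r) M N) - F (resample (rowset r) M N')| <= c.

(** The Doob martingale of [F]: the rows in [rs] are averaged out, so the empty list gives [F] and
    the list of all rows gives its mean. *)
Let G rs : mxspace R n p -> R := foldr (fun r => redraw Z (rowset r)) F rs.

Let bG rs : bmeas (G rs).
Proof. by elim: rs => // r rs IH; exact: bmeas_redraw. Qed.

Let Gc rs r M N N' :
  `|G rs (resample (rowset r) M N) - G rs (resample (rowset r) M N')| <= c.
Proof.
elim: rs r M N N' => [|r' rs IH] r M N N'; first exact: Fc.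
rewrite /= -ExB//; [|exact: bmeas_resample..].
apply: (le_trans (Ex_norm_le _ _)).
  by apply: bmeasB => //; exact: bmeas_resample.
rewrite -[leRHS](Ex_cst P); apply: Ex_le; [|exact: bmeas_cst|].
  by apply/bmeas_norm/bmeasB => //; exact: bmeas_resample.
by move=> w; rewrite 2!(resampleC (rowset r')); exact: IH.
Qed.

Let G_depends rs (M M' : 'M[R]_(n, p)) :
  (forall i j, i \notin rs -> M i j = M' i j) -> G rs M = G rs M'.
Proof.
elim: rs M M' => [|r rs IH] M M' h; first by congr F; apply/matrixP => i j; exact: h.
rewrite /= /redraw; congr Ex; apply/funext => w; apply: IH => i j irs.
rewrite !mxE inE/=; case: eqP => // /eqP ir.
by apply: h; rewrite inE negb_or ir.
Qed.

Let EG rs : Ex P (fun w => G rs (mxrv Z w)) = Ex P (fun w => F (mxrv Z w)).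
Proof. by elim: rs => // r rs <-; rewrite /= -decoupling. Qed.

Let G_enum M : G (enum 'I_n) M = Ex P (fun w => F (mxrv Z w)).
Proof.
rewrite -(EG (enum 'I_n)) -[LHS](Ex_cst P); congr Ex; apply/funext => w.
by apply: G_depends => i j; rewrite mem_enum.
Qed.

(** The increment [X - m] is centred and bounded by [c], so in the quadratic bound for the
    exponential only [2 (s c)^2] survives the integration. *)
Let exp_step r rs s M : `|s| * c <= 2^-1 ->
  redraw Z (rowset r) (fun M => expR (s * G rs M)) M <=
  expR (2 * (s * c) ^+ 2) * expR (s * G (r :: rs) M).
Proof.
move=> sc; rewrite /redraw /=.
set X := fun w => G rs (resample (rowset r) M (mxrv Z w)).
have bX : bmeas X by exact: bmeas_resample.
set m := redraw Z _ _ _; have mE : m = Ex P X by [].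
have Xm w : `|X w - m| <= c.
  rewrite mE -(Ex_cst P (X w)) -ExB//; last exact: bmeas_cst.
  apply: (le_trans (Ex_norm_le _ _)); first by apply: bmeasB => //; exact: bmeas_cst.
  rewrite -[leRHS](Ex_cst P); apply: Ex_le; [|exact: bmeas_cst|].
    by apply/bmeas_norm/bmeasB => //; exact: bmeas_cst.
  by move=> w'; exact: Gc.
have c0 : 0 <= c by apply: le_trans (Xm point); exact: normr_ge0.
have h w : expR (s * X w) <= expR (s * m) * (1 + 2 * (s * c) ^+ 2 + s * (X w - m)).
  rewrite (_ : s * X w = s * m + s * (X w - m)); last by ring.
  rewrite expRD ler_wpM2l ?expR_ge0//.
  apply: (le_trans (expR_le_quadratic _)).
    apply: le_trans sc; apply: (le_trans (ler_norm _)).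
    by rewrite normrM ler_wpM2l.
  rewrite -addrA -[leRHS]addrA lerD2l addrC lerD2r ler_wpM2l//.
  by rewrite !exprMn ler_wpM2l ?sqr_ge0// -[_ ^+ 2]real_normK ?num_real// lerXn2r// ?nnegrE.
have bE : bmeas (fun w => expR (s * X w)) by exact/bmeas_expR/bmeasZ.
have bL : bmeas (fun w => s * (X w - m)) by apply/bmeasZ/bmeasB => //; exact: bmeas_cst.
apply: (@le_trans _ _ (Ex P (fun w => expR (s * m) * (1 + 2 * (s * c) ^+ 2 + s * (X w - m))))).
  apply: Ex_le => //; apply/bmeasZ/bmeasD => //; exact: bmeas_cst.
rewrite ExZ; last by apply: bmeasD => //; exact: bmeas_cst.
rewrite ExD//; last exact: bmeas_cst.
rewrite Ex_cst ExZ; last by apply: bmeasB => //; exact: bmeas_cst.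
rewrite ExB//; last exact: bmeas_cst.
by rewrite Ex_cst -mE subrr mulr0 addr0 mulrC ler_wpM2r ?expR_ge0// expR_ge1Dx.
Qed.

Lemma bounded_differences_mgf s : `|s| * c <= 2^-1 ->
  Ex P (fun w => expR (s * (F (mxrv Z w) - Ex P (fun w => F (mxrv Z w))))) <=
  expR (2 * (s * c) ^+ 2 * n%:R).
Proof.
move=> sc; set m := Ex P (fun w => F _).
have bE rs : bmeas (fun M => expR (s * G rs M) : R) by exact/bmeas_expR/bmeasZ.
have h rs : Ex P (fun w => expR (s * F (mxrv Z w))) <=
    expR (2 * (s * c) ^+ 2 * (size rs)%:R) * Ex P (fun w => expR (s * G rs (mxrv Z w))).
  elim: rs => [|r rs IH]; first by rewrite mulr0 expR0 mul1r.
  apply: (le_trans IH); rewrite (decoupling Zind (rowset r) (bE rs)).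
  apply: (@le_trans _ _ (expR (2 * (s * c) ^+ 2 * (size rs)%:R) *
      Ex P (fun w => expR (2 * (s * c) ^+ 2) * expR (s * G (r :: rs) (mxrv Z w))))).
    rewrite ler_wpM2l ?expR_ge0//; apply: Ex_le; last by move=> w; exact: exp_step.
      by apply: bmeas_mxrv; exact: bmeas_redraw.
    by apply: bmeasZ; exact: (bmeas_mxrv Z (bE (r :: rs))).
  rewrite ExZ; last exact: (bmeas_mxrv Z (bE (r :: rs))).
  rewrite mulrA -expRD (_ : _ + _ = 2 * (s * c) ^+ 2 * (size (r :: rs))%:R)//.
  by rewrite /= -natr1; ring.
have := h (enum 'I_n); rewrite size_enum_ord.
under [X in _ * Ex P X]eq_fun do rewrite G_enum.
rewrite Ex_cst -/m => hF.
rewrite (_ : (fun _ => _) = fun w => expR (- (s * m)) * expR (s * F (mxrv Z w))); last first.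
  by apply/funext => w; rewrite -expRD; congr expR; ring.
rewrite ExZ; last exact: (bmeas_mxrv Z (bE [::])).
rewrite -ler_pdivlMl ?expR_gt0// expRN invrK mulrC; exact: hF.
Qed.

Lemma bounded_differences_tail s eta : 0 <= s -> s * c <= 2^-1 ->
  (P [set w | eta <= `|F (mxrv Z w) - Ex P (fun w => F (mxrv Z w))|]%R <=
   (2 * expR (2 * (s * c) ^+ 2 * n%:R - s * eta))%:E)%E.
Proof.
move=> s0 sc; set m := Ex P (fun w => F _).
have bY : bmeas (fun w => F (mxrv Z w) - m).
  by apply: bmeasB; [exact: bmeas_mxrv|exact: bmeas_cst].
have mY := bY.1.
pose E1 w := expR (s * (F (mxrv Z w) - m)).
pose E2 w := expR ((- s) * (F (mxrv Z w) - m)).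
have b1 : bmeas E1 by exact/bmeas_expR/bmeasZ.
have b2 : bmeas E2 by exact/bmeas_expR/bmeasZ.
apply: (@le_trans _ _ (Ex P (fun w => expR (- (s * eta)) * (E1 w + E2 w)))%:E).
  apply: probability_le_Ex.
  - rewrite -[X in measurable X]setTI; apply: (measurable_fun_ler _ _ measurableT (Y := [set
    true])) => //.
    exact: measurableT_comp.
  - exact/bmeasZ/bmeasD.
  - by move=> w; rewrite mulr_ge0 ?expR_ge0// addr_ge0 ?expR_ge0.
  move=> w /= hw; rewrite expRN mulrC ler_pdivlMr ?expR_gt0// mul1r.
  move: hw; rewrite ler_normr => /orP[] hw.
    by rewrite -[leLHS]addr0 lerD ?expR_ge0// ler_expR ler_wpM2l.
  by rewrite -[leLHS]add0r lerD ?expR_ge0// ler_expR mulNr -mulrN ler_wpM2l.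
rewrite lee_fin ExZ; last exact: bmeasD.
rewrite ExD// [_ - s * eta]addrC expRD mulrCA ler_wpM2l ?expR_ge0//.
rewrite [leRHS]mulr_natl mulr2n lerD//; first by apply: bounded_differences_mgf; rewrite ger0_norm.
by rewrite -(sqrrN (s * c)) -mulNr; apply: bounded_differences_mgf; rewrite normrN ger0_norm.
Qed.

(** The first absolute moment follows directly from the exponential moments at [s] and [-s], by
    [|y| <= exp y + exp (-y)]. *)
Lemma bounded_differences_L1 s : 0 < s -> s * c <= 2^-1 ->
  Ex P (fun w => `|F (mxrv Z w) - Ex P (fun w => F (mxrv Z w))|) <=
  2 * expR (2 * (s * c) ^+ 2 * n%:R) / s.
Proof.
move=> s0 sc; set m := Ex P (fun w => F _).
have bY : bmeas (fun w => F (mxrv Z w) - m).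
  by apply: bmeasB; [exact: bmeas_mxrv|exact: bmeas_cst].
pose E1 w := expR (s * (F (mxrv Z w) - m)).
pose E2 w := expR ((- s) * (F (mxrv Z w) - m)).
have b1 : bmeas E1 by exact/bmeas_expR/bmeasZ.
have b2 : bmeas E2 by exact/bmeas_expR/bmeasZ.
rewrite ler_pdivlMr// mulrC -ExZ; last exact: bmeas_norm.
apply: (@le_trans _ _ (Ex P (fun w => E1 w + E2 w))).
  apply: Ex_le; [exact/bmeasZ/bmeas_norm|exact: bmeasD|move=> w].
  rewrite /E1 /E2 mulNr; set y := s * _.
  have -> : s * `|F (mxrv Z w) - m| = `|y| by rewrite normrM gtr0_norm.
  have h1 := expR_ge1Dx y; have h2 := expR_ge1Dx (- y).
  have h3 := expR_ge0 y; have h4 := expR_ge0 (- y).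
  by rewrite ler_norml; apply/andP; split; lra.
rewrite ExD// [leRHS]mulr_natl mulr2n lerD//; first by apply: bounded_differences_mgf;
  rewrite gtr0_norm.
by rewrite -(sqrrN (s * c)) -mulNr; apply: bounded_differences_mgf; rewrite normrN gtr0_norm.
Qed.

End bounded_differences.

(** * Variance of quadratic forms *)

Section entry_moments.
Context d (Omega : measurableType d) {R : realType} (P : probability Omega R).

Lemma ge0_integral_law (law : probability R R) (X : {RV P >-> R}) (f : R -> \bar R) :
  (forall B, measurable B -> distribution P X B = law B) ->
  measurable_fun setT f -> (forall x, 0 <= f x)%E ->
  (\int[P]_w f (X w) = \int[law]_x f x)%E.
Proof.
move=> hX mf f0; rewrite -(ge0_integral_distribution X mf f0).
by apply: eq_measure_integral => A mA _; exact: hX.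
Qed.

Lemma le_integral_EFin (f g : Omega -> R) : measurable_fun setT f ->
  measurable_fun setT g -> (forall w, 0 <= f w) -> (forall w, f w <= g w) ->
  (\int[P]_w (f w)%:E <= \int[P]_w (g w)%:E)%E.
Proof.
move=> mf mg f0 fg; apply: ge0_le_integral => //.
- by move=> w _; rewrite lee_fin.
- exact/measurable_EFinP.
- exact/measurable_EFinP.
by move=> w _; rewrite lee_fin.
Qed.

Lemma integral_EFinD (f g : Omega -> R) : measurable_fun setT f ->
  measurable_fun setT g -> (forall w, 0 <= f w) -> (forall w, 0 <= g w) ->
  (\int[P]_w (f w + g w)%:E = \int[P]_w (f w)%:E + \int[P]_w (g w)%:E)%E.
Proof.
move=> mf mg f0 g0; under eq_integral do rewrite EFinD.
by rewrite ge0_integralD//; solve [by move=> w _; rewrite lee_fin|exact/measurable_EFinP].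
Qed.

Lemma integral_EFin_cst (r : R) : (\int[P]_w (r%:E) = r%:E)%E.
Proof.
rewrite integral_cst// [X in (_ * X)%E](_ : _ = 1%E) ?mule1//.
exact: probability_setT.
Qed.

Lemma integral_EFinZ (r : R) (f : Omega -> R) : measurable_fun setT f ->
  (forall w, 0 <= f w) -> 0 <= r ->
  (\int[P]_w (r * f w)%:E = r%:E * \int[P]_w (f w)%:E)%E.
Proof.
move=> mf f0 r0; under eq_integral do rewrite EFinM.
by rewrite ge0_integralZl//; [exact/measurable_EFinP|move=> w _; rewrite lee_fin].
Qed.

End entry_moments.

Section quadratic_form_moments.
Context d (Omega : measurableType d) {R : realType} (P : probability Omega R).
Context {n p : nat} (Z : 'I_n -> 'I_p -> {RV P >-> R}).
Hypothesis Zind : mutual_independence (fun ij : 'I_n * 'I_p => Z ij.1 ij.2).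
Variable m4 : R.
Hypothesis m4_ge0 : 0 <= m4.
(* What the moments of an entry [z] are used for: [E z = 0], [E z^2 = 1] and
   [E (z^2 - 1)^2 <= m4]. *)
Hypothesis Zmom : forall i j (x y t : R),
  (\int[P]_w ((x + y * Z i j w + t * (Z i j w ^+ 2 - 1)) ^+ 2)%:E <=
   (x ^+ 2 + 2 * y ^+ 2 + 2 * m4 * t ^+ 2)%:E)%E.

Let E (F : mxspace R n p -> R) : \bar R := (\int[P]_w (F (mxrv Z w))%:E)%E.

Let mZ (F : mxspace R n p -> R) : measurable_fun setT F ->
  measurable_fun setT (fun w => F (mxrv Z w)).
Proof. by move=> mF; exact: measurableT_comp mF (measurable_mxrv Z). Qed.

(** An estimate may be proved with all entries outside [S] frozen. The integrals are extended-valued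
    because squares of quadratic forms are unbounded. *)
Lemma integral_redraw_le S (F G : mxspace R n p -> R) :
  measurable_fun setT F -> measurable_fun setT G -> (forall M, 0 <= F M) ->
  (forall M, (\int[P]_w (F (resample S M (mxrv Z w)))%:E <= (G M)%:E)%E) ->
  (E F <= E G)%E.
Proof.
move=> mF mG F0 FG; rewrite /E.
rewrite (decoupling_ge0 Zind S (F := fun M => (F M)%:E))//; last exact/measurable_EFinP.
apply: ge0_le_integral => //.
- move=> w _; apply: integral_ge0 => w' _; rewrite lee_fin; exact: F0.
- pose H := fun x : Omega * Omega => (F (resample S (mxrv Z x.1) (mxrv Z x.2)))%:E.
  apply: (measurable_fun_fubini_tonelli_F (m2 := P) H).
    apply/measurable_EFinP; apply: measurableT_comp mF _.
    apply: mxmeasP; apply: mxmeas_resample.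
      exact: mxmeas_comp (mxmeas_mxrv Z) measurable_fst.
    exact: mxmeas_comp (mxmeas_mxrv Z) measurable_snd.
  by move=> x; rewrite lee_fin.
by apply/measurable_EFinP; exact: mZ.
Qed.

Let mentry i j : measurable_fun setT (fun M : mxspace R n p => M i j).
Proof. exact: mxmeas_id. Qed.

Let resample1 r c (M N : 'M[R]_(n, p)) j :
  resample [set (r, c)] M N r j = if j == c then N r j else M r j.
Proof. by rewrite mxE !inE xpair_eqE eqxx. Qed.

Let linf r (b : 'I_p -> R) s (M : mxspace R n p) := \sum_(j <- s) b j * M r j.

Let mlinf r b s : measurable_fun setT (linf r b s).
Proof. by apply: measurable_sum => j; exact: measurable_funM. Qed.

Let linf_cons r b c s M : linf r b (c :: s) M = b c * M r c + linf r b s M.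
Proof. by rewrite /linf big_cons. Qed.

Let linf_resample r b c s M N : c \notin s ->
  linf r b s (resample [set (r, c)] M N) = linf r b s M.
Proof.
move=> cs; rewrite /linf; apply: eq_big_seq => j js; rewrite resample1.
by case: eqP => // jc; rewrite -jc js in cs.
Qed.

Let linf_sqr r b s : uniq s ->
  (E (fun M => (linf r b s M ^+ 2)%R) <= (2 * \sum_(j <- s) b j ^+ 2)%:E)%E.
Proof.
elim: s => [_|c s IH /= /andP[cs us]].
  rewrite big_nil mulr0 /E; under eq_integral do rewrite /linf big_nil expr0n/=.
  by rewrite integral0.
apply: (@le_trans _ _ (E (fun M => linf r b s M ^+ 2 + 2 * b c ^+ 2))).
  apply: (@integral_redraw_le [set (r, c)]).
  - exact: measurable_funX.
  - by apply: measurable_funD => //; exact: measurable_funX.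
  - by move=> M; exact: sqr_ge0.
  move=> M; have := Zmom r c (linf r b s M) (b c) 0.
  rewrite expr0n/= mulr0 addr0; apply: le_trans.
  rewrite le_eqVlt; apply/orP; left; apply/eqP; apply: eq_integral => w _.
  rewrite linf_cons linf_resample// resample1 eqxx mxE.
  by rewrite mul0r addr0 addrC.
rewrite /E integral_EFinD//; first last.
- by move=> w; rewrite mulr_ge0// sqr_ge0.
- by move=> w; exact: sqr_ge0.
- by apply: measurable_funX; exact: mZ.
rewrite integral_EFin_cst big_cons mulrDr addrC EFinD leeD2l//.
exact: IH.
Qed.

Let quadf r (B : 'M[R]_p) s (M : mxspace R n p) :=
  \sum_(i <- s) (\sum_(j <- s) M r i * B i j * M r j - B i i).

Let mquadf r B s : measurable_fun setT (quadf r B s).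
Proof.
apply: measurable_sum => i; apply: measurable_funB => //.
apply: measurable_sum => j; apply: measurable_funM => //.
exact: measurable_funM.
Qed.

Let quadf_resample r B c s M N : c \notin s ->
  quadf r B s (resample [set (r, c)] M N) = quadf r B s M.
Proof.
move=> cs; have h j : j \in s -> (j == c) = false.
  by move=> js; apply: contraNF cs => /eqP <-.
rewrite /quadf; apply: eq_big_seq => i js; congr (_ - _).
by apply: eq_big_seq => j js'; rewrite !resample1 !h.
Qed.

(** One more entry [z] produces exactly the polynomial [x + y z + t (z^2 - 1)] of [Zmom], where [x]
    and [y] depend only on the entries in [s]. *)
Let quadf_cons r B c s M : B^T = B -> quadf r B (c :: s) M =
  quadf r B s M + 2 * linf r (B c) s M * M r c + B c c * (M r c ^+ 2 - 1).
Proof.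
move=> sB; rewrite /quadf big_cons big_cons.
under [X in _ + X = _]eq_bigr do rewrite big_cons -addrA.
rewrite big_split/= -/(quadf r B s M).
have -> : \sum_(i <- s) M r i * B i c * M r c = linf r (B c) s M * M r c.
  rewrite /linf mulr_suml; apply: eq_bigr => i _.
  by rewrite -{1}sB mxE [M r i * _]mulrC.
have -> : \sum_(j <- s) M r c * B c j * M r j = linf r (B c) s M * M r c.
  by rewrite /linf mulr_suml; apply: eq_bigr => i _; ring.
by ring.
Qed.

(** A new entry costs 16 times each [B c j ^+ 2], that is 8 for each of the two symmetric positions,
    and [2 m4] at the diagonal position. *)
Let C := 8 + 2 * m4.

Let quadf_sqr r B x s : B^T = B -> uniq s ->
  (E (fun M => ((x + quadf r B s M) ^+ 2)%R) <=
   (x ^+ 2 + C * \sum_(i <- s) \sum_(j <- s) B i j ^+ 2)%:E)%E.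
Proof.
move=> sB; elim: s => [_|c s IH /= /andP[cs us]].
  rewrite big_nil mulr0 /E addr0.
  under eq_integral do rewrite /quadf big_nil addr0.
  by rewrite integral_EFin_cst.
pose G M := (x + quadf r B s M) ^+ 2 + (8 * linf r (B c) s M ^+ 2 + 2 * m4 * B c c ^+ 2).
have mG1 : measurable_fun setT (fun M => (x + quadf r B s M) ^+ 2).
  by apply: measurable_funX; exact: measurable_funD.
have mG2 : measurable_fun setT (fun M => 8 * linf r (B c) s M ^+ 2).
  by apply: measurable_funM => //; exact: measurable_funX.
apply: (@le_trans _ _ (E G)).
  apply: (@integral_redraw_le [set (r, c)]).
  - by apply: measurable_funX; exact: measurable_funD.
  - by apply: measurable_funD => //; exact: measurable_funD.
  - by move=> M; exact: sqr_ge0.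
  move=> M; have := Zmom r c (x + quadf r B s M) (2 * linf r (B c) s M) (B c c).
  rewrite /G (_ : 8 * linf r (B c) s M ^+ 2 = 2 * (2 * linf r (B c) s M) ^+ 2); last by ring.
  rewrite addrA; apply: le_trans.
  rewrite le_eqVlt; apply/orP; left; apply/eqP; apply: eq_integral => w _.
  rewrite quadf_cons// quadf_resample// linf_resample// resample1 eqxx mxE.
  by rewrite !addrA.
have p1 w : 0 <= (x + quadf r B s (mxrv Z w)) ^+ 2 by exact: sqr_ge0.
have p2 w : 0 <= 8 * linf r (B c) s (mxrv Z w) ^+ 2 by rewrite mulr_ge0 ?sqr_ge0.
have p3 : 0 <= 2 * m4 * B c c ^+ 2 by rewrite mulr_ge0 ?sqr_ge0// mulr_ge0.
rewrite /E /G integral_EFinD//; first last.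
- by move=> w; exact: addr_ge0.
- by apply: measurable_funD => //; exact: (mZ mG2).
- exact: (mZ mG1).
rewrite integral_EFinD//; last exact: (mZ mG2).
rewrite integral_EFin_cst integral_EFinZ//; last 2 first.
- by apply: measurable_funX; exact: mZ.
- by move=> w; exact: sqr_ge0.
have h1 := IH us.
have h2 : ((8 : R)%R%:E * E (fun M => (linf r (B c) s M ^+ 2)%R) <=
    (16 * \sum_(j <- s) B c j ^+ 2)%:E)%E.
  apply: (@le_trans _ _ ((8 : R)%R%:E * (2 * \sum_(j <- s) B c j ^+ 2)%:E)%E).
    by rewrite lee_pmul2l//; exact: linf_sqr.
  by rewrite -EFinM lee_fin; lra.
apply: (le_trans (leeD h1 (leeD h2 (lexx _)))).
rewrite -!EFinD lee_fin big_cons big_cons.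
under [X in _ <= _ + C * (_ + X)]eq_bigr do rewrite big_cons.
rewrite big_split/=.
have -> : \sum_(i <- s) B i c ^+ 2 = \sum_(j <- s) B c j ^+ 2.
  by apply: eq_bigr => i _; rewrite -{1}sB mxE.
set T := \sum_(j <- s) B c j ^+ 2; set U := \sum_(i <- s) _.
have T0 : 0 <= T by apply: sumr_ge0 => i _; exact: sqr_ge0.
have mT : 0 <= m4 * T by rewrite mulr_ge0.
have b0 : 0 <= B c c ^+ 2 by exact: sqr_ge0.
by rewrite /C !mulrDl !mulrDr; lra.
Qed.

(** The free constant [x] lets one estimate serve for fluctuations ([x = 0]), second moments
    ([x = \tr B]), one-sided bounds, and sums over several rows. *)
Lemma qform_row_variance r (B : 'M[R]_p) x : B^T = B ->
  (\int[P]_w ((x + (qform B (row r (mxrv Z w)) - \tr B)) ^+ 2)%:E <=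
   (x ^+ 2 + (8 + 2 * m4) * \tr (B *m B))%:E)%E.
Proof.
move=> sB; have := quadf_sqr r x sB (index_enum_uniq 'I_p).
rewrite mxtrace_sqr//; apply: le_trans.
rewrite le_eqVlt; apply/orP; left; apply/eqP; apply: eq_integral => w _.
rewrite /quadf big_split/= sumrN qformE.
by congr (((_ + (_ - _)) ^+ 2)%:E); apply: eq_bigr => i _; apply: eq_bigr => j _; rewrite !mxE.
Qed.

Let mqf (B : mxspace R n p -> 'M[R]_p) r : mxmeas B -> measurable_fun setT
  (fun M : mxspace R n p => qform (B M) (row r M) - \tr (B M)).
Proof.
move=> mB; apply: measurable_funB; last exact: measurable_mxtrace.
by apply: measurable_qform => //; apply: mxmeas_row; exact: mxmeas_id.
Qed.

(** As [B] ignores the rows in [s], the terms behave as orthogonal ones: redrawing row [r], with the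
    sum over the other rows frozen as [x], adds only the variance of its own term. *)
Lemma sum_qform_variance (s : seq 'I_n) (w : 'I_n -> R) (b T : R)
    (B : mxspace R n p -> 'M[R]_p) : uniq s -> mxmeas B ->
  (forall M, (B M)^T = B M) -> (forall M, \tr (B M *m B M) <= T) ->
  (forall r M N, r \in s -> B (resample (rowset r) M N) = B M) ->
  (forall r, 0 <= w r <= b) ->
  (\int[P]_om ((\sum_(r <- s) w r * (qform (B (mxrv Z om)) (row r (mxrv Z om)) -
      \tr (B (mxrv Z om)))) ^+ 2)%:E <=
   ((size s)%:R * (b ^+ 2 * ((8 + 2 * m4) * T)))%:E)%E.
Proof.
move=> us mB sB BT; elim: s us => [_ _ _|r s IH /= /andP[rs us] Bs wb].
  rewrite mul0r; under eq_integral do rewrite big_nil expr0n/=.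
  by rewrite integral0.
pose D M := \sum_(r <- s) w r * (qform (B M) (row r M) - \tr (B M)).
have mD : measurable_fun setT (D : mxspace R n p -> R).
  by apply: measurable_sum => i; apply: measurable_funM => //; exact: mqf.
have /andP[wr0 wrb] := wb r.
have b0 : 0 <= b ^+ 2 by exact: sqr_ge0.
have C0 : 0 <= C by rewrite addr_ge0// mulr_ge0.
have K0 : 0 <= b ^+ 2 * (C * T).
  by rewrite mulr_ge0// mulr_ge0//; apply: le_trans (BT 0); exact: mxtrace_sqr_ge0.
apply: (@le_trans _ _ (E (fun M => D M ^+ 2 + b ^+ 2 * (C * T)))).
  under eq_integral do rewrite big_cons -/(D _).
  apply: (@integral_redraw_le (rowset r) (fun M => (w r * (qform (B M) (row r M) - \tr (B M)) +
    D M) ^+ 2)).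
  - apply: measurable_funX; apply: measurable_funD => //.
    by apply: measurable_funM => //; exact: mqf.
  - by apply: measurable_funD => //; exact: measurable_funX.
  - by move=> M; exact: sqr_ge0.
  move=> M.
  have sB' : (w r *: B M)^T = w r *: B M by rewrite linearZ/= sB.
  have := qform_row_variance r (D M) sB'.
  rewrite -scalemxAl -scalemxAr !mxtraceZ => h.
  apply: le_trans (le_trans h _); last first.
    rewrite lee_fin lerD2l -/C mulrA mulrA [C * w r * w r](_ : _ = w r ^+ 2 * C); last by ring.
    rewrite -mulrA ler_pM//.
    - exact: sqr_ge0.
    - by rewrite mulr_ge0//; exact: mxtrace_sqr_ge0.
    - by rewrite lerXn2r// nnegrE// (le_trans wr0).
    - by rewrite ler_wpM2l.
  rewrite le_eqVlt; apply/orP; left; apply/eqP; apply: eq_integral => om _.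
  rewrite Bs ?mem_head// row_resample eqxx qformZ -mulrBr addrC.
  congr (((_ + _) ^+ 2)%:E); apply: eq_big_seq => i js.
  rewrite Bs ?mem_head// row_resample; case: eqP => // ir.
  by rewrite -ir js in rs.
rewrite /E integral_EFinD//; last 2 first.
- by apply: measurable_funX; exact: mZ.
- by move=> om; exact: sqr_ge0.
rewrite integral_EFin_cst [X in (_ <= X%:E)%E](_ : _ =
  (size s)%:R * (b ^+ 2 * (C * T)) + b ^+ 2 * (C * T)); last first.
  by rewrite /C /= -natr1; ring.
rewrite EFinD leeD2r//.
by apply: IH => // i M N js; apply: Bs; rewrite inE js orbT.
Qed.

End quadratic_form_moments.

(** * Moment bounds for the law of one entry *)

Section moments_of_law.
Context {R : realType} (law : probability R R) (c : R).
Hypotheses (c0 : 0 < c)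
  (law0 : ('E_law[fun z => z] = 0)%E) (law1 : ('V_law[fun z => z] = 1)%E)
  (law8 : ('E_law[fun z => (`|z| `^ (8 + c))%R] < +oo)%E).

Let integrable8 : law.-integrable setT (fun z : R => (z ^+ 8)%:E).
Proof.
have h : law.-integrable setT (fun z : R => (1 + `|z| `^ (8 + c))%:E).
  under [X in law.-integrable _ X]eq_fun do rewrite EFinD.
  apply: integrableD => //; first exact: finite_measure_integrable_cst.
  apply/integrableP; split.
    apply/measurable_EFinP; apply: measurableT_comp (@measurable_powR R _) _.
    exact: normr_measurable.
  move: law8; rewrite unlock; congr (_ < _)%E; apply: eq_integral => z _.
  by rewrite gee0_abs// lee_fin powR_ge0.
apply: le_integrable h => //.
  by apply/measurable_EFinP; exact: measurable_funX.
move=> z _; rewrite !abse_EFin lee_fin normrX.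
rewrite (ger0_norm (_ : 0 <= 1 + _)); last by rewrite addr_ge0// powR_ge0.
rewrite -powR_mulrn//; have [z1|z1] := lerP `|z| 1.
  rewrite powR_mulrn// -[leLHS]addr0 lerD ?powR_ge0//.
  by rewrite exprn_ile1.
by rewrite -[leLHS]add0r lerD// ler_powR// ?lerDl ltW.
Qed.

Let integrableX k : (k <= 8)%N -> law.-integrable setT (fun z : R => (z ^+ k)%:E).
Proof.
move=> k8; have h : law.-integrable setT (fun z : R => (1 + z ^+ 8)%:E).
  under [X in law.-integrable _ X]eq_fun do rewrite EFinD.
  apply: integrableD => //; exact: finite_measure_integrable_cst.
apply: le_integrable h => //.
  by apply/measurable_EFinP; exact: measurable_funX.
move=> z _; rewrite !abse_EFin lee_fin.
have z8 : 0 <= z ^+ 8 by rewrite (exprM z 2 4) exprn_ge0// sqr_ge0.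
rewrite (ger0_norm (_ : 0 <= 1 + _)); last by rewrite addr_ge0.
rewrite -(ger0_norm z8) !normrX; have [z1|z1] := lerP `|z| 1.
  by rewrite -[leLHS]addr0 lerD ?exprn_ge0// exprn_ile1.
by rewrite -[leLHS]add0r lerD// ler_eXn2l// ltW.
Qed.

Let m1 : \int[law]_z z = 0.
Proof. by have := law0; rewrite unlock /Rintegral => ->. Qed.

Let m2 : \int[law]_z (z ^+ 2) = 1.
Proof.
have := law1; rewrite /variance unlock law0/= unlock => h.
by rewrite /Rintegral -[RHS]/(fine 1) -h; congr fine; apply: eq_integral => z _;
  rewrite -[RHS]/(((z - 0) * (z - 0))%:E) subr0 expr2.
Qed.

(** The product of [y z] and [t (z^2 - 1)] involves the third moment; it is removed by
    [2 u v <= u^2 + v^2], at the price of the two factors 2. The remaining first-order terms have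
    mean 0. *)
Lemma law_moments : exists2 m4 : R, 0 <= m4 & forall x y t,
  (\int[law]_z ((x + y * z + t * (z ^+ 2 - 1)) ^+ 2)%:E <=
   (x ^+ 2 + 2 * y ^+ 2 + 2 * m4 * t ^+ 2)%:E)%E.
Proof.
exists (\int[law]_z ((z ^+ 2 - 1) ^+ 2)).
  by apply: Rintegral_ge0 => z _; exact: sqr_ge0.
move=> x y t.
have i1 : law.-integrable setT (fun z : R => (y * z)%:E).
  under [X in law.-integrable _ X]eq_fun do rewrite EFinM.
  by apply: integrableZl => //; have := integrableX (isT : (1 <= 8)%N).
have icst (k : R) : law.-integrable setT (fun z : R => k%:E).
  exact: finite_measure_integrable_cst.
have i2 : law.-integrable setT (fun z : R => (z ^+ 2)%:E) by exact: integrableX.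
have i22 : law.-integrable setT (fun z : R => (z ^+ 2 - 1)%:E).
  under [X in law.-integrable _ X]eq_fun do rewrite EFinB.
  exact: integrableB.
have i4 : law.-integrable setT (fun z : R => ((z ^+ 2 - 1) ^+ 2)%:E).
  have -> : (fun z : R => ((z ^+ 2 - 1) ^+ 2)%:E) =
      (fun z : R => (z ^+ 4)%:E + ((-2)%:E * (z ^+ 2)%:E + 1%:E))%E.
    by apply/funext => z; rewrite -EFinM -!EFinD; congr EFin; ring.
  apply: integrableD => //; first exact: integrableX.
  by apply: integrableD => //; exact: integrableZl.
pose f z : R := x ^+ 2 + (2 * x * y * z + (2 * x * t * (z ^+ 2 - 1) +
  (2 * y ^+ 2 * z ^+ 2 + 2 * t ^+ 2 * (z ^+ 2 - 1) ^+ 2))).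
have iZ (k : R) (g : R -> R) : law.-integrable setT (EFin \o g) ->
    law.-integrable setT (EFin \o (fun z => k * g z)).
  move=> ig; rewrite /comp; under [X in law.-integrable _ X]eq_fun do rewrite EFinM.
  exact: integrableZl.
have iD (g h : R -> R) : law.-integrable setT (EFin \o g) ->
    law.-integrable setT (EFin \o h) -> law.-integrable setT (EFin \o (fun z => g z + h z)).
  move=> ig ih; rewrite /comp; under [X in law.-integrable _ X]eq_fun do rewrite EFinD.
  exact: integrableD.
have i0 : law.-integrable setT (EFin \o (fun z : R => z)).
  by have := integrableX (isT : (1 <= 8)%N).
have if1 : law.-integrable setT (EFin \o (fun z => 2 * x * y * z)) by exact: iZ.
have if2 : law.-integrable setT (EFin \o (fun z : R => 2 * x * t * (z ^+ 2 - 1))) by exact: iZ.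
have if3 : law.-integrable setT (EFin \o (fun z : R => 2 * y ^+ 2 * z ^+ 2)) by exact: iZ.
have if4 : law.-integrable setT (EFin \o (fun z : R => 2 * t ^+ 2 * (z ^+ 2 - 1) ^+ 2)).
  exact: (iZ (2 * t ^+ 2) (fun z => (z ^+ 2 - 1) ^+ 2)).
have if34 := iD _ _ if3 if4; have if234 := iD _ _ if2 if34.
have if1234 := iD _ _ if1 if234.
have if_ : law.-integrable setT (EFin \o f).
  exact: (iD (fun=> x ^+ 2) _ (icst _) if1234).
apply: (@le_trans _ _ (\int[law]_z (f z)%:E)%E).
  apply: le_integral_EFin.
  - apply: measurable_funX; apply: measurable_funD.
      by apply: measurable_funD => //; exact: measurable_funM.
    by apply: measurable_funM => //; apply: measurable_funB => //; exact: measurable_funX.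
  - by apply/measurable_EFinP; exact: measurable_int if_.
  - by move=> z; exact: sqr_ge0.
  move=> z; rewrite /f.
  by have := sqr_ge0 (y * z - t * (z ^+ 2 - 1)); nra.
have -> : (\int[law]_z (f z)%:E = (\int[law]_z f z)%R%:E)%E.
  by rewrite /Rintegral fineK//; exact: integrable_fin_num.
rewrite lee_fin /f (RintegralD measurableT (icst _) if1234).
rewrite (RintegralD measurableT if1 if234) (RintegralD measurableT if2 if34).
rewrite (RintegralD measurableT if3 if4).
have cE (k : R) : \int[law]_z k = k.
  by rewrite Rintegral_cst// [X in fine X](_ : _ = 1%E) ?mulr1//; exact: probability_setT.
have e2 : \int[law]_z (z ^+ 2 - 1) = 0.
  by rewrite (RintegralB measurableT i2 (icst 1)) m2 cE subrr.
rewrite (RintegralZl _ measurableT i0) m1 (RintegralZl _ measurableT i22) e2.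
rewrite (RintegralZl _ measurableT i2) m2 (RintegralZl _ measurableT i4) cE.
by rewrite le_eqVlt; apply/orP; left; apply/eqP; ring.
Qed.

End moments_of_law.

(** * The trace of the ridge resolvent *)

Section ridge_trace.
Context {R : realType} {n p : nat} (w : 'I_n -> R) (e : R).
Hypotheses (w0 : forall i, 0 <= w i) (e0 : 0 < e).
Implicit Types M N : 'M[R]_(n, p).

Definition ridge_inv (M : 'M[R]_(n, p)) : 'M[R]_p := invmx (wgram w M + e%:M).
Definition ridge_inv_but r (M : 'M[R]_(n, p)) : 'M[R]_p :=
  invmx (wgram_but w M r + e%:M).
Definition ridge_tr M := \tr (ridge_inv M).

Lemma wgram_but_resample r M N :
  wgram_but w (resample (rowset r) M N) r = wgram_but w M r.
Proof.
by apply: eq_bigr => i ir; rewrite row_resample (negbTE ir).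
Qed.

Lemma ridge_inv_but_resample r M N :
  ridge_inv_but r (resample (rowset r) M N) = ridge_inv_but r M.
Proof. by rewrite /ridge_inv_but wgram_but_resample. Qed.

Lemma wgram_resample r M N : w r = 0 ->
  wgram w (resample (rowset r) M N) = wgram w M.
Proof. by move=> wr; rewrite !(wgramD1 _ _ r) wgram_but_resample wr !scale0r. Qed.

Lemma mxmeas_ridge_inv : mxmeas (ridge_inv : mxspace R n p -> _).
Proof.
apply: mxmeas_inv; apply: mxmeasD; last exact: mxmeas_cst.
exact: mxmeas_wgram (@mxmeas_id _ _ _).
Qed.

Lemma mxmeas_ridge_inv_but r : mxmeas (ridge_inv_but r : mxspace R n p -> _).
Proof.
apply: mxmeas_inv; apply: mxmeasD; last exact: mxmeas_cst.
exact: mxmeas_wgram_but (@mxmeas_id _ _ _).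
Qed.

Lemma ridge_tr_bound M : 0 <= ridge_tr M <= p%:R / e.
Proof.
by rewrite ridge_trace_ge0 ?ridge_trace_le//; exact: psd_wgram.
Qed.

Lemma bmeas_ridge_tr : bmeas (ridge_tr : mxspace R n p -> R).
Proof.
split; first by apply: measurable_mxtrace; exact: mxmeas_ridge_inv.
by exists (p%:R / e) => M; have /andP[h1 h2] := ridge_tr_bound M; rewrite ger0_norm.
Qed.

Lemma ridge_tr_but r M : 0 <= \tr (ridge_inv_but r M) - ridge_tr M <= e^-1.
Proof.
rewrite /ridge_tr /ridge_inv (wgramD1 _ _ r).
exact: ridge_trace_rank1_update (psd_wgram_but _ _ w0) e0 _ _ (w0 r).
Qed.

(** Both traces fall short of the same row-deleted trace by an amount between 0 and [e^-1]. *)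
Lemma ridge_tr_diff r M N N' :
  `|ridge_tr (resample (rowset r) M N) - ridge_tr (resample (rowset r) M N')| <= e^-1.
Proof.
have := ridge_tr_but r (resample (rowset r) M N).
have := ridge_tr_but r (resample (rowset r) M N').
by rewrite !ridge_inv_but_resample ler_norml => /andP[? ?] /andP[? ?]; apply/andP; split; lra.
Qed.

End ridge_trace.

Section saturation.
Context {R : realType}.
Implicit Types (w q : R).

(** The share of one row in the trace identity. For nonnegative arguments it stays in [[0, 1]],
    hence is integrable however large [q] may be, and it is Lipschitz in [q]. *)
Definition satur w q := w * q / (1 + w * q).

Lemma satur_ge0 w q : 0 <= w -> 0 <= q -> 0 <= satur w q.
Proof. by move=> w0 q0; rewrite divr_ge0// ?addr_ge0// mulr_ge0. Qed.

Lemma satur_le1 w q : 0 <= w -> 0 <= q -> satur w q <= 1.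
Proof.
move=> w0 q0; rewrite ler_pdivrMr; first by rewrite mul1r lerDr.
by rewrite ltr_pwDl// mulr_ge0.
Qed.

Lemma saturB w q q' : 0 <= w -> 0 <= q -> 0 <= q' ->
  satur w q - satur w q' = w * (q - q') / ((1 + w * q) * (1 + w * q')).
Proof.
move=> w0 q0 q'0; have h x : 0 <= x -> 1 + w * x != 0.
  by move=> x0; rewrite gt_eqF// ltr_pwDl// mulr_ge0.
by rewrite /satur; field; rewrite !h.
Qed.

Lemma satur_lipschitz b w q q' : 0 <= w <= b -> 0 <= q -> 0 <= q' ->
  `|satur w q - satur w q'| <= b * `|q - q'|.
Proof.
move=> /andP[w0 wb] q0 q'0; rewrite saturB// normrM normrM (ger0_norm w0).
have h x : 0 <= x -> 1 <= 1 + w * x by move=> x0; rewrite lerDl mulr_ge0.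
have d1 : 1 <= (1 + w * q) * (1 + w * q').
  by rewrite -[leLHS]mulr1 ler_pM// ?h.
rewrite normfV (ger0_norm (le_trans ler01 d1)) ler_pdivrMr ?(lt_le_trans ltr01 d1)//.
apply: (@le_trans _ _ (b * `|q - q'|)); first by rewrite ler_wpM2r.
by rewrite -[leLHS]mulr1 ler_wpM2l// mulr_ge0// (le_trans w0).
Qed.

End saturation.

Section ridge_law_of_large_numbers.
Context d (Omega : measurableType d) {R : realType} (P : probability Omega R).
Context {n p : nat} (Z : 'I_n -> 'I_p -> {RV P >-> R}).
Hypothesis Zind : mutual_independence (fun ij : 'I_n * 'I_p => Z ij.1 ij.2).
Variable m4 : R.
Hypothesis m4_ge0 : 0 <= m4.
Hypothesis Zmom : forall i j (x y t : R),
  (\int[P]_w ((x + y * Z i j w + t * (Z i j w ^+ 2 - 1)) ^+ 2)%:E <=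
   (x ^+ 2 + 2 * y ^+ 2 + 2 * m4 * t ^+ 2)%:E)%E.
Variables (w : 'I_n -> R) (b : R).
Hypothesis wb : forall i, 0 <= w i <= b.

Let w0 i : 0 <= w i. Proof. by have /andP[] := wb i. Qed.
Let b0 (i : 'I_n) : 0 <= b.
Proof. by have /andP[h1 h2] := wb i; exact: le_trans h1 h2. Qed.
Let C := 8 + 2 * m4.
Let C0 : 0 <= C. Proof. by rewrite addr_ge0// mulr_ge0. Qed.

Definition ridge_mean e := Ex P (fun om => ridge_tr w e (mxrv Z om)).

Lemma ridge_mean_bound e : 0 < e -> 0 <= ridge_mean e <= p%:R / e.
Proof.
move=> e0; have bt := bmeas_mxrv Z (bmeas_ridge_tr (p := p) w0 e0).
have h om := ridge_tr_bound w0 e0 (mxrv Z om).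
rewrite -{1}(Ex_cst P 0) -(Ex_cst P (p%:R / e)) /ridge_mean.
by rewrite !Ex_le//; try exact: bmeas_cst; move=> om; have /andP[] := h om.
Qed.

(** Bounded differences with constant [1 / (kappa n)] and parameter [sigma kappa n]. The condition
    [sigma <= 1/2] is the admissible range, and [sigma <= kappa eta / 4] makes the quadratic term of
    the exponent at most half of the linear one. *)
Lemma ridge_tail kappa eta (sigma := Num.min 2^-1 (kappa * eta / 4)) :
  (0 < n)%N -> 0 < kappa -> 0 < eta ->
  (P [set om | eta <= `|ridge_tr w (kappa * n%:R) (mxrv Z om) -
       ridge_mean (kappa * n%:R)|]%R <=
   (2 * expR (- (sigma * kappa * eta / 2 * n%:R)))%:E)%E.
Proof.
move=> n0 k0 eta0; set e := kappa * n%:R.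
have e0 : 0 < e by rewrite mulr_gt0// ltr0n.
have s0 : 0 < sigma by rewrite lt_min invr_gt0 ltr0n/= divr_gt0// mulr_gt0.
have s1 : sigma <= 2^-1 by rewrite ge_min lexx.
have s2 : sigma <= kappa * eta / 4 by rewrite ge_min lexx orbT.
have se : sigma * e * e^-1 = sigma by rewrite mulfK// gt_eqF.
have := bounded_differences_tail Zind (bmeas_ridge_tr (p := p) w0 e0)
  (ridge_tr_diff w0 e0) eta (s := sigma * e).
rewrite se => /(_ (ltW (mulr_gt0 s0 e0)) s1) h; apply: (le_trans h).
rewrite lee_fin ler_wpM2l// ler_expR -subr_ge0.
have -> : - (sigma * kappa * eta / 2 * n%:R) - (2 * sigma ^+ 2 * n%:R - sigma * e * eta) =
  2 * sigma * n%:R * (kappa * eta / 4 - sigma) by rewrite /e; field.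
by rewrite mulr_ge0 ?subr_ge0// mulr_ge0// mulr_ge0// ltW.
Qed.

Let q r e (M : 'M[R]_(n, p)) := qform (ridge_inv_but w e r M) (row r M).

Let q_ge0 r e M : 0 < e -> 0 <= q r e M.
Proof.
by move=> e0; apply/psdE/posdef_psd/ridge_inv_posdef => //; exact: psd_wgram_but.
Qed.

Let mq r e : measurable_fun setT (q r e : mxspace R n p -> R).
Proof.
apply: measurable_qform; first exact: mxmeas_ridge_inv_but.
by apply: mxmeas_row; exact: mxmeas_id.
Qed.

Let msatur d' (T : measurableType d') v (f : T -> R) : measurable_fun setT f ->
  measurable_fun setT (fun x => satur v (f x)).
Proof.
move=> mf; apply: measurable_funM; first exact: measurable_funM.
by apply: measurable_inv; apply: measurable_funD => //; exact: measurable_funM.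
Qed.

Let bsatur d' (T : measurableType d') v (f : T -> R) : 0 <= v ->
  measurable_fun setT f -> (forall x, 0 <= f x) -> bmeas (fun x => satur v (f x)).
Proof.
move=> v0 mf f0; split; first exact: msatur.
by exists 1 => x; rewrite ger0_norm ?satur_ge0 ?satur_le1.
Qed.

Let tr_but_ge0 r e M : 0 < e -> 0 <= \tr (ridge_inv_but w e r M : 'M[R]_p).
Proof. by move=> e0; apply: ridge_trace_ge0 => //; exact: psd_wgram_but. Qed.

Let row_fluctuation r e s : 0 < e -> 0 < s ->
  Ex P (fun om => `|satur (w r) (q r e (mxrv Z om)) -
      satur (w r) (\tr (ridge_inv_but w e r (mxrv Z om)))|) <=
  b * (C * (p%:R / e ^+ 2) / (2 * s) + s / 2).
Proof.
move=> e0 s0; have bge0 := b0 r.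
pose F M := `|satur (w r) (q r e M) - satur (w r) (\tr (ridge_inv_but w e r M))|.
have mF : measurable_fun setT (F : mxspace R n p -> R).
  apply: measurableT_comp => //; apply: measurable_funB; first exact: msatur.
  by apply: msatur; apply: measurable_mxtrace; exact: mxmeas_ridge_inv_but.
have bF : bmeas (F : mxspace R n p -> R).
  apply: bmeas_norm; apply: bmeasB.
    by apply: bsatur => // M; exact: q_ge0.
  apply: bsatur => //; last by move=> M; exact: tr_but_ge0.
  by apply: measurable_mxtrace; exact: mxmeas_ridge_inv_but.
rewrite -lee_fin Ex_ge0_EFin; last exact: (bmeas_mxrv Z bF).
set K := b * _.
have K0 : 0 <= K.
  rewrite mulr_ge0// addr_ge0//; last by rewrite divr_ge0// ltW.
  rewrite divr_ge0//; last by rewrite mulr_ge0// ltW.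
  by rewrite mulr_ge0// divr_ge0// sqr_ge0.
rewrite -[leRHS](integral_EFin_cst P).
apply: (integral_redraw_le Zind (S := rowset r) (F := F) (G := fun=> K)) => //.
  by move=> M; exact: normr_ge0.
move=> M; pose B := ridge_inv_but w e r M.
have sB : B^T = B by have [] := ridge_inv_posdef (psd_wgram_but M r w0) e0.
pose xi om := qform B (row r (mxrv Z om)) - \tr B.
have mxi : measurable_fun setT xi.
  apply: measurable_funB => //; apply: measurable_qform; first exact: mxmeas_cst.
  by apply: mxmeas_row; exact: mxmeas_mxrv.
apply: (@le_trans _ _ (\int[P]_om (b * (2 * s)^-1 * (0 + xi om) ^+ 2 + b * (s / 2))%:E)%E).
  apply: le_integral_EFin.
  - exact: (bmeas_resample Z (rowset r) M bF).1.
  - apply: measurable_funD => //; apply: measurable_funM => //.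
    by apply: measurable_funX; exact: measurable_funD.
  - by move=> om; exact: normr_ge0.
  move=> om; rewrite /F /q !ridge_inv_but_resample row_resample eqxx -/B add0r.
  apply: (le_trans (satur_lipschitz (wb r) _ _)).
  - by apply/psdE/posdef_psd/ridge_inv_posdef => //; exact: psd_wgram_but.
  - exact: tr_but_ge0.
  rewrite -mulrA -mulrDr ler_wpM2l// -/(xi om) -(real_normK (num_real (xi om))).
  set y := `|xi om|.
  (* Young's inequality [y <= y^2 / (2 s) + s / 2] reduces the first moment to the second; [s] is
     chosen later. *)
  have -> : (2 * s)^-1 * y ^+ 2 + s / 2 = y + (2 * s)^-1 * (y - s) ^+ 2.
    by field; rewrite gt_eqF.
  by rewrite lerDl mulr_ge0 ?sqr_ge0// invr_ge0 mulr_ge0// ltW.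
have c1 : 0 <= b * (2 * s)^-1 by rewrite mulr_ge0// invr_ge0 mulr_ge0// ltW.
have m1 : measurable_fun setT (fun om => (0 + xi om) ^+ 2).
  by apply: measurable_funX; exact: measurable_funD.
rewrite integral_EFinD//; first last.
- by move=> om; rewrite mulr_ge0// divr_ge0// ltW.
- by move=> om; rewrite mulr_ge0// sqr_ge0.
- exact: measurable_funM.
rewrite integral_EFin_cst integral_EFinZ//; last by move=> om; exact: sqr_ge0.
have h := qform_row_variance Zind m4_ge0 Zmom r 0 sB.
apply: (@le_trans _ _ ((b * (2 * s)^-1)%:E * (0 ^+ 2 + C * \tr (B *m B))%:E + (b * (s / 2))%:E)%E).
  by rewrite leeD2r// lee_wpmul2l// lee_fin.
rewrite -EFinM -EFinD lee_fin expr0n/= add0r.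
rewrite [leRHS](_ : _ = b / (2 * s) * (C * (p%:R / e ^+ 2)) + b * (s / 2)); last first.
  by rewrite /K; ring.
rewrite lerD2r ler_wpM2l// ler_wpM2l//.
by apply: ridge_trace_sqr_le => //; exact: psd_wgram_but.
Qed.

(** Three replacements inside [satur]: the quadratic form by the trace of the same resolvent, this
    trace by the one with the row put back (cost [e^-1]), and the latter by its mean (cost [L]). *)
Lemma ridge_equation_error e s L : 0 < e -> 0 < s ->
  Ex P (fun om => `|ridge_tr w e (mxrv Z om) - ridge_mean e|) <= L ->
  `|p%:R - e * ridge_mean e - \sum_r satur (w r) (ridge_mean e)| <=
  n%:R * (b * (C * (p%:R / e ^+ 2) / (2 * s) + s / 2 + e^-1 + L)).
Proof.
move=> e0 s0 hL; set x := ridge_mean e.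
have /andP[x0 _] := ridge_mean_bound e0.
have btr : bmeas (fun om => ridge_tr w e (mxrv Z om)).
  exact: (bmeas_mxrv Z (bmeas_ridge_tr (p := p) w0 e0)).
have bq r : bmeas (fun om => satur (w r) (q r e (mxrv Z om))).
  apply: bsatur => //; last by move=> om; exact: q_ge0.
  exact: measurableT_comp (mq r e) (measurable_mxrv Z).
have bt r : bmeas (fun om => satur (w r) (\tr (ridge_inv_but w e r (mxrv Z om)))).
  apply: bsatur => //; last by move=> om; exact: tr_but_ge0.
  apply: measurable_mxtrace; exact: mxmeas_comp (mxmeas_ridge_inv_but _ _ _) (measurable_mxrv Z).
have id1 : p%:R - e * x = \sum_r Ex P (fun om => satur (w r) (q r e (mxrv Z om))).
  rewrite -Ex_sum// /x -ExZ// -[p%:R](Ex_cst P) -ExB//; last 2 first.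
  - exact: bmeas_cst.
  - exact: bmeasZ.
  congr Ex; apply/funext => om.
  by rewrite /ridge_tr /ridge_inv ridge_trace_identity.
rewrite id1 -sumrB; apply: (le_trans (ler_norm_sum _ _ _)).
rewrite -[n in n%:R]card_ord mulr_natl -sumr_const; apply: ler_sum => r _.
rewrite -[satur (w r) x](Ex_cst P) -ExB//; last exact: bmeas_cst.
pose D1 om := `|satur (w r) (q r e (mxrv Z om)) -
  satur (w r) (\tr (ridge_inv_but w e r (mxrv Z om)))|.
pose D2 om := `|ridge_tr w e (mxrv Z om) - x|.
have b1 : bmeas D1 by apply: bmeas_norm; exact: bmeasB.
have b2 : bmeas D2 by apply/bmeas_norm/bmeasB => //; exact: bmeas_cst.
have b3 : bmeas (fun om => b * (e^-1 + D2 om)).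
  by apply/bmeasZ/bmeasD => //; exact: bmeas_cst.
apply: (le_trans (Ex_norm_le _ _)); first by apply: bmeasB => //; exact: bmeas_cst.
apply: (@le_trans _ _ (Ex P (fun om => D1 om + b * (e^-1 + D2 om)))).
  apply: Ex_le; [by apply/bmeas_norm/bmeasB => //; exact: bmeas_cst|exact: bmeasD|].
  move=> om; rewrite -(subrK (satur (w r) (\tr (ridge_inv_but w e r (mxrv Z om)))) (satur _ (q _
    _ _))).
  rewrite -addrA; apply: (le_trans (ler_normD _ _)); rewrite lerD2l.
  apply: (le_trans (satur_lipschitz (wb r) _ _)) => //; first exact: tr_but_ge0.
  rewrite ler_wpM2l//; first exact: b0 r.
  rewrite -(subrK (ridge_tr w e (mxrv Z om)) (\tr _)) -addrA.
  apply: (le_trans (ler_normD _ _)); rewrite lerD2r.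
  by have /andP[h1 h2] := ridge_tr_but w0 e0 r (mxrv Z om); rewrite ger0_norm.
rewrite ExD// ExZ; last by apply: bmeasD => //; exact: bmeas_cst.
rewrite ExD//; last exact: bmeas_cst.
rewrite Ex_cst [leRHS](_ : _ = b * (C * (p%:R / e ^+ 2) / (2 * s) + s / 2) +
  b * (e^-1 + L)); last by ring.
apply: lerD; first exact: row_fluctuation.
rewrite ler_wpM2l//; first exact: b0 r.
by rewrite lerD2l.
Qed.

(** Concentration with [s = e / (2 sqrt n)] has exponent 1/2, and [exp (1/2) <= 2] gives
    [L = 8 / (kappa sqrt n)]; together with 1 for the reinserted row this makes the 9. Young's
    inequality is used with parameter [1 / sqrt n]. *)
Lemma ridge_equation kappa (x := ridge_mean (kappa * n%:R)) : (0 < n)%N -> (p <= n)%N ->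
  0 < kappa ->
  `|p%:R / n%:R - kappa * x - n%:R^-1 * \sum_r satur (w r) x| <=
  b * (C / (2 * kappa ^+ 2) + 2^-1 + 9 / kappa) / Num.sqrt n%:R.
Proof.
move=> n0 pn k0; set rt : R := Num.sqrt _; set e := kappa * n%:R in x *.
have nR : (0 : R) < n%:R by rewrite ltr0n.
have rt0 : 0 < rt by rewrite sqrtr_gt0.
have rt2 : n%:R = rt ^+ 2 by rewrite sqr_sqrtr// ltW.
have rt1 : 1 <= rt by rewrite -sqrtr1 ler_sqrt// ler1n.
have e0 : 0 < e by rewrite mulr_gt0.
have bge0 := b0 (Ordinal n0).
pose s := e / (2 * rt).
have s0 : 0 < s by rewrite divr_gt0// mulr_gt0.
have se : s * e^-1 = (2 * rt)^-1 by rewrite /s; field; rewrite !gt_eqF.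
have sh : s * e^-1 <= 2^-1.
  by rewrite se lef_pV2 ?posrE ?mulr_gt0// -[leLHS]mulr1 ler_wpM2l.
have := bounded_differences_L1 Zind (bmeas_ridge_tr (p := p) w0 e0)
  (ridge_tr_diff w0 e0) s0 sh; rewrite -/(ridge_mean e) -/x => h1.
have hL : Ex P (fun om => `|ridge_tr w e (mxrv Z om) - x|) <= 8 * rt / e.
  apply: (le_trans h1).
  have -> : 8 * rt / e = 2 * 2 / s by rewrite /s; field; rewrite !gt_eqF.
  rewrite ler_wpM2r ?invr_ge0 ?(ltW s0)// ler_wpM2l//.
  have -> : 2 * (s / e) ^+ 2 * n%:R = 2^-1.
    by rewrite se rt2; field; rewrite gt_eqF.
  by apply: (le_trans (expR_le_quadratic (lexx _))); lra.
have := ridge_equation_error (s := rt^-1) e0 _ hL; rewrite invr_gt0 => /(_ rt0).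
rewrite -ler_pdivrMl// -/x.
rewrite -[X in X * `|_|]ger0_norm ?invr_ge0 ?(ltW nR)// -normrM => h2.
rewrite [X in `|X|](_ : _ = n%:R^-1 * (p%:R - e * x - \sum_r satur (w r) x)); last first.
  by rewrite /e; field; rewrite gt_eqF.
apply: (le_trans h2); rewrite -[leRHS]mulrA ler_wpM2l//.
have h3 : C * (p%:R / e ^+ 2) / (2 / rt) <= C / (2 * kappa ^+ 2) / rt.
  have -> : C * (p%:R / e ^+ 2) / (2 / rt) = C / (2 * kappa ^+ 2) * (p%:R * rt / n%:R ^+ 2).
    by rewrite /e; field; rewrite !gt_eqF.
  rewrite ler_wpM2l//; first by rewrite divr_ge0// mulr_ge0// sqr_ge0.
  have -> : rt^-1 = n%:R * rt / n%:R ^+ 2 by rewrite rt2; field; rewrite gt_eqF.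
  by rewrite ler_wpM2r ?invr_ge0 ?sqr_ge0// ler_wpM2r ?ler_nat// ltW.
have h4 : e^-1 <= kappa^-1 / rt.
  rewrite -invfM lef_pV2 ?posrE ?mulr_gt0// ler_wpM2l ?(ltW k0)// rt2 expr2.
  by rewrite -[leLHS]mulr1 ler_wpM2l// ltW.
have h5 : 8 * rt / e = 8 / kappa / rt by rewrite /e rt2; field; rewrite !gt_eqF.
have h6 : rt^-1 / 2 = 2^-1 / rt by rewrite mulrC.
rewrite h5 h6 [leRHS](_ : _ = C / (2 * kappa ^+ 2) / rt + 2^-1 / rt + kappa^-1 / rt +
  8 / kappa / rt); last by ring.
by rewrite lerD2r lerD// lerD2r.
Qed.

End ridge_law_of_large_numbers.

(** * The barrier process *)

Section barrier_process.
Context d (Omega : measurableType d) {R : realType} (P : probability Omega R).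
Context {n p : nat} (Z : 'I_n -> 'I_p -> {RV P >-> R}).
Hypothesis Zind : mutual_independence (fun ij : 'I_n * 'I_p => Z ij.1 ij.2).
Variable m4 : R.
Hypothesis m4_ge0 : 0 <= m4.
Hypothesis Zmom : forall i j (x y t : R),
  (\int[P]_w ((x + y * Z i j w + t * (Z i j w ^+ 2 - 1)) ^+ 2)%:E <=
   (x ^+ 2 + 2 * y ^+ 2 + 2 * m4 * t ^+ 2)%:E)%E.

Let C := 8 + 2 * m4.
Let C8 : 8 <= C. Proof. by rewrite lerDl mulr_ge0. Qed.

(** One minus the Cantelli bound for the event that [z B^2 z^T] is below half of [tr B^2]: a second
    moment [4 C^2 + C] over the squared threshold [(2 C + 1/2)^2], in units of the squared trace. *)
Definition barrier_gap (m4 : R) : R :=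
  let C := 8 + 2 * m4 in (C + 4^-1) / (4 * C ^+ 2 + 2 * C + 4^-1).
(** At this height [K], Chebyshev's inequality leaves a probability of at most [g / 2] for a larger
    [z B z^T]; the added 1 gives [K <= K^2]. *)
Definition barrier_cut (m4 phi : R) : R :=
  8 * phi ^+ 2 * (9 + 2 * m4) / barrier_gap m4 + 1.
(** The two arguments are the requirements of the deterministic step: [2 phi delta <= 1], and the
    upper bound on [delta] in [barrier_step]. *)
Definition barrier_shift (m4 phi a : R) : R :=
  Num.min (2 * phi)^-1 (a / (2 * (1 + a * barrier_cut m4 phi))).

Let g := barrier_gap m4.

Lemma barrier_gap_bounds : 0 < g < 1.
Proof.
have C0 : 0 < C by apply: lt_le_trans C8.
have C2 : 0 <= C ^+ 2 by exact: sqr_ge0.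
rewrite /g /barrier_gap -/C divr_gt0 ?ltr_pdivrMr ?mul1r; lra.
Qed.

Lemma barrier_cut_ge1 phi : 1 <= barrier_cut m4 phi.
Proof.
have /andP[g0 _] := barrier_gap_bounds; rewrite /barrier_cut lerDr.
rewrite divr_ge0 ?(ltW g0)// mulr_ge0//; first by rewrite mulr_ge0// sqr_ge0.
by rewrite addr_ge0// mulr_ge0.
Qed.

Lemma barrier_shift_gt0 phi a : 0 < phi -> 0 < a -> 0 < barrier_shift m4 phi a.
Proof.
move=> phi0 a0; rewrite /barrier_shift lt_min invr_gt0 mulr_gt0//= divr_gt0//.
by rewrite mulr_gt0// ltr_pwDl// mulr_ge0 ?(ltW a0)// (le_trans ler01)// barrier_cut_ge1.
Qed.

Section step.
Variables (phi : R).
Hypothesis phi0 : 0 < phi.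
Let K := barrier_cut m4 phi.

(* The first alternative only makes the step measurable without any reference
   to positive definiteness: along the process it does not occur. *)
Definition good_step (B : 'M[R]_p) (z : 'rV[R]_p) : bool :=
  ~~ ((`|\tr B| <= 2 * phi) && (\tr (B *m B) <= (2 * phi) ^+ 2)) ||
  ((qform B z <= K) && (\tr (B *m B) / 2 <= qform (B *m B) z)).

Lemma measurable_good_step d' (T : measurableType d') (B : T -> 'M[R]_p)
    (z : T -> 'rV[R]_p) : mxmeas B -> mxmeas z ->
  measurable_fun setT (fun x => good_step (B x) (z x)).
Proof.
move=> mB mz; have mt := measurable_mxtrace (mxmeasM mB mB).
apply: measurable_or.
  apply: measurable_neg; apply: measurable_and; apply: measurable_fun_ler => //.
  by apply: measurableT_comp => //; exact: measurable_mxtrace.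
apply: measurable_and; apply: measurable_fun_ler => //.
- exact: measurable_qform.
- exact: measurable_funM.
- by apply: measurable_qform => //; exact: mxmeasM.
Qed.

Let half B z : R := if good_step B z then 2^-1 else 1.

Let bmeas_half B r : bmeas (fun om => half B (row r (mxrv Z om))).
Proof.
split; last first.
  by exists 1 => om; rewrite /half; case: ifP; rewrite ger0_norm//; lra.
apply: measurable_fun_ifT => //; apply: measurable_good_step.
  exact: mxmeas_cst.
by apply: mxmeas_row; exact: mxmeas_mxrv.
Qed.

(* A lower-tail Chebyshev inequality of Cantelli type for the quadratic form in
   [B^2], and an ordinary one for the quadratic form in [B]. *)
Lemma good_step_Ex B r : B^T = B ->
  Ex P (fun om => half B (row r (mxrv Z om))) <= 1 - g / 4.
Proof.
move=> sB; have /andP[g0 g1] := barrier_gap_bounds.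
have [cond|ncond] := boolP ((`|\tr B| <= 2 * phi) && (\tr (B *m B) <= (2 * phi) ^+ 2)); last first.
  rewrite (_ : (fun _ => _) = fun=> 2^-1); first by rewrite Ex_cst; lra.
  by apply/funext => om; rewrite /half /good_step ncond.
have /andP[c1 c2] := cond.
set t := \tr (B *m B) in c2 *.
have t0 : 0 <= t by exact: mxtrace_sqr_ge0.
have K1 : 1 <= K by exact: barrier_cut_ge1.
have K0 : 0 < K by exact: lt_le_trans K1.
have C0 : 0 < C by exact: lt_le_trans C8.
pose u om := qform B (row r (mxrv Z om)).
pose v om := qform (B *m B) (row r (mxrv Z om)).
(* The shift that minimizes the Cantelli ratio [(al^2 + C t^2) / (al + t / 2)^2]. *)
pose al := 2 * C * t.
pose den := (al + t / 2) ^+ 2.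
have mu : measurable_fun setT u.
  by apply: measurable_qform; [exact: mxmeas_cst|apply: mxmeas_row; exact: mxmeas_mxrv].
have mv : measurable_fun setT v.
  by apply: measurable_qform; [exact: mxmeas_cst|apply: mxmeas_row; exact: mxmeas_mxrv].
have al0 : 0 <= al by rewrite mulr_ge0// mulr_ge0// ltW.
have den0 : 0 <= den by exact: sqr_ge0.
have sBB : (- (B *m B))^T = - (B *m B) by rewrite linearN/= trmx_mul sB.
have hu := qform_row_variance Zind m4_ge0 Zmom r (\tr B) sB.
have hv := qform_row_variance Zind m4_ge0 Zmom r al sBB.
pose U om := (\tr B + (u om - \tr B)) ^+ 2.
pose V om := (al + (qform (- (B *m B)) (row r (mxrv Z om)) - \tr (- (B *m B)))) ^+ 2.
have mU : measurable_fun setT U.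
  by apply: measurable_funX; apply: measurable_funD => //; exact: measurable_funB.
have VE om : V om = (al - (v om - t)) ^+ 2.
  by rewrite /V qformN linearN/= /v /t opprK opprB [- _ + _]addrC.
have mV : measurable_fun setT V.
  rewrite (_ : V = fun om => (al - (v om - t)) ^+ 2); last by apply/funext.
  by apply: measurable_funX; apply: measurable_funB => //; exact: measurable_funB.
have U0 om : 0 <= U om by exact: sqr_ge0.
have V0 om : 0 <= V om by exact: sqr_ge0.
have k0 : 0 <= 2^-1 * (K ^+ 2)^-1 by rewrite mulr_ge0// invr_ge0 sqr_ge0.
have k1 : 0 <= 2^-1 * den^-1 by rewrite mulr_ge0// invr_ge0.
have pw om : half B (row r (mxrv Z om)) <=
    2^-1 + (2^-1 * (K ^+ 2)^-1 * U om + 2^-1 * den^-1 * V om).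
  rewrite /half; case: ifPn => [_|].
    by rewrite lerDl addr_ge0// mulr_ge0.
  rewrite /good_step cond/= negb_and -!ltNge => /orP[uK|vt].
    have : 1 <= (K ^+ 2)^-1 * U om.
      rewrite mulrC ler_pdivlMr ?exprn_gt0// mul1r /U addrC subrK.
      by rewrite lerXn2r// ?nnegrE ?(ltW K0)// ltW// (lt_trans K0).
    have := mulr_ge0 k1 (V0 om); lra.
  (* For [t = 0] this failure cannot occur, so [den] is positive whenever it matters. *)
  have tp : 0 < t.
    rewrite lt_neqAle t0 andbT; apply: contraTN vt => /eqP t0'.
    by rewrite -leNgt -/t -t0' mul0r; exact/psdE/psd_sqr.
  have : 1 <= den^-1 * V om.
    have dp : 0 < den by rewrite exprn_gt0// ltr_pwDr// divr_gt0.
    rewrite mulrC ler_pdivlMr// mul1r VE lerXn2r// ?nnegrE.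
    - by rewrite addr_ge0// divr_ge0.
    - rewrite subr_ge0; move: vt; rewrite -/(v om) -/t; lra.
    - move: vt; rewrite -/(v om) -/t; lra.
  have := mulr_ge0 k0 (U0 om); lra.
rewrite -lee_fin Ex_ge0_EFin; last exact: bmeas_half.
apply: (@le_trans _ _ (\int[P]_om (2^-1 + (2^-1 * (K ^+ 2)^-1 * U om +
  2^-1 * den^-1 * V om))%:E)%E).
  apply: le_integral_EFin => //.
  - by have [] := bmeas_half B r.
  - by apply: measurable_funD => //; apply: measurable_funD; exact: measurable_funM.
  - by move=> om; rewrite /half; case: ifP.
have mU' : measurable_fun setT (fun om => 2^-1 * (K ^+ 2)^-1 * U om) by exact: measurable_funM.
have mV' : measurable_fun setT (fun om => 2^-1 * den^-1 * V om) by exact: measurable_funM.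
rewrite integral_EFinD//; last 2 first.
- exact: measurable_funD.
- by move=> om; rewrite addr_ge0// mulr_ge0.
rewrite integral_EFinD//; last 2 first.
- by move=> om; rewrite mulr_ge0.
- by move=> om; rewrite mulr_ge0.
rewrite integral_EFin_cst !integral_EFinZ//.
have e1 : (\int[P]_om (U om)%:E <= (4 * phi ^+ 2 * (1 + C))%:E)%E.
  apply: (le_trans hu); rewrite lee_fin -/C -/t.
  have h1 : \tr B ^+ 2 <= (2 * phi) ^+ 2.
    by rewrite -(real_normK (num_real (\tr B))) lerXn2r// ?nnegrE ?mulr_ge0// ltW.
  have h2 : C * t <= C * (2 * phi) ^+ 2 by rewrite ler_wpM2l// ltW.
  have -> : 4 * phi ^+ 2 * (1 + C) = (2 * phi) ^+ 2 + C * (2 * phi) ^+ 2 by ring.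
  exact: lerD.
have e2 : (\int[P]_om (V om)%:E <= ((4 * C ^+ 2 + C) * t ^+ 2)%:E)%E.
  apply: (le_trans hv); rewrite lee_fin -/C mulNmx mulmxN opprK.
  have := psd_trace_sqr_le (psd_sqr sB); rewrite -/t => h1.
  have h2 := ler_wpM2l (ltW C0) h1.
  have -> : (4 * C ^+ 2 + C) * t ^+ 2 = al ^+ 2 + C * t ^+ 2 by rewrite /al; ring.
  by rewrite lerD2l.
apply: (@le_trans _ _ (2^-1%:E + ((2^-1 * (K ^+ 2)^-1)%:E * (4 * phi ^+ 2 * (1 + C))%:E +
    (2^-1 * den^-1)%:E * ((4 * C ^+ 2 + C) * t ^+ 2)%:E))%E).
  by rewrite leeD2l// leeD// lee_wpmul2l// lee_fin.
rewrite -!EFinM -!EFinD lee_fin.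
have f1 : (K ^+ 2)^-1 * (4 * phi ^+ 2 * (1 + C)) <= g / 2.
  have h : 8 * phi ^+ 2 * (1 + C) / g <= K ^+ 2.
    apply: (@le_trans _ _ K); last by rewrite expr2 -[leLHS]mulr1 ler_wpM2l// ltW.
    rewrite /K /barrier_cut -/g (_ : 9 + 2 * m4 = 1 + C) ?lerDl//.
    by rewrite /C; ring.
  rewrite mulrC ler_pdivrMr ?exprn_gt0// mulrC.
  move: h; rewrite ler_pdivrMr// => h; lra.
have f2 : den^-1 * ((4 * C ^+ 2 + C) * t ^+ 2) <= 1 - g.
  have [->|tn] := eqVneq t 0; first by rewrite expr0n/= !mulr0 subr_ge0 ltW.
  have gE : 1 - g = (4 * C ^+ 2 + C) / (4 * C ^+ 2 + 2 * C + 4^-1).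
    rewrite /g /barrier_gap -/C; field.
    by rewrite gt_eqF//; have := sqr_ge0 C; lra.
  rewrite gE /den /al (_ : (2 * C * t + t / 2) ^+ 2 = (4 * C ^+ 2 + 2 * C + 4^-1) * t ^+ 2);
    last by field.
  rewrite le_eqVlt; apply/orP; left; apply/eqP; field.
  by rewrite tn/= gt_eqF//; have := sqr_ge0 C; lra.
by move: f1 f2; lra.
Qed.

End step.

Variables (phi a b : R) (w : 'I_n -> R) (A0 : 'M[R]_(n, p) -> 'M[R]_p) (l0 : R).
Hypotheses (phi0 : 0 < phi) (a0 : 0 < a).
Hypothesis mA0 : mxmeas (A0 : mxspace R n p -> _).
Hypothesis sA0 : forall M, (A0 M)^T = A0 M.

Let delta := barrier_shift m4 phi a.

Definition barrier_mx rs (M : 'M[R]_(n, p)) : 'M[R]_p :=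
  A0 M + \sum_(r <- rs) w r *: ((row r M)^T *m row r M).

(** The list is read from its end: the head is the row inserted last. It is tested against the
    resolvent at the raised level, taken before its insertion. *)
Fixpoint barrier_level rs (M : 'M[R]_(n, p)) : R :=
  if rs is r :: rs' then
    barrier_level rs' M +
    (if good_step phi (invmx (barrier_mx rs' M - (barrier_level rs' M)%:M - delta%:M))
          (row r M) then delta else 0)
  else l0.

(** A factor 1/2 for each success. The mean contracts at every row, so Markov's inequality bounds
    the number of successes from below although the successive tests are not independent. *)
Fixpoint barrier_weight rs (M : 'M[R]_(n, p)) : R :=
  if rs is r :: rs' then
    barrier_weight rs' M *
    (if good_step phi (invmx (barrier_mx rs' M - (barrier_level rs' M)%:M - delta%:M))
          (row r M) then 2^-1 else 1)
  else 1.

Let Binv rs M := invmx (barrier_mx rs M - (barrier_level rs M)%:M - delta%:M).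

Lemma barrier_mx_cons r rs M : barrier_mx (r :: rs) M =
  barrier_mx rs M + w r *: ((row r M)^T *m row r M).
Proof. by rewrite /barrier_mx big_cons -addrA; congr (_ + _); rewrite addrC. Qed.

Let mbarrier_mx rs : mxmeas (barrier_mx rs : mxspace R n p -> _).
Proof.
apply: mxmeasD => //; apply: mxmeas_sum => i _; apply: mxmeasZ => //.
by apply: mxmeasM; [apply: mxmeas_tr|]; apply: mxmeas_row; exact: mxmeas_id.
Qed.

Let mBinv rs : measurable_fun setT (barrier_level rs : mxspace R n p -> R) ->
  mxmeas (Binv rs : mxspace R n p -> _).
Proof.
move=> ml; apply: mxmeas_inv; apply: mxmeasD; last by apply: mxmeasN; exact: mxmeas_cst.
apply: mxmeasD => //; apply: mxmeasN => i j.
under [X in measurable_fun _ X]eq_fun do rewrite mxE.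
by case: (i == j); [exact: ml|exact: measurable_cst].
Qed.

Let mgood rs r : measurable_fun setT (barrier_level rs : mxspace R n p -> R) ->
  measurable_fun setT (fun M : mxspace R n p => good_step phi (Binv rs M) (row r M)).
Proof.
move=> ml; apply: measurable_good_step; first exact: mBinv.
by apply: mxmeas_row; exact: mxmeas_id.
Qed.

Let mlevel rs : measurable_fun setT (barrier_level rs : mxspace R n p -> R).
Proof.
elim: rs => [|r rs IH]; first exact: measurable_cst.
by apply: measurable_funD => //; apply: measurable_fun_ifT => //; exact: mgood.
Qed.

Let bweight rs : bmeas (barrier_weight rs : mxspace R n p -> R).
Proof.
elim: rs => [|r rs IH]; first exact: bmeas_cst.
apply: bmeasM => //; split.
  by apply: measurable_fun_ifT => //; exact: mgood.
by exists 1 => M; case: ifP => _; rewrite ger0_norm//; lra.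
Qed.

Lemma barrier_weight_level rs M : exists k : nat,
  barrier_weight rs M = 2^-1 ^+ k /\ barrier_level rs M = l0 + delta * k%:R.
Proof.
elim: rs => [|r rs [k [h1 h2]]]; first by exists 0%N; rewrite expr0 mulr0 addr0.
rewrite /=; case: ifP => _.
  exists k.+1; rewrite {1}h1 exprSr; split => //.
  by rewrite {1}h2 -natr1; ring.
by exists k; rewrite mulr1 addr0.
Qed.

Lemma barrier_weight_ge0 rs M : 0 <= barrier_weight rs M.
Proof. by have [k [-> _]] := barrier_weight_level rs M; rewrite exprn_ge0. Qed.

Hypothesis aw : forall i, a <= w i.

(** A failed step keeps the level, and the added row can only lower the trace; a successful one is
    an instance of [barrier_step]. *)
Lemma barrier_invariant rs M :
  posdefmx (A0 M - l0%:M) -> \tr (invmx (A0 M - l0%:M)) <= phi ->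
  posdefmx (barrier_mx rs M - (barrier_level rs M)%:M) /\
  \tr (invmx (barrier_mx rs M - (barrier_level rs M)%:M)) <= phi.
Proof.
move=> p0 t0; elim: rs => [|r rs [pI tI]]; first by rewrite /barrier_mx big_nil addr0.
have w0 : 0 <= w r by rewrite (le_trans (ltW a0)).
have pr := psdZ w0 (psd_rank1 (row r M)).
have d0 : 0 < delta by exact: barrier_shift_gt0.
have dphi : 2 * phi * delta <= 1.
  by rewrite -ler_pdivlMl ?mulr_gt0// mulr1 /delta /barrier_shift ge_min lexx.
set D := barrier_mx rs M - (barrier_level rs M)%:M in pI tI.
rewrite barrier_mx_cons /= -/D; case: ifPn => good; last first.
  rewrite addr0 addrAC -/D; split; first exact: posdefDl.
  by apply: le_trans tI; exact: psd_mxtrace_rank1_update_le.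
have -> : barrier_mx rs M + w r *: ((row r M)^T *m row r M) -
    (barrier_level rs M + delta)%:M = D - delta%:M + w r *: ((row r M)^T *m row r M).
  rewrite /D; set Y := w r *: _; apply/matrixP => i j; rewrite !mxE.
  by case: (i == j); rewrite ?mulr1n ?mulr0n; ring.
have pD := barrier_posdef pI phi0 tI dphi.
split; first exact: posdefDl.
move: good; rewrite /good_step.
have -> : `|\tr (invmx (D - delta%:M))| <= 2 * phi.
  rewrite ger0_norm; first exact: barrier_trace_le.
  exact: barrier_trace_ge0 dphi.
rewrite (barrier_trace_sqr_le pI phi0 tI dphi)/= => /andP[g1 g2].
apply: (barrier_step pI phi0 tI d0 dphi a0 (aw r) _ _ g1 g2).
  by rewrite (le_trans ler01)// barrier_cut_ge1.
by rewrite /delta /barrier_shift ge_min lexx orbT.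
Qed.

(** A weight below [2^-1 ^+ k] records more than [k] successes. *)
Lemma barrier_lower_bound rs M k :
  posdefmx (A0 M - l0%:M) -> \tr (invmx (A0 M - l0%:M)) <= phi ->
  barrier_weight rs M < 2^-1 ^+ k ->
  posdefmx (barrier_mx rs M - (l0 + delta * k%:R)%:M).
Proof.
move=> p0 t0; have [pI _] := barrier_invariant rs p0 t0.
have [k' [-> lE]] := barrier_weight_level rs M; rewrite lE in pI.
rewrite ltr_iXn2l// ?invr_gt0// ?invf_lt1 ?ltr1n// => kk'.
have -> : barrier_mx rs M - (l0 + delta * k%:R)%:M =
  barrier_mx rs M - (l0 + delta * k'%:R)%:M + (delta * (k'%:R - k%:R))%:M.
  apply/matrixP => i j; rewrite !mxE.
  by case: (i == j); rewrite ?mulr1n ?mulr0n; ring.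
apply: posdefDl => //; apply/posdef_psd/posdef_scalar.
by rewrite mulr_gt0 ?barrier_shift_gt0// subr_gt0 ltr_nat.
Qed.

Let barrier_resample rs r (M N : 'M[R]_(n, p)) : r \notin rs ->
  A0 (resample (rowset r) M N) = A0 M ->
  [/\ barrier_mx rs (resample (rowset r) M N) = barrier_mx rs M,
      barrier_level rs (resample (rowset r) M N) = barrier_level rs M &
      barrier_weight rs (resample (rowset r) M N) = barrier_weight rs M].
Proof.
move=> + A0r; elim: rs => [|i rs IH]; first by rewrite /barrier_mx !big_nil A0r.
rewrite inE negb_or => /andP[ri rrs]; have [h1 h2 h3] := IH rrs.
by rewrite !barrier_mx_cons /= h1 h2 h3 row_resample eq_sym (negbTE ri).
Qed.

(** The head row is redrawn with the others frozen. The weight of the tail and the tested resolvent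
    ignore this row, so [good_step_Ex] supplies one factor. *)
Lemma barrier_weight_Ex rs : uniq rs ->
  (forall r M N, r \in rs -> A0 (resample (rowset r) M N) = A0 M) ->
  Ex P (fun om => barrier_weight rs (mxrv Z om)) <= (1 - g / 4) ^+ size rs.
Proof.
have /andP[g0 g1] := barrier_gap_bounds.
have rho0 : 0 <= 1 - g / 4 by lra.
elim: rs => [_ _|r rs IH /= /andP[rrs us] A0r]; first by rewrite Ex_cst expr0.
have bw := bweight (r :: rs).
rewrite (decoupling Zind (rowset r) bw) exprS.
apply: (@le_trans _ _ (Ex P (fun om => (1 - g / 4) * barrier_weight rs (mxrv Z om)))).
  apply: Ex_le; first by apply: bmeas_mxrv; exact: bmeas_redraw.
    by apply: bmeasZ; exact: (bmeas_mxrv Z (bweight rs)).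
  move=> om; set M := mxrv Z om; rewrite /redraw.
  pose B := Binv rs M.
  have sB : B^T = B.
    have sbm : (barrier_mx rs M)^T = barrier_mx rs M.
      rewrite /barrier_mx linearD/= sA0 linear_sum/=; congr (_ + _).
      by apply: eq_bigr => i _; rewrite linearZ/= trmx_mul trmxK.
    by rewrite /B /Binv trmx_inv !linearB/= !tr_scalar_mx sbm.
  have e om' : barrier_weight (r :: rs) (resample (rowset r) M (mxrv Z om')) =
      barrier_weight rs M * (if good_step phi B (row r (mxrv Z om')) then 2^-1 else 1).
    have [h1 h2 h3] := barrier_resample rrs (A0r r M (mxrv Z om') (mem_head _ _)).
    by rewrite /= h1 h2 h3 row_resample eqxx.
  rewrite (_ : (fun _ => _) = fun om' => barrier_weight rs M *
    (if good_step phi B (row r (mxrv Z om')) then 2^-1 else 1)); last exact/funext.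
  rewrite ExZ.
    by rewrite mulrC ler_wpM2r ?barrier_weight_ge0// good_step_Ex.
  split; last by exists 1 => om'; case: ifP => _; rewrite ger0_norm//; lra.
  apply: measurable_fun_ifT => //; apply: measurable_good_step; first exact: mxmeas_cst.
  by apply: mxmeas_row; exact: mxmeas_mxrv.
rewrite ExZ; last exact: (bmeas_mxrv Z (bweight rs)).
rewrite ler_wpM2l//; apply: IH => // i M N irs; apply: A0r.
by rewrite inE irs orbT.
Qed.

Lemma measurable_barrier_weight rs k :
  measurable [set om | 2^-1 ^+ k <= barrier_weight rs (mxrv Z om)].
Proof.
rewrite -[X in measurable X]setTI.
apply: (measurable_fun_ler _ _ measurableT (Y := [set true])) => //.
by have [] := bmeas_mxrv Z (bweight rs).
Qed.

Lemma barrier_weight_tail rs k : uniq rs ->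
  (forall r M N, r \in rs -> A0 (resample (rowset r) M N) = A0 M) ->
  (P [set om | 2^-1 ^+ k <= barrier_weight rs (mxrv Z om)]%R <=
   (2 ^+ k * (1 - g / 4) ^+ size rs)%:E)%E.
Proof.
move=> us A0r; have b1 := bmeas_mxrv Z (bweight rs).
apply: (@le_trans _ _ (Ex P (fun om => 2 ^+ k * barrier_weight rs (mxrv Z om)))%:E).
  apply: probability_le_Ex; [exact: measurable_barrier_weight|exact: bmeasZ| |].
    by move=> om; rewrite mulr_ge0 ?exprn_ge0 ?barrier_weight_ge0.
  by move=> om /=; rewrite exprVn -ler_pdivrMl ?exprn_gt0// mulr1.
by rewrite lee_fin ExZ// ler_wpM2l ?exprn_ge0// barrier_weight_Ex.
Qed.

End barrier_process.

(** * Square roots and the reduction to weighted Gram matrices *)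

Lemma cvg_sumr {R : realType} I (s : seq I) (f : I -> nat -> R) (l : I -> R) :
  (forall i, f i k @[k --> \oo] --> l i) ->
  \sum_(i <- s) f i k @[k --> \oo] --> \sum_(i <- s) l i.
Proof.
move=> fl; elim: s => [|a s IH].
  by rewrite big_nil; under eq_fun do rewrite big_nil; exact: cvg_cst.
by rewrite big_cons; under eq_fun do rewrite big_cons; exact: cvgD.
Qed.

Section square_roots.
Context {R : realType} {p : nat}.
Implicit Types A S Y : 'M[R]_p.

(* The matrices that are polynomials in [A] with nonnegative coefficients, in
   Horner form: unlike that of all positive semidefinite matrices, this cone is
   closed under products. *)
Inductive nncone A : 'M[R]_p -> Prop :=
| nncone0 : nncone A 0
| nncone_horner c Y : 0 <= c -> nncone A Y -> nncone A (c%:M + A *m Y).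

Lemma nnconeD A Y Y' : nncone A Y -> nncone A Y' -> nncone A (Y + Y').
Proof.
move=> hY; elim: hY Y' => [|c V c0 hV IH] Y'; first by rewrite add0r.
case=> [|c' V' c'0 hV']; first by rewrite addr0; exact: nncone_horner.
rewrite addrACA -raddfD/= -mulmxDr; apply: nncone_horner; first exact: addr_ge0.
exact: IH.
Qed.

Lemma nnconeZ A a Y : 0 <= a -> nncone A Y -> nncone A (a *: Y).
Proof.
move=> a0; elim=> [|c V c0 hV IH]; first by rewrite scaler0; exact: nncone0.
rewrite scalerDr scale_scalar_mx scalemxAr; apply: nncone_horner => //.
exact: mulr_ge0.
Qed.

Lemma nncone_mull A Y : nncone A Y -> nncone A (A *m Y).
Proof. by move=> hY; rewrite -[A *m Y]add0r -(raddf0 (@scalar_mx R p)); exact: nncone_horner. Qed.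

Lemma nnconeM A Y Y' : nncone A Y -> nncone A Y' -> nncone A (Y *m Y').
Proof.
move=> hY hY'; elim: hY => [|c V c0 hV IH]; first by rewrite mul0mx; exact: nncone0.
rewrite mulmxDl mul_scalar_mx -mulmxA; apply: nnconeD; first exact: nnconeZ.
exact: nncone_mull.
Qed.

Lemma nncone_comm A Y : nncone A Y -> A *m Y = Y *m A.
Proof.
elim=> [|c V c0 hV IH]; first by rewrite mulmx0 mul0mx.
by rewrite mulmxDr mulmxDl mul_scalar_mx mul_mx_scalar -mulmxA -IH.
Qed.

Lemma nncone_comm2 A Y Y' : nncone A Y -> nncone A Y' -> Y *m Y' = Y' *m Y.
Proof.
move=> hY hY'; elim: hY => [|c V c0 hV IH]; first by rewrite mulmx0 mul0mx.
rewrite mulmxDr mulmxDl mul_scalar_mx mul_mx_scalar -mulmxA IH !mulmxA.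
by rewrite (nncone_comm hY').
Qed.

(** The induction also carries [A Y], because the Horner step multiplies by [A]; then [A (A V)]
    becomes the congruence [A V A] by commutation. *)
Lemma nncone_psd A Y : possemidefmx A -> nncone A Y -> possemidefmx Y.
Proof.
move=> pA hY; suff [] : possemidefmx Y /\ possemidefmx (A *m Y) by [].
have [sA _] := pA.
elim: hY => [|c V c0 hV [IH1 IH2]]; first by rewrite mulmx0; split; exact: psd0.
have pc : possemidefmx (c%:M : 'M[R]_p).
  rewrite -scalemx1; apply: psdZ => //; exact/posdef_psd/posdef_scalar.
split; first exact: psdD.
rewrite mulmxDr mul_mx_scalar; apply: psdD; first exact: psdZ.
by rewrite [A *m V]nncone_comm// mulmxA -{2}sA; exact: psd_congr.
Qed.

(** A fixed point [L] satisfies [(1 - L)^2 = 1 - A]. The iterates increase from 0, so that [1 - L]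
    is reached from above. *)
Fixpoint sqrt_iter A k : 'M[R]_p :=
  if k is k'.+1 then 2^-1 *: (A + sqrt_iter A k' *m sqrt_iter A k') else 0.

Section contraction.
Variable A : 'M[R]_p.
Hypotheses (pA : possemidefmx A) (A1 : possemidefmx (1%:M - A)).
Let Y := sqrt_iter A.

Let YS k : Y k.+1 = 2^-1 *: (A + Y k *m Y k). Proof. by []. Qed.

Let coneA : nncone A A.
Proof.
rewrite -[X in nncone _ X](mulmx1 A); apply: nncone_mull.
by rewrite -[1%:M]addr0 -(mulmx0 p A); apply: nncone_horner => //; exact: nncone0.
Qed.

Let coneY k : nncone A (Y k).
Proof.
elim: k => [|k IH]; first exact: nncone0.
by apply: nnconeZ; rewrite ?invr_ge0//; apply: nnconeD => //; exact: nnconeM.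
Qed.

(** A new increment is half the product of the previous increment with a sum of two iterates;
    closure of the cone under products thus gives monotonicity. *)
Let coneYB k : nncone A (Y k.+1 - Y k).
Proof.
elim: k => [|k IH]; first by rewrite subr0; exact: coneY.
have -> : Y k.+2 - Y k.+1 = 2^-1 *: ((Y k.+1 - Y k) *m (Y k.+1 + Y k)).
  rewrite (YS k.+1) [X in _ - X = _]YS -scalerBr; congr (_ *: _).
  rewrite mulmxBl !mulmxDr [Y k *m Y k.+1](nncone_comm2 (coneY _) (coneY _)).
  move: (Y k.+1 *m Y k.+1) (Y k.+1 *m Y k) (Y k *m Y k) => U V W.
  by apply/matrixP => i j; rewrite !mxE; ring.
by apply: nnconeZ; rewrite ?invr_ge0//; apply: nnconeM => //; exact: nnconeD.
Qed.

Let psd_half (B : 'M[R]_p) : possemidefmx B -> possemidefmx (2^-1 *: B).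
Proof. by apply: psdZ; rewrite invr_ge0. Qed.

(** [1 - Y^2] is [(1 - Y) + (Y - Y^2)], and [Y - Y^2 = Y (1 - Y) Y + (1 - Y) Y (1 - Y)] is a sum of
    two congruences. *)
Let Y_le1 k : possemidefmx (1%:M - Y k).
Proof.
elim: k => [|k IH]; first by rewrite subr0; exact/posdef_psd/posdef_scalar.
have pY := nncone_psd pA (coneY k).
have -> : 1%:M - Y k.+1 = 2^-1 *: (1%:M - A) + 2^-1 *: ((1%:M - Y k) +
    (Y k *m (1%:M - Y k) *m (Y k)^T + (1%:M - Y k) *m Y k *m (1%:M - Y k)^T)).
  have [-> _] := pY; have [-> _] := IH.
  have -> : Y k *m (1%:M - Y k) *m Y k + (1%:M - Y k) *m Y k *m (1%:M - Y k) =
      Y k - Y k *m Y k.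
    rewrite !mulmxBr !mulmxBl !mulmx1 !mul1mx.
    move: (Y k *m Y k) (Y k *m Y k *m Y k) => U V.
    by apply/matrixP => i j; rewrite !mxE; ring.
  rewrite YS; move: (Y k *m Y k) => W; apply/matrixP => i j; rewrite !mxE.
  by case: (i == j); rewrite ?mulr1n ?mulr0n; field.
apply: psdD; first exact: psd_half.
apply: psd_half; apply: psdD => //.
by apply: psdD; exact: psd_congr.
Qed.

(** The quadratic forms of the iterates are increasing and bounded; polarization passes to the
    entries. *)
Let Y_cvg i j : cvgn (fun k => Y k i j).
Proof.
have hq x : cvgn (fun k => qform (Y k) x).
  apply: nondecreasing_is_cvgn.
    apply/nondecreasing_seqP => k; rewrite -subr_ge0 -qformB.
    exact/psdE/nncone_psd/coneYB.
  exists (qform 1%:M x) => _ [k _ <-].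
  exact: psd_qform_le (Y_le1 k).
have sY k : (Y k)^T = Y k by have [] := nncone_psd pA (coneY k).
have -> : (fun k => Y k i j) = (fun k => 2^-1 *
    (qform (Y k) (1 *: delta_mx 0 i + 1 *: delta_mx 0 j) -
     qform (Y k) (delta_mx 0 i) - qform (Y k) (delta_mx 0 j))).
  by apply/funext => k; rewrite qform_lin2// !qform_delta; field.
apply: is_cvgMr; apply: is_cvgB => //; exact: is_cvgB.
Qed.

Lemma psd_sqrt_exists : exists S, possemidefmx S /\ S *m S = 1%:M - A.
Proof.
pose L : 'M[R]_p := \matrix_(i, j) limn (fun k => Y k i j).
have hL i j : Y k i j @[k --> \oo] --> L i j by rewrite mxE; exact: Y_cvg.
have LE : L = 2^-1 *: (A + L *m L).
  apply/matrixP => i j.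
  have h1 : Y k.+1 i j @[k --> \oo] --> L i j.
    by have := hL i j; rewrite -(cvg_shiftS (fun k => Y k i j)).
  have h2 : Y k.+1 i j @[k --> \oo] --> (2^-1 *: (A + L *m L)) i j.
    rewrite !mxE; under eq_fun do rewrite YS !mxE.
    apply: cvgM; first exact: cvg_cst.
    apply: cvgD; first exact: cvg_cst.
    by apply: cvg_sumr => l; exact: cvgM.
  exact: cvg_unique h1 h2.
exists (1%:M - L); split.
  split.
    apply/matrixP => i j; rewrite !mxE eq_sym; congr (_ - _).
    rewrite (_ : (fun k => Y k j i) = fun k => Y k i j)//; apply/funext => k.
    by have [sY _] := nncone_psd pA (coneY k); rewrite -[in LHS]sY mxE.
  move=> x; rewrite -/(qform _ _) qformB subr_ge0.
  have hx : qform (Y k) x @[k --> \oo] --> qform L x.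
    rewrite qformE; under eq_fun do rewrite qformE.
    apply: cvg_sumr => i; apply: cvg_sumr => j.
    by apply: cvgM; [apply: cvgM => //; exact: cvg_cst|exact: cvg_cst].
  rewrite -(cvg_lim _ hx)//; apply: limr_le; first by apply/cvg_ex; eexists; exact: hx.
  by apply: nearW => k; exact: psd_qform_le (Y_le1 k).
rewrite mulmxBl !mulmxBr !mulmx1 mul1mx; have := LE.
move=> /(congr1 (fun M => 2 *: M)); rewrite scalerA mulfV ?scale1r ?pnatr_eq0// => h.
move: (L *m L) h => W h; apply/matrixP => i j; have := congr1 (fun M : 'M[R]_p => M i j) h.
by rewrite !mxE; lra.
Qed.

End contraction.

(** Scaling by [s = 1 / (1 + \tr A)] brings [A] below the identity, and the iteration is run on
    [1 - s A]. *)
Lemma posdef_sqrt_exists A : posdefmx A -> exists S, possemidefmx S /\ S *m S = A.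
Proof.
move=> pA; have pA' := posdef_psd pA.
pose s := (1 + \tr A)^-1; have t0 := psd_trace_ge0 pA'.
have s0 : 0 < s by rewrite invr_gt0 ltr_pwDl.
have p1 : possemidefmx (1%:M - s *: A).
  split; first by rewrite linearB linearZ/= tr_scalar_mx; case: pA' => ->.
  move=> x; rewrite -/(qform _ _) qformB qformZ subr_ge0.
  rewrite mulrC ler_pdivrMr ?ltr_pwDl// mulrC.
  apply: (le_trans (psd_qform_le_trace x pA')).
  by rewrite ler_wpM2r ?qform1_ge0// lerDr.
have p2 : possemidefmx (1%:M - (1%:M - s *: A)).
  by rewrite opprB addrCA subrr addr0; apply: psdZ => //; exact: ltW.
have [S [pS SS]] := psd_sqrt_exists p1 p2.
exists (Num.sqrt s^-1 *: S); split; first by apply: psdZ => //; exact: sqrtr_ge0.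
rewrite -scalemxAl -scalemxAr scalerA SS -expr2 sqr_sqrtr; last by rewrite invr_ge0 ltW.
by rewrite opprB addrCA subrr addr0 scalerA mulVf ?gt_eqF// scale1r.
Qed.

Lemma posdef_sqrtmx A : posdefmx A ->
  possemidefmx (sqrtmx A) /\ sqrtmx A *m sqrtmx A = A.
Proof.
move=> /posdef_sqrt_exists h; rewrite /sqrtmx.
exact: (@xgetPex _ 0 [set S | possemidefmx S /\ S *m S = A]).
Qed.

(* With [E = S - D], the products of [E] with [S + D] on both sides sum to
   [2 (S^2 - D^2) = 0], so [E (S + D) E] has trace zero. *)
Lemma psd_sqrt_unique S D : possemidefmx S -> posdefmx D ->
  S *m S = D *m D -> S = D.
Proof.
move=> pS pD SD; have [[sS _] [sD _]] := (pS, pD).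
have [_ pT] := posdefDr pS pD.
pose E := S - D; have sE : E^T = E by rewrite linearB/= sS sD.
have h0 : (S + D) *m E + E *m (S + D) = 0.
  rewrite /E mulmxBr mulmxDr !mulmxDl !mulNmx SD.
  move: (D *m D) (S *m D) (D *m S) => U V W; by apply/matrixP => i j; rewrite !mxE; ring.
have h1 : \tr (E *m (S + D) *m E) = 0.
  have := congr1 (fun M => \tr (E *m M)) h0; rewrite mulmx0 linear0 mulmxDr linearD/=.
  rewrite mulmxA [\tr (E *m (E *m _))]mxtrace_mulC -mulr2n.
  by move/eqP; rewrite mulrn_eq0/= => /eqP.
suff E0 : E = 0 by apply/eqP; rewrite -subr_eq0; apply/eqP.
have h2 i : (E *m (S + D) *m E) i i = qform (S + D) (row i E).
  rewrite -{2}sE -[LHS]qform_delta /qform !mulmxA -!rowE.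
  by rewrite trmx_delta tr_row -!mulmxA -colE.
have q0 (x : 'rV[R]_p) : 0 <= qform (S + D) x.
  by have := psdE (posdef_psd (posdefDr pS pD)) x.
have h3 i : qform (S + D) (row i E) = 0.
  rewrite -h2; move: h1 => /psumr_eq0P; apply => //= j _.
  by rewrite h2.
apply/row_matrixP => i; rewrite row0; apply/eqP/negP => /negP /pT.
by rewrite -/(qform _ _) h3 ltxx.
Qed.

Lemma sqrtmx_diag A : is_diag_mx A -> (forall i, 0 < A i i) ->
  sqrtmx A = diag_mx (\row_i Num.sqrt (A i i)).
Proof.
move=> dA A0; set D := diag_mx _.
have pD : posdefmx D.
  split; first by rewrite tr_diag_mx.
  move=> x x0; rewrite -/(qform _ _) qformE.
  have -> : \sum_i \sum_j x 0 i * D i j * x 0 j = \sum_i Num.sqrt (A i i) * x 0 i ^+ 2.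
    apply: eq_bigr => i _; rewrite (bigD1 i)//= big1 ?addr0.
      by rewrite !mxE eqxx mulr1n; ring.
    by move=> j ji; rewrite !mxE eq_sym (negbTE ji) mulr0n mulr0 mul0r.
  rewrite lt0r sumr_ge0 ?andbT; last by move=> i _; rewrite mulr_ge0 ?sqr_ge0 ?sqrtr_ge0.
  apply: contra x0 => /eqP h; apply/eqP/rowP => i; rewrite mxE.
  have := psumr_eq0P (fun i _ => mulr_ge0 (sqrtr_ge0 (A i i)) (sqr_ge0 (x 0 i))) h.
  move=> /(_ i isT)/eqP; rewrite mulf_eq0 gt_eqF ?sqrtr_gt0//= sqrf_eq0.
  by move/eqP.
have DD : D *m D = A.
  rewrite mulmx_diag; apply/matrixP => i j; rewrite !mxE.
  case: eqP => [->|/eqP ij]; first by rewrite mulr1n -expr2 sqr_sqrtr// ltW.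
  by rewrite mulr0n; apply/esym; move/is_diag_mxP: dA; apply.
have [pS SS] : possemidefmx (sqrtmx A) /\ sqrtmx A *m sqrtmx A = A.
  rewrite /sqrtmx; apply: (@xgetPex _ 0 [set S | possemidefmx S /\ S *m S = A]).
  by exists D; split => //; exact: posdef_psd.
by apply: psd_sqrt_unique => //; rewrite SS DD.
Qed.

End square_roots.

Section blocks.
Context {R : realType} {k : nat} (n_ : 'I_k -> nat) {p : nat}.
Let n := (\sum_(i < k) n_ i)%N.
Implicit Types (Gamma : 'M[R]_n) (Z : 'M[R]_(n, p)).

Lemma sum_block (V : nmodType) (f : 'I_n -> V) i :
  \sum_(j < n_ i) f (tagnat.Rank i j) = \sum_(r | tagnat.sig1 r == i) f r.
Proof.
(* Extension by 0 to all blocks turns the sum over one block into a dependent double sum, which the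
   bijection between pairs and row indices flattens. *)
pose g i' (j : 'I_(n_ i')) := if i' == i then f (tagnat.Rank i' j) else 0.
transitivity (\sum_i' \sum_(j < n_ i') g i' j).
  rewrite (bigD1 i)//= [X in _ = _ + X]big1 ?addr0; first by apply: eq_bigr => j _; rewrite /g eqxx.
  by move=> i' /negbTE ii'; apply: big1 => j _; rewrite /g ii'.
rewrite sig_big_dep/= (reindex _ tagnat.sig_bij_on)/= [RHS]big_mkcond/=.
by apply: eq_bigr => r _; rewrite /g tagnat.sig2K.
Qed.

Definition diag_weight Gamma (r : 'I_n) : R := Gamma r r.
Definition block_weight Gamma i (r : 'I_n) : R :=
  if tagnat.sig1 r == i then Gamma r r else 0.
Definition coblock_weight Gamma i (r : 'I_n) : R :=
  if tagnat.sig1 r == i then 0 else Gamma r r.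

Lemma wgram_block Gamma Z i : wgram (diag_weight Gamma) Z =
  wgram (block_weight Gamma i) Z + wgram (coblock_weight Gamma i) Z.
Proof.
rewrite /wgram -big_split/=; apply: eq_bigr => r _.
by rewrite -scalerDl /block_weight /coblock_weight; case: ifP; rewrite ?addr0 ?add0r.
Qed.

Lemma gram_sum_rows m (Y : 'M[R]_(m, p)) : Y^T *m Y = \sum_i (row i Y)^T *m row i Y.
Proof.
apply/matrixP => a b; rewrite mxE summxE; apply: eq_bigr => i _.
by rewrite !mxE big_ord1 !mxE.
Qed.

Section factorization.
Variables (Gamma : 'M[R]_n) (Sigma : 'M[R]_p).
Hypotheses (dG : is_diag_mx Gamma) (G0 : forall r, 0 < Gamma r r).
Hypothesis pS : posdefmx Sigma.
Variable Z : 'M[R]_(n, p).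
Let X := sqrtmx Gamma *m Z *m sqrtmx Sigma.
Let Q := sqrtmx Sigma.

Let row_gram r : (row r X)^T *m row r X =
  Q *m (Gamma r r *: ((row r Z)^T *m row r Z)) *m Q.
Proof.
have [[sQ _] _] := posdef_sqrtmx pS.
have -> : row r X = Num.sqrt (Gamma r r) *: (row r Z *m Q).
  rewrite /X sqrtmx_diag// -mulmxA row_mul row_diag_mx mxE -scalemxAl -rowE.
  by rewrite row_mul.
set c := Num.sqrt _; have -> : (c *: (row r Z *m Q))^T = c *: (row r Z *m Q)^T.
  by rewrite linearZ.
rewrite -scalemxAl -scalemxAr scalerA -expr2 sqr_sqrtr ?(ltW (G0 r))//.
by rewrite trmx_mul sQ -scalemxAr -scalemxAl !mulmxA.
Qed.

Lemma gram_full : X^T *m X = Q *m wgram (diag_weight Gamma) Z *m Q.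
Proof.
rewrite gram_sum_rows /wgram mulmx_sumr mulmx_suml; apply: eq_bigr => r _.
exact: row_gram.
Qed.

Lemma gram_block i : (submxcol X i)^T *m submxcol X i =
  Q *m wgram (block_weight Gamma i) Z *m Q.
Proof.
rewrite gram_sum_rows /wgram mulmx_sumr mulmx_suml.
transitivity (\sum_(j < n_ i) (row (tagnat.Rank i j) X)^T *m row (tagnat.Rank i j) X).
  by apply: eq_bigr => j _; congr (_^T *m _); apply/rowP => c; rewrite !mxE.
rewrite (sum_block (fun r => (row r X)^T *m row r X)) big_mkcond/=.
apply: eq_bigr => r _; rewrite /block_weight; case: ifP => _; first exact: row_gram.
by rewrite scale0r mulmx0 mul0mx.
Qed.

(** Both Gram matrices have the form [Q _ Q], and cyclicity of the trace removes [Q]. The block's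
    own rows contribute the trace of the identity, which is [p]. *)
Lemma FE_wgram : (forall i, wgram (block_weight Gamma i) Z \in unitmx) ->
  FE X = \sum_(i < k) p%:R / (p%:R +
    \tr (invmx (wgram (block_weight Gamma i) Z) *m wgram (coblock_weight Gamma i) Z)).
Proof.
move=> uA; apply: eq_bigr => i _ /=; congr (_ / _).
have [_ QQ] := posdef_sqrtmx pS.
have uQ : Q \in unitmx.
  have := posdef_unit pS; rewrite -QQ unitmx_mul => /andP[] //.
rewrite gram_full gram_block (wgram_block _ _ i).
set A := wgram (block_weight _ _) _; set B := wgram _ _.
have uAi : A \in unitmx by exact: uA.
have -> : invmx (Q *m A *m Q) = invmx Q *m invmx A *m invmx Q.
  apply: mulmx1_inv; rewrite !mulmxA mulmxK// -mulmxA.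
  by rewrite -[Q *m A *m (_ *m _)]mulmxA [A *m _]mulmxA mulmxV// mul1mx mulmxV.
rewrite !mulmxA -[_ *m invmx Q *m Q]mulmxA mulVmx// mulmx1 -!mulmxA mxtrace_mulC.
rewrite -!mulmxA mulmxV// mulmx1 mulmxDr mulVmx// linearD/=.
by rewrite mxtrace1.
Qed.

End factorization.
End blocks.

(** * Limits of spectral distributions *)

Section esd.
Context {R : realType}.

(** Unique factorization of the characteristic polynomial makes the unspecified list [eigenvals A] a
    permutation of the diagonal. *)
Lemma esd_integral n (A : 'M[R]_n) (f : R -> R) : is_diag_mx A ->
  measurable_fun setT f -> (forall x, 0 <= f x) ->
  \int[esd A]_x f x = n%:R^-1 * \sum_(i < n) f (A i i).
Proof.
move=> dA mf f0.
have mF : measurable_fun setT (EFin \o f) by exact/measurable_EFinP.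
have chA : char_poly A = \prod_(x <- [seq A i i | i <- enum 'I_n]) ('X - x%:P).
  by rewrite char_poly_trig ?is_diag_mx_is_trig// big_map big_enum.
have eA : perm_eq (eigenvals A) [seq A i i | i <- enum 'I_n].
  apply: (@prod_XsubC_eq R); rewrite -chA; apply/esym.
  by apply: (@xgetPex _ [::] [set s : seq R | char_poly A = \prod_(x <- s) ('X - x%:P)]);
    exists [seq A i i | i <- enum 'I_n].
have sA : size (eigenvals A) = n by rewrite (perm_size eA) size_map size_enum_ord.
have -> : \sum_(i < n) f (A i i) = \sum_(i < n) f (eigenvals A)`_i.
  rewrite -(big_mkord xpredT (fun i => f (eigenvals A)`_i)).
  transitivity (\sum_(x <- eigenvals A) f x); last by rewrite (big_nth 0) sA.
  by rewrite (perm_big _ eA)/= big_map big_enum.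
rewrite /Rintegral /esd ge0_integral_mscale//; last by move=> x _; rewrite lee_fin.
rewrite ge0_integral_measure_sum//; last by move=> x _; rewrite lee_fin.
under eq_bigr do rewrite integral_dirac// diracT mul1e.
by rewrite sumEFin -EFinM.
Qed.

End esd.

Section clamp.
Context {R : realType} (a b : R).
Hypotheses (a0 : 0 < a) (ab : a <= b).

(** The identity and [x -> (1 + s x)^-1] are not bounded continuous functions on the line.
    Composition with [clamp] makes them so and keeps their values on [[a, b]], which contains the
    weights and, as shown below, carries the limit. *)
Definition clamp (x : R) : R := Num.max a (Num.min b x).

Lemma clamp_itv x : a <= clamp x <= b.
Proof. by rewrite /clamp le_max lexx ge_max ab ge_min lexx. Qed.

Lemma clamp_gt0 x : 0 < clamp x.
Proof. by have /andP[h _] := clamp_itv x; exact: lt_le_trans h. Qed.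

Lemma clamp_id x : a <= x <= b -> clamp x = x.
Proof.
by move=> /andP[ax xb]; rewrite /clamp; rewrite (min_idPr xb) (max_idPr ax).
Qed.

Lemma continuous_clamp : continuous clamp.
Proof.
move=> x; apply: continuous_max; first exact: cvg_cst.
by apply: continuous_min; [exact: cvg_cst|exact: cvg_id].
Qed.

Lemma continuous_eta_clamp s : 0 <= s -> continuous (fun x => (1 + s * clamp x)^-1).
Proof.
move=> s0 x; apply: (@continuousV R R (fun x => 1 + s * clamp x) x).
  by rewrite gt_eqF// ltr_wpDr// mulr_ge0// ltW// clamp_gt0.
by apply: cvgD; [exact: cvg_cst|apply: cvgM; [exact: cvg_cst|exact: continuous_clamp]].
Qed.

End clamp.

Section weak_limit.
Context {R : realType} (N : nat -> nat) (v : forall t, 'I_(N t) -> R)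
  (mu : probability R R).
Variables (a b : R).
Hypotheses (a0 : 0 < a) (ab : a <= b) (vab : forall t (i : 'I_(N t)), a <= v i <= b).
Let avg (f : R -> R) t := (N t)%:R^-1 * \sum_(i < N t) f (v (t:=t) i).
Hypothesis avg_cvg : forall f : R -> R, continuous f -> (exists M, forall x, `|f x| <= M) ->
  (forall x, 0 <= f x) -> avg f t @[t --> \oo] --> \int[mu]_x f x.
Local Notation clamp := (clamp a b).

(** The test function [min 1 |x - clamp x|] has average 0 along the sequence, hence integral 0 in
    the limit. *)
Lemma weak_limit_ae : {ae mu, forall x, clamp x = x}.
Proof.
pose f x := Num.min 1 `|x - clamp x|.
have f0 x : 0 <= f x by rewrite /f le_min ler01 normr_ge0.
have f1 x : `|f x| <= 1 by rewrite ger0_norm// ge_min lexx.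
have cf : continuous f.
  move=> x; apply: (@continuous_min R R (cst 1) (fun x => `|x - clamp x|)); first exact: cvg_cst.
  by apply: cvg_norm; apply: cvgB; [exact: cvg_id|exact: continuous_clamp].
have bf : bmeas f by split; [exact: continuous_measurable_fun|exists 1].
have Ef : Ex mu f = 0.
  apply/esym; apply: (cvg_unique _ _ (avg_cvg cf (ex_intro _ 1 f1) f0)) => //.
  rewrite (_ : avg f = cst 0); first exact: cvg_cst.
  apply/funext => t; rewrite /avg big1 ?mulr0// => i _.
  by rewrite /f clamp_id// subrr normr0; apply/min_idPr.
have If : (\int[mu]_x `|(f x)%:E|)%E = 0%E.
  rewrite -[RHS](congr1 EFin Ef).
  transitivity (\int[mu]_x (f x)%:E)%E; last by rewrite -(Ex_ge0_EFin mu bf).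
  by apply: eq_integral => x _ /=; rewrite ger0_norm.
have mF : measurable_fun [set: R] (EFin \o f) by apply/measurable_EFinP; exact: bf.1.
move: If => /(ae_eq_integral_abs mu measurableT mF); apply: filterS => x /(_ I)/= [].
rewrite /f => /eqP; rewrite minEle; case: ifP => _; first by rewrite oner_eq0.
by rewrite normr_eq0 subr_eq0 eq_sym => /eqP.
Qed.

Lemma weak_limit_clamp (g : R -> R) : measurable_fun setT g ->
  \int[mu]_x g x = \int[mu]_x g (clamp x).
Proof.
move=> mg; rewrite /Rintegral; congr fine; apply: ae_eq_integral => //.
- exact/measurable_EFinP.
- apply/measurable_EFinP; apply: measurableT_comp mg _.
  by apply: continuous_measurable_fun; exact: continuous_clamp.
- by apply: filterS weak_limit_ae => x h _ /=; rewrite h.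
Qed.

Lemma weak_limit_mean : avg id t @[t --> \oo] --> mean mu.
Proof.
rewrite /mean weak_limit_clamp; last exact: measurable_id.
rewrite (_ : avg id = avg clamp); last first.
  apply/funext => t; rewrite /avg; congr (_ * _); apply: eq_bigr => i _.
  by rewrite clamp_id.
apply: avg_cvg; first exact: continuous_clamp.
  by exists b => x; have /andP[? ?] := clamp_itv ab x; rewrite ger0_norm// ltW// clamp_gt0.
by move=> x; rewrite ltW// clamp_gt0.
Qed.

Let inv_gt0 s x : 0 <= s -> 0 < 1 + s * clamp x.
Proof. by move=> s0; rewrite ltr_wpDr// mulr_ge0// ltW// clamp_gt0. Qed.

Let inv_le1 s x : 0 <= s -> `|(1 + s * clamp x)^-1| <= 1.
Proof.
move=> s0; have c0 := inv_gt0 x s0.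
rewrite ger0_norm ?invr_ge0 ?(ltW c0)// invf_le1// lerDl.
by rewrite mulr_ge0// ltW// clamp_gt0.
Qed.

Lemma eta_clamp (s : R) : Defs.eta mu s = \int[mu]_x (1 + s * clamp x)^-1.
Proof.
rewrite /Defs.eta (weak_limit_clamp (g := fun x => (1 + s * x)^-1))//.
apply: measurable_inv; apply: measurable_funD => //.
Qed.

Lemma weak_limit_eta s : 0 <= s -> avg (fun x => (1 + s * x)^-1) t @[t --> \oo] --> Defs.eta mu s.
Proof.
move=> s0; rewrite eta_clamp.
rewrite (_ : avg _ = avg (fun x => (1 + s * clamp x)^-1)); last first.
  apply/funext => t; rewrite /avg; congr (_ * _); apply: eq_bigr => i _.
  by rewrite clamp_id.
apply: avg_cvg; first exact: continuous_eta_clamp.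
  by exists 1 => x; exact: inv_le1.
by move=> x; rewrite invr_ge0 ltW// inv_gt0.
Qed.

Lemma bmeas_eta s : 0 <= s -> bmeas (fun x => (1 + s * clamp x)^-1).
Proof.
by move=> s0; split; [apply: continuous_measurable_fun; exact: continuous_eta_clamp
  |exists 1 => x; exact: inv_le1].
Qed.

Lemma eta_le s : 0 <= s -> Defs.eta mu s <= (1 + a * s)^-1.
Proof.
move=> s0; rewrite eta_clamp -[leRHS](Ex_cst mu).
apply: Ex_le; [exact: bmeas_eta|exact: bmeas_cst|move=> x].
have /andP[h _] := clamp_itv ab x.
rewrite lef_pV2 ?posrE ?inv_gt0//; last by rewrite ltr_wpDr// mulr_ge0// ltW.
by rewrite lerD2l mulrC ler_wpM2l.
Qed.

Lemma eta0 : Defs.eta mu 0 = 1.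
Proof.
rewrite eta_clamp -[RHS](Ex_cst mu); apply: eq_Rintegral => x _.
by rewrite mul0r addr0 invr1.
Qed.

Lemma eta_lipschitz s t : 0 <= s -> 0 <= t -> `|Defs.eta mu s - Defs.eta mu t| <= b * `|s - t|.
Proof.
move=> s0 t0; rewrite !eta_clamp -ExB; try exact: bmeas_eta.
have bB : bmeas (fun x => (1 + s * clamp x)^-1 - (1 + t * clamp x)^-1).
  by apply: bmeasB; exact: bmeas_eta.
apply: le_trans (Ex_norm_le mu bB) _; rewrite -[leRHS](Ex_cst mu).
apply: Ex_le; [exact: bmeas_norm|exact: bmeas_cst|move=> x].
have /andP[h1 h2] := clamp_itv ab x; have c0 : 0 < clamp x by exact: clamp_gt0.
have u0 := inv_gt0 x s0; have w0 := inv_gt0 x t0.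
have -> : (1 + s * clamp x)^-1 - (1 + t * clamp x)^-1 =
    (1 + s * clamp x)^-1 * (1 + t * clamp x)^-1 * (clamp x * (t - s)).
  by field; rewrite !gt_eqF.
rewrite !normrM -[leRHS]mul1r; apply: ler_pM; rewrite ?mulr_ge0//.
  by apply: mulr_ile1; rewrite ?normr_ge0// inv_le1.
by rewrite distrC (gtr0_norm c0) ler_wpM2r.
Qed.

(** Intermediate value theorem. [F] extends the transform evenly to the whole line, so that
    continuity at 0 is two-sided. *)
Lemma eta_f_spec gamma : 0 < gamma < 1 ->
  0 <= eta_f gamma mu /\ Defs.eta mu (eta_f gamma mu) = 1 - gamma.
Proof.
move=> /andP[g0 g1]; rewrite /eta_f /eta_inv; set y := 1 - gamma.
have y0 : 0 < y by rewrite subr_gt0.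
have y1 : y <= 1 by rewrite gerBl ltW.
apply: (@xgetPex _ 0 [set x | 0 <= x /\ Defs.eta mu x = y]).
pose F (x : R) := Defs.eta mu `|x|.
have cF : continuous F.
  have b0 : 0 < b by exact: lt_le_trans ab.
  move=> x; apply/cvgrPdist_le => e e0; near=> z.
  apply: le_trans (eta_lipschitz _ _) _; rewrite ?normr_ge0//.
  rewrite mulrC -ler_pdivlMr//; apply: le_trans (ler_dist_dist _ _) _.
  near: z; apply/nbhs_normP; exists (e / b); first by rewrite /= divr_gt0.
  by move=> z /= /ltW.
(* At this point the upper bound [1 / (1 + a X)] is already below [y]. *)
pose X := (a * y)^-1.
have X0 : 0 <= X by rewrite invr_ge0 ltW// mulr_gt0.
have FX : F X <= y.
  rewrite /F (ger0_norm X0); apply: le_trans (eta_le X0) _.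
  rewrite -[leRHS]invrK lef_pV2 ?posrE ?invr_gt0//; last first.
    by rewrite ltr_wpDr// mulr_ge0// ltW.
  by rewrite /X invfM mulrA divff ?gt_eqF// mul1r lerDr ler01.
have F0 : F 0 = 1 by rewrite /F normr0 eta0.
have [|c] := @IVT R F 0 X y X0 (continuous_subspaceT cF).
  by rewrite F0 minC ge_min FX le_max y1.
rewrite in_itv/= => /andP[c0 _]; rewrite /F (ger0_norm c0) => Fc.
by exists c.
Unshelve. all: by end_near.
Qed.

End weak_limit.

(** * Almost sure limits *)

Section borel_cantelli.
Context d (Omega : measurableType d) {R : realType} (P : probability Omega R).

(** The rank from which [Q] holds may depend on the sample point, as in the conclusion of the
    Borel-Cantelli lemma. *)
Definition almost_eventually (Q : nat -> Omega -> Prop) :=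
  {ae P, forall om, \forall t \near \oo, Q t om}.

Lemma ae_eventually_near (Q : nat -> Prop) (Q1 Q2 : nat -> Omega -> Prop) :
  (\forall t \near \oo, Q t) -> (forall t om, Q t -> Q1 t om -> Q2 t om) ->
  almost_eventually Q1 -> almost_eventually Q2.
Proof.
move=> nQ QQ; apply: filterS => om; apply: filterS2 nQ => t; exact: QQ.
Qed.

Lemma ae_eventuallyS2 (Q1 Q2 Q : nat -> Omega -> Prop) :
  (forall t om, Q1 t om -> Q2 t om -> Q t om) ->
  almost_eventually Q1 -> almost_eventually Q2 -> almost_eventually Q.
Proof.
move=> h; apply: filterS2 => om; apply: filterS2 => t; exact: h.
Qed.

Lemma ae_eventuallyS (Q1 Q : nat -> Omega -> Prop) :
  (forall t om, Q1 t om -> Q t om) -> almost_eventually Q1 -> almost_eventually Q.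
Proof. by move=> h; apply: filterS => om; apply: filterS => t; exact: h. Qed.

(** Telescoping of [1 / y^2 <= 2 / y - 2 / (y + 1)], valid for [y >= 1]. *)
Let sum_inv_le (n : nat) : \sum_(0 <= t < n) (t.+1%:R ^+ 2 : R)^-1 <= 2 - 2 / n.+1%:R.
Proof.
elim: n => [|n IH]; first by rewrite big_nil; lra.
rewrite big_nat_recr//=; apply: le_trans (lerD IH (lexx _)) _.
have -> : n.+2%:R = n.+1%:R + 1 :> R by rewrite -natr1.
set y := n.+1%:R; have y1 : 1 <= y :> R by rewrite /y -[1]/(1%:R) ler_nat.
have y0 : 0 < y by exact: lt_le_trans y1.
have z0 : 0 < y + 1 by rewrite addr_gt0.
rewrite -subr_ge0.
have -> : 2 - 2 / (y + 1) - (2 - 2 / y + (y ^+ 2)^-1) = (y - 1) / (y ^+ 2 * (y + 1)).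
  by field; rewrite !gt_eqF.
by rewrite divr_ge0 ?subr_ge0// mulr_ge0 ?sqr_ge0// ltW.
Qed.

Lemma borel_cantelli_sqr (N : nat -> nat) (E : nat -> set Omega) (K : R) :
  (forall t, (t <= N t)%N) -> (forall t, measurable (E t)) ->
  (\forall t \near \oo, (P (E t) <= (K / (N t)%:R ^+ 2)%:E)%E) ->
  almost_eventually (fun t om => ~ E t om).
Proof.
move=> tN mE [T _ hT].
(* The square covers the finitely many indices before the bound holds, where the probability is at
   most 1; the 4 comes from [t + 1 <= 2 N t]. *)
pose K' : R := 4 * `|K| + T.+1%:R ^+ 2.
have K'0 : 0 <= K' by rewrite addr_ge0 ?mulr_ge0 ?sqr_ge0.
have bE t : (P (E t) <= (K' / t.+1%:R ^+ 2)%:E)%E.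
  have t0 : 0 < t.+1%:R ^+ 2 :> R by rewrite exprn_gt0.
  have [tT|Tt] := ltnP t T.+1.
    apply: le_trans (probability_le1 P (mE t)) _; rewrite lee_fin ler_pdivlMr// mul1r.
    apply: (@le_trans _ _ (T.+1%:R ^+ 2)); last by rewrite lerDr mulr_ge0.
    by rewrite lerXn2r ?nnegrE// ler_nat.
  apply: le_trans (hT t (ltnW Tt)) _; rewrite lee_fin.
  have N0 : 0 < (N t)%:R ^+ 2 :> R.
    by rewrite exprn_gt0// ltr0n (leq_trans _ (tN t))// (leq_trans _ Tt).
  rewrite ler_pdivrMr// mulrAC ler_pdivlMr//.
  have h : t.+1%:R ^+ 2 <= 4 * (N t)%:R ^+ 2 :> R.
    rewrite (_ : 4 = 2 ^+ 2); last by ring.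
    rewrite -exprMn lerXn2r ?nnegrE ?mulr_ge0//.
    rewrite -natrM ler_nat mul2n -addnn; have := tN t; case: (t) Tt => // t' _ h.
    by rewrite -(addn1 t'.+1) leq_add// (leq_trans _ h).
  apply: (@le_trans _ _ (`|K| * (4 * (N t)%:R ^+ 2))).
    by apply: le_trans (ler_wpM2r (ltW t0) (ler_norm K)) _; rewrite ler_wpM2l.
  by rewrite mulrA [`|K| * 4]mulrC ler_wpM2r ?(ltW N0)// lerDl sqr_ge0.
have fin : (\big[+%E/0%R]_(0 <= t <oo) P (E t) < +oo)%E.
  apply: (@le_lt_trans _ _ (K' * 2)%:E); last exact: ltry.
  apply: lime_le; first by apply: is_cvg_nneseries => *; exact: measure_ge0.
  apply: nearW => n.
  apply: (@le_trans _ _ (\sum_(0 <= t < n) (K' / t.+1%:R ^+ 2)%:E)%E).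
    by apply: lee_sum => t _; exact: bE.
  rewrite sumEFin lee_fin -mulr_sumr ler_wpM2l//.
  by apply: le_trans (sum_inv_le n) _; rewrite gerBl divr_ge0.
have z := lim_sup_set_cvg0 mE fin.
exists (lim_sup_set E); split => //.
  by apply: bigcap_measurable => // n _; apply: bigcup_measurable => j _; exact: mE.
move=> om /= h n _; apply: contrapT => h'; apply: h.
exists n => // t /= nt Et; apply: h'; exists t => //.
Qed.

Lemma borel_cantelli_exp (N : nat -> nat) (E : nat -> set Omega) (K e : R) : 0 < e -> 0 <= K ->
  (forall t, (t <= N t)%N) -> (forall t, measurable (E t)) ->
  (\forall t \near \oo, (P (E t) <= (K * expR (- (e * (N t)%:R)))%:E)%E) ->
  almost_eventually (fun t om => ~ E t om).
Proof.
move=> e0 K0 tN mE nE; apply: (borel_cantelli_sqr (K := K * (4 / e ^+ 2)) tN mE).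
near=> t; apply: le_trans (_ : (_ <= (K * expR (- (e * (N t)%:R)))%:E)%E) _; first by near: t.
rewrite lee_fin -mulrA ler_wpM2l//.
have N0 : 0 < (N t)%:R :> R.
  by rewrite ltr0n (leq_trans _ (tN t))//; near: t; exists 1%N.
set y : R := (N t)%:R in N0 *.
(* Squared, this bounds [exp (- e y)] by [4 / (e y)^2] and reduces to the previous lemma. *)
have h : 1 + e * y / 2 <= expR (e * y / 2) by exact: expR_ge1Dx.
have y0 : 0 < e * y / 2 by rewrite divr_gt0// mulr_gt0.
rewrite expRN (_ : e * y = e * y / 2 + e * y / 2); last by field.
rewrite expRD -expr2.
rewrite (_ : 4 / e ^+ 2 / y ^+ 2 = ((e * y / 2) ^+ 2)^-1); last by field; rewrite !gt_eqF.
rewrite lef_pV2 ?posrE ?exprn_gt0 ?expR_gt0//.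
by rewrite lerXn2r ?nnegrE ?expR_ge0 ?(ltW y0)// (le_trans _ h)// lerDr.
Unshelve. all: by end_near.
Qed.

End borel_cantelli.

(** * Weights restricted to a set of rows, and the a priori bound *)

Section sub_weight.
Context {R : realType} {n : nat}.

Definition sub_weight (g : 'I_n -> R) (S : {set 'I_n}) r := if r \in S then g r else 0.

Lemma sub_weight_bounds (g : 'I_n -> R) S b :
  (forall r, 0 <= g r <= b) -> forall r, 0 <= sub_weight g S r <= b.
Proof.
move=> gb r; rewrite /sub_weight; case: ifP => _ //; rewrite lexx/=.
by have /andP[h1 h2] := gb r; exact: le_trans h2.
Qed.

Lemma sum_satur_sub (g : 'I_n -> R) S x :
  \sum_r satur (sub_weight g S r) x = \sum_(r in S) satur (g r) x.
Proof.
rewrite [RHS]big_mkcond/=; apply: eq_bigr => r _; rewrite /sub_weight.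
by case: ifP => // _; rewrite /satur !mul0r.
Qed.

Lemma saturE (w x : R) : 0 <= w -> 0 <= x -> satur w x = 1 - (1 + w * x)^-1.
Proof.
by move=> w0 x0; rewrite /satur; field; rewrite gt_eqF// ltr_wpDr// mulr_ge0.
Qed.

(** Each row of [S] contributes at least [1 - 1 / (1 + a x)], while the total is at most [p] plus
    the error, hence at most [(1 + theta) / 2] per row. So [x] is bounded as soon as [p] is below
    [|S|] with a margin, and the bound is free of [kappa]. *)
Lemma apriori_bound (g : 'I_n -> R) (S : {set 'I_n}) (a theta err kappa x : R) p :
  (0 < n)%N -> 0 < a -> (forall r, a <= g r) -> 0 < #|S|%:R :> R -> theta < 1 ->
  0 < kappa -> 0 <= x -> p%:R <= theta * #|S|%:R ->
  err * n%:R <= (1 - theta) / 2 * #|S|%:R ->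
  `|p%:R / n%:R - kappa * x - n%:R^-1 * \sum_r satur (sub_weight g S r) x| <= err ->
  x <= 2 / (a * (1 - theta)).
Proof.
move=> n0 a0 ga S0 t1 k0 x0 pS eS; rewrite sum_satur_sub.
have N0 : 0 < n%:R :> R by rewrite ltr0n.
set T := \sum_(r in S) _ => h.
have u0 : 0 < 1 + a * x by rewrite ltr_wpDr// mulr_ge0// ltW.
have lT : #|S|%:R * (1 - (1 + a * x)^-1) <= T.
  rewrite mulr_natl -sumr_const; apply: ler_sum => r _.
  have gr : 0 < g r by exact: lt_le_trans (ga r).
  rewrite saturE ?(ltW gr)// lerD2l lerN2 lef_pV2 ?posrE//.
    by rewrite lerD2l ler_wpM2r.
  by rewrite ltr_wpDr// mulr_ge0// ltW.
have uT : T <= p%:R + err * n%:R.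
  have h' : n%:R^-1 * T <= p%:R / n%:R + err.
    move: h; rewrite ler_norml => /andP[h _]; have kx := mulr_ge0 (ltW k0) x0; lra.
  rewrite -(ler_pM2l (_ : 0 < n%:R^-1)) ?invr_gt0//; apply: le_trans h' _.
  by rewrite le_eqVlt; apply/orP; left; apply/eqP; field; rewrite gt_eqF.
have h1 : #|S|%:R * (1 - (1 + a * x)^-1) <= #|S|%:R * ((1 + theta) / 2).
  by apply: le_trans lT _; apply: le_trans uT _; lra.
rewrite ler_pM2l// in h1.
have h2 : (1 - theta) / 2 <= (1 + a * x)^-1 by lra.
have d0 : 0 < (1 - theta) / 2 by lra.
have h3 : 1 + a * x <= 2 / (1 - theta).
  by rewrite -[2 / _]invf_div -[leLHS]invrK lef_pV2 ?posrE ?invr_gt0.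
rewrite invfM mulrCA mulrC ler_pdivlMr// mulrC; lra.
Qed.

Context {p : nat}.

Lemma psd_scalar (c : R) : 0 <= c -> possemidefmx (c%:M : 'M[R]_p).
Proof.
by move=> c0; rewrite -scalemx1; apply: psdZ => //; apply: posdef_psd; exact: posdef_scalar.
Qed.

Lemma posdef_shift_le (A : 'M[R]_p) (c c' : R) : c <= c' ->
  posdefmx (A - c'%:M) -> posdefmx (A - c%:M).
Proof.
move=> cc' pA; have -> : A - c%:M = A - c'%:M + (c' - c)%:M.
  by rewrite [(c' - c)%:M]raddfB/= addrA subrK.
by apply: posdefDl => //; apply: psd_scalar; rewrite subr_ge0.
Qed.

Lemma wgram_sub (g : 'I_n -> R) (S : {set 'I_n}) (M : 'M[R]_(n, p)) :
  wgram (sub_weight g S) M = \sum_(r in S) g r *: ((row r M)^T *m row r M).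
Proof.
rewrite /wgram [RHS]big_mkcond/=; apply: eq_bigr => r _; rewrite /sub_weight.
by case: ifP => // _; rewrite scale0r.
Qed.

Lemma barrier_mx_split (g : 'I_n -> R) (S : {set 'I_n}) m (M : 'M[R]_(n, p)) :
  barrier_mx g (wgram (sub_weight g [set r in drop m (enum S)])) (take m (enum S)) M =
  wgram (sub_weight g S) M.
Proof.
rewrite /barrier_mx !wgram_sub -[in RHS]big_enum -[in RHS](cat_take_drop m (enum S)) big_cat/=.
rewrite addrC; congr (_ + _); rewrite big_uniq ?drop_uniq ?enum_uniq//=.
by apply: eq_bigl => r; rewrite inE.
Qed.

Lemma card_drop_enum (S : {set 'I_n}) m : #|[set r in drop m (enum S)]| = (#|S| - m)%N.
Proof.
by rewrite cardsE (card_uniqP _) ?drop_uniq ?enum_uniq// size_drop -cardE.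
Qed.

End sub_weight.

Definition mean_bound {R : realType} (a theta : R) := 2 / (a * (1 - theta)).

Definition ridge_error {R : realType} (m4 b kappa : R) n : R :=
  b * ((8 + 2 * m4) / (2 * kappa ^+ 2) + 2^-1 + 9 / kappa) / Num.sqrt n%:R.

Lemma ridge_error_small {R : realType} (N : nat -> nat) (tN : forall t, (t <= N t)%N)
  (m4 b kappa e : R) : 0 < kappa -> 0 < e -> \forall t \near \oo, ridge_error m4 b kappa (N t) <= e.
Proof.
move=> k0 e0; rewrite /ridge_error; set C := b * _.
near=> t.
have h : (C / e) ^+ 2 + 1 <= (N t)%:R.
  apply: (@le_trans _ _ t%:R); last by rewrite ler_nat.
  by near: t; exact: nbhs_infty_ger.
have N0 : 0 < (N t)%:R :> R by apply: lt_le_trans h; rewrite ltr_wpDl// sqr_ge0.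
rewrite ler_pdivrMr ?sqrtr_gt0// mulrC -ler_pdivrMr//.
apply: le_trans (ler_norm _) _; rewrite -sqrtr_sqr ler_wsqrtr//.
by apply: le_trans h; rewrite lerDl.
Unshelve. all: by end_near.
Qed.

(** * Almost sure estimates along the sequence of problems *)

Section asymptotics.
Context d (Omega : measurableType d) {R : realType} (P : probability Omega R).
Variables (N p : nat -> nat) (Z : forall t, 'I_(N t) -> 'I_(p t) -> {RV P >-> R}).
Hypothesis tN : forall t, (t <= N t)%N.
Hypothesis Zind : forall t,
  mutual_independence (fun ij : 'I_(N t) * 'I_(p t) => Z ij.1 ij.2).
Variable m4 : R.
Hypothesis m4_ge0 : 0 <= m4.
Hypothesis Zmom : forall t (i : 'I_(N t)) (j : 'I_(p t)) (x y s : R),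
  (\int[P]_w ((x + y * Z i j w + s * (Z i j w ^+ 2 - 1)) ^+ 2)%:E <=
   (x ^+ 2 + 2 * y ^+ 2 + 2 * m4 * s ^+ 2)%:E)%E.
Variables (a b : R) (g : forall t, 'I_(N t) -> R).
Hypotheses (a0 : 0 < a) (gab : forall t (r : 'I_(N t)), a <= g r <= b).

Let ga t (r : 'I_(N t)) : a <= g r.
Proof. by have /andP[] := gab r. Qed.
Let g0b t (r : 'I_(N t)) : 0 <= g r <= b.
Proof. by have /andP[h ->] := gab r; rewrite (le_trans (ltW a0) h). Qed.

Let err kappa t := ridge_error m4 b kappa (N t).
Let err_small kappa e (k0 : 0 < kappa) (e0 : 0 < e) := ridge_error_small tN m4 b k0 e0.

Section row_sets.
Variables (S : forall t, {set 'I_(N t)}) (theta s0 : R).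
Hypotheses (theta1 : theta < 1) (s00 : 0 < s0).
Hypothesis pS : \forall t \near \oo, (p t)%:R <= theta * #|S t|%:R.
Hypothesis SN : \forall t \near \oo, s0 * (N t)%:R <= #|S t|%:R.
Let w t := sub_weight (g (t:=t)) (S t).
Let w0b t r : 0 <= w (t:=t) r <= b.
Proof. by apply: sub_weight_bounds; exact: g0b. Qed.


Lemma mean_bound_gt0 : 0 < mean_bound a theta.
Proof. by rewrite divr_gt0// mulr_gt0// subr_gt0. Qed.

Let pN : \forall t \near \oo, (p t <= N t)%N.
Proof.
near=> t; rewrite -(ler_nat R); apply: (@le_trans _ _ (theta * #|S t|%:R)); first by near: t.
apply: (@le_trans _ _ #|S t|%:R); first by rewrite ler_piMl// ltW.
by rewrite ler_nat -[leqRHS]card_ord max_card.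
Unshelve. all: by end_near.
Qed.

Let N_gt0 : \forall t \near \oo, (0 < N t)%N.
Proof. by exists 1%N => // t /= t0; exact: leq_trans (tN t). Qed.

Let mean_equation kappa t : (0 < N t)%N -> (p t <= N t)%N -> 0 < kappa ->
  `|(p t)%:R / (N t)%:R - kappa * ridge_mean (Z (t:=t)) (@w t) (kappa * (N t)%:R)
    - (N t)%:R^-1 * \sum_r satur (@w t r) (ridge_mean (Z (t:=t)) (@w t) (kappa * (N t)%:R))| <=
      err kappa t.
Proof.
move=> n0 pn k0.
have h := ridge_equation (@Zind t) m4_ge0 (Zmom (t:=t)) (w0b (t:=t)) n0 pn k0.
exact: h.
Qed.

Let mean_ge0 kappa t : (0 < N t)%N -> 0 < kappa ->
  0 <= ridge_mean (Z (t:=t)) (@w t) (kappa * (N t)%:R).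
Proof.
move=> n0 k0; have e0 : 0 < kappa * (N t)%:R by rewrite mulr_gt0// ltr0n.
by have /andP[] := ridge_mean_bound (Z (t:=t)) (w0b (t:=t)) e0.
Qed.

Lemma ridge_mean_le kappa : 0 < kappa -> \forall t \near \oo,
  ridge_mean (Z (t:=t)) (@w t) (kappa * (N t)%:R) <= mean_bound a theta.
Proof.
move=> k0; have e0 : 0 < (1 - theta) / 2 * s0 by rewrite mulr_gt0// divr_gt0// subr_gt0.
near=> t; have n0 : (0 < N t)%N by near: t.
have N0 : 0 < (N t)%:R :> R by rewrite ltr0n.
have sN : s0 * (N t)%:R <= #|S t|%:R by near: t.
apply: (@apriori_bound _ _ (g (t:=t)) (S t) a theta (err kappa t) kappa _ (p t)) => //.
- by apply: lt_le_trans sN; rewrite mulr_gt0.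
- exact: mean_ge0.
- by near: t.
- apply: (@le_trans _ _ ((1 - theta) / 2 * s0 * (N t)%:R)).
    by rewrite ler_pM2r//; near: t; exact: err_small.
  by rewrite -mulrA ler_wpM2l// divr_ge0// subr_ge0 ltW.
- by apply: mean_equation => //; near: t.
Unshelve. all: by end_near.
Qed.

Lemma ridge_tr_cvg kappa e : 0 < kappa -> 0 < e -> almost_eventually P (fun t om =>
  `|ridge_tr (@w t) (kappa * (N t)%:R) (mxrv (Z (t:=t)) om)
    - ridge_mean (Z (t:=t)) (@w t) (kappa * (N t)%:R)| <= e).
Proof.
move=> k0 e0.
(* The first conjunct excludes the empty problem, whose ridge parameter is 0. *)
pose E t : set Omega := [set om | (0 < N t)%N && (e <=
  `|ridge_tr (@w t) (kappa * (N t)%:R) (mxrv (Z (t:=t)) om)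
    - ridge_mean (Z (t:=t)) (@w t) (kappa * (N t)%:R)|)].
have mE t : measurable (E t).
  rewrite /E; have [n0|n0] := posnP (N t).
    by rewrite [X in measurable X](_ : _ = set0)//; apply/seteqP; split.
  have e1 : 0 < kappa * (N t)%:R by rewrite mulr_gt0// ltr0n.
  rewrite /= -[X in measurable X]setTI.
  apply: (measurable_fun_ler _ _ measurableT (Y := [set true])) => //.
  apply: measurableT_comp => //; apply: measurable_funB => //.
  apply: (bmeas_mxrv (Z (t:=t)) _).1; apply: bmeas_ridge_tr => // r.
  by have /andP[] := w0b r.
pose sigma := Num.min 2^-1 (kappa * e / 4).
have sg : 0 < sigma by rewrite lt_min invr_gt0 ltr0n/= divr_gt0// mulr_gt0.
have c0 : 0 < sigma * kappa * e / 2 by rewrite divr_gt0// !mulr_gt0.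
have nE : \forall t \near \oo, (P (E t) <= (2 * expR (- (sigma * kappa * e / 2 * (N t)%:R)))%:E)%E.
  near=> t; have n0 : (0 < N t)%N by near: t.
  by rewrite /E n0; exact: (ridge_tail (@Zind t) (w0b (t:=t)) n0 k0 e0).
have bc := borel_cantelli_exp c0 (ler0n _ 2) tN mE nE.
apply: (ae_eventually_near N_gt0 _ bc) => t om n0 nEt.
by rewrite leNgt; apply/negP => h; apply: nEt; rewrite /E /= n0 ltW.
Unshelve. all: by end_near.
Qed.

End row_sets.

Section lower_bound.
Variables (S : forall t, {set 'I_(N t)}) (theta s0 : R).
Hypotheses (theta1 : theta < 1) (s00 : 0 < s0).
Hypothesis pS : \forall t \near \oo, (p t)%:R <= theta * #|S t|%:R.
Hypothesis SN : \forall t \near \oo, s0 * (N t)%:R <= #|S t|%:R.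
Let w t := sub_weight (g (t:=t)) (S t).

(* Most rows of [S t] only provide the initial barrier, at the level [- kappa n];
   the other [m t] rows then raise the level above [0]. This is consistent because
   the initial bound [phi] does not depend on [kappa]. *)
Lemma gram_lower_bound : exists2 c, 0 < c & almost_eventually P (fun t om =>
  posdefmx (wgram (@w t) (mxrv (Z (t:=t)) om) - (c * (N t)%:R)%:M)).
Proof.
(* With [k = m / q0] the contraction over [m] rows is at most [4^-k], which beats the factor [2^k]
   from Markov's inequality. *)
have [q0 q0P] : exists q0 : nat, (1 - barrier_gap m4 / 4) ^+ q0 <= 4^-1.
  have /andP[g0 g1] := barrier_gap_bounds m4_ge0.
  have z1 : `|1 - barrier_gap m4 / 4| < 1 by rewrite ltr_norml; apply/andP; split; lra.
  have /cvgrPdist_le/(_ _ (_ : 0 < 4^-1)) := cvg_expr z1.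
  move=> /(_ ltac:(by rewrite invr_gt0))[q _ /(_ q (leqnn q))]; rewrite /= sub0r normrN.
  by move=> h; exists q; apply: le_trans (ler_norm _) h.
pose dl := (1 - theta) / 2.
have dl0 : 0 < dl by rewrite divr_gt0// subr_gt0.
(* Only [|S| / q] rows are spent on raising the level: [q >= 2] leaves at least half of [S], and
   [1 / q <= dl] keeps the aspect ratio of the remaining rows at most [theta' < 1]. *)
have [q [q2 qdl]] : exists q : nat, (2 <= q)%N /\ dl^-1 <= q%:R.
  have [q _ /(_ q (leqnn q)) h] := nbhs_infty_ger dl^-1.
  by exists (maxn 2 q); rewrite leq_maxl (le_trans h)// ler_nat leq_maxr.
have q_gt0 : 0 < q%:R :> R by rewrite ltr0n (leq_trans _ q2).
pose m t := (#|S t| %/ q)%N.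
pose S' t := [set r in drop (m t) (enum (S t))].
pose rs t := take (m t) (enum (S t)).
have m_le t : (m t)%:R <= dl * #|S t|%:R.
  have h1 : (m t)%:R * q%:R <= #|S t|%:R :> R by rewrite -natrM ler_nat leq_trunc_div.
  have h2 : (m t)%:R <= #|S t|%:R / q%:R :> R by rewrite ler_pdivlMr.
  apply: le_trans h2 _; rewrite mulrC ler_wpM2r// -[leRHS]invrK lef_pV2 ?posrE ?invr_gt0//.
have m_half t : (m t)%:R <= #|S t|%:R / 2 :> R.
  have h1 : (m t)%:R * q%:R <= #|S t|%:R :> R by rewrite -natrM ler_nat leq_trunc_div.
  have h2 : (m t)%:R * 2 <= (m t)%:R * q%:R :> R by rewrite ler_wpM2l// ler_nat.
  by rewrite ler_pdivlMr//; apply: le_trans h1.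
have cS' t : #|S' t|%:R = #|S t|%:R - (m t)%:R :> R.
  by rewrite /S' card_drop_enum natrB// leq_div.
pose theta' := (1 + theta) / 2.
have theta'1 : theta' < 1 by rewrite /theta' ltr_pdivrMr// mul1r -[ltRHS]/(1 + 1) ltrD2l.
have pS' : \forall t \near \oo, (p t)%:R <= theta' * #|S' t|%:R.
  near=> t; apply: (@le_trans _ _ (theta * #|S t|%:R)); first by near: t.
  rewrite cS' mulrBr lerBrDr (_ : theta' = theta + dl); last by rewrite /theta' /dl; field.
  rewrite [leRHS]mulrDl lerD2l; apply: le_trans (m_le t); rewrite -[leRHS]mul1r ler_wpM2r//.
  by rewrite (_ : theta + dl = theta') ?ltW// /theta' /dl; field.
have S'N : \forall t \near \oo, s0 / 2 * (N t)%:R <= #|S' t|%:R.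
  near=> t; have sN : s0 * (N t)%:R <= #|S t|%:R by near: t.
  have mh := m_half t; rewrite cS'; lra.
(* The 1 absorbs the deviation of the trace from its mean, eventually at most 1. *)
pose phi := mean_bound a theta' + 1.
have mb0 : 0 < mean_bound a theta' by exact: mean_bound_gt0.
have phi0 : 0 < phi by rewrite addr_gt0.
pose Q := (q * maxn 1 q0)%N.
have Q0 : 0 < Q%:R :> R by rewrite ltr0n muln_gt0 leq_max/= andbT (leq_trans _ q2).
(* The factor 2 absorbs the rounding in the integer divisions. *)
pose c1 := s0 / (2 * Q%:R).
have c10 : 0 < c1 by rewrite divr_gt0// mulr_gt0.
pose k t := (m t %/ maxn 1 q0)%N.
have k_ge : \forall t \near \oo, c1 * (N t)%:R <= (k t)%:R.
  near=> t; have sN : s0 * (N t)%:R <= #|S t|%:R by near: t.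
  have kQ : #|S t|%:R <= ((k t)%:R + 1) * Q%:R :> R.
    by rewrite natr1 -natrM ler_nat /k /m -divnMA ltnW// ltn_ceil// -(ltr0n R).
  have N1 : c1^-1 <= (N t)%:R.
    by apply: (@le_trans _ _ t%:R); [near: t; exact: nbhs_infty_ger|rewrite ler_nat].
  have N2 : 1 <= c1 * (N t)%:R by rewrite -ler_pdivrMl// mulr1.
  have e1 : s0 * (N t)%:R = 2 * (c1 * (N t)%:R) * Q%:R by rewrite /c1; field; rewrite gt_eqF.
  have h : 2 * (c1 * (N t)%:R) <= (k t)%:R + 1.
    by rewrite -(ler_pM2r Q0) -e1; apply: le_trans kQ.
  lra.
pose delta := barrier_shift m4 phi a.
have delta0 : 0 < delta by exact: barrier_shift_gt0.
(* The level starts at [- kappa n] and rises by at least [delta k >= delta c1 n = 2 kappa n], so it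
   ends at [kappa n] or above. *)
pose kappa := delta * c1 / 2.
have kappa0 : 0 < kappa by rewrite divr_gt0// mulr_gt0.
pose A0 t (M : 'M[R]_(N t, p t)) := wgram (sub_weight (g (t:=t)) (S' t)) M.
pose W t om := barrier_weight m4 phi a (g (t:=t)) (@A0 t) (- (kappa * (N t)%:R)) (rs t) (mxrv (Z
  (t:=t)) om).
pose E t : set Omega := [set om | 2^-1 ^+ k t <= W t om].
have mE t : measurable (E t).
  by apply: measurable_barrier_weight; apply: mxmeas_wgram; exact: mxmeas_id.
have nE : \forall t \near \oo, (P (E t) <= (1 * expR (- (c1 / 2 * (N t)%:R)))%:E)%E.
  near=> t; have kN : c1 * (N t)%:R <= (k t)%:R by near: t.
  apply: (@le_trans _ _ ((2 ^+ k t * (1 - barrier_gap m4 / 4) ^+ size (rs t))%:E)).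
    apply: (barrier_weight_tail (@Zind t) m4_ge0 (Zmom (t:=t)) a _ _ phi0).
    - by apply: mxmeas_wgram; exact: mxmeas_id.
    - move=> M; have [] // := @psd_wgram R (N t) (p t) (sub_weight (g (t:=t)) (S' t)) M _.
      by move=> r; have /andP[] := sub_weight_bounds (S' t) (g0b (t:=t)) r.
    - by rewrite take_uniq// enum_uniq.
    - move=> r M M' rs_r; apply: wgram_resample; rewrite /sub_weight inE.
      have : uniq (take (m t) (enum (S t)) ++ drop (m t) (enum (S t))).
        by rewrite cat_take_drop enum_uniq.
      by rewrite cat_uniq => /and3P[_ /hasPn h _]; case: ifP => // /h /negP[].
  rewrite lee_fin mul1r size_takel; last by rewrite -cardE leq_div.
  set z := 1 - _; have z01 : 0 <= z <= 1.
    by have /andP[? ?] := barrier_gap_bounds m4_ge0; rewrite /z; apply/andP; split; lra.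
  have /andP[z0 z1] := z01.
  have h1 : z ^+ m t <= 4^-1 ^+ k t.
    apply: (@le_trans _ _ (z ^+ (maxn 1 q0 * k t))).
      by apply: ler_wiXn2l => //; rewrite mulnC leq_trunc_div.
    rewrite exprM lerXn2r ?nnegrE ?exprn_ge0 ?invr_ge0//.
    by apply: le_trans q0P; apply: ler_wiXn2l => //; rewrite leq_maxr.
  apply: (@le_trans _ _ (2^-1 ^+ k t)).
    apply: le_trans (ler_wpM2l _ h1) _; first by rewrite exprn_ge0.
    by rewrite -exprMn (_ : 2 * 4^-1 = 2^-1)//; field.
  apply: (@le_trans _ _ (expR (- 2^-1) ^+ k t)).
    rewrite lerXn2r ?nnegrE ?invr_ge0 ?expR_ge0//.
    by have := expR_ge1Dx (- 2^-1 : R) => h; lra.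
  rewrite -expRM_natl ler_expR mulrN lerN2.
  by rewrite mulrAC ler_pM2r// invr_gt0.
have c120 : 0 < c1 / 2 by rewrite divr_gt0.
have bc := borel_cantelli_exp c120 ler01 tN mE nE.
have mn := ridge_mean_le theta'1 (_ : 0 < s0 / 2) pS' S'N kappa0.
have {}mn := mn ltac:(by rewrite divr_gt0).
have tr1 := ridge_tr_cvg S' kappa0 ltr01.
exists kappa => //.
have good : \forall t \near \oo, [/\ (0 < N t)%N, c1 * (N t)%:R <= (k t)%:R &
    ridge_mean (Z (t:=t)) (sub_weight (g (t:=t)) (S' t)) (kappa * (N t)%:R) <= mean_bound a theta'].
  near=> t; split; [|by near: t|by near: t].
  by apply: leq_trans (tN t); near: t; exists 1%N.
apply: (ae_eventuallyS2 _ bc); last first.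
  by apply: (ae_eventually_near good _ tr1) => t om G T; exact: (conj G T).
move=> t om /negP; rewrite -ltNge => nE' [[n0 kN mN] tr2].
have w0 r : 0 <= sub_weight (g (t:=t)) (S' t) r.
  by have /andP[] := sub_weight_bounds (S' t) (g0b (t:=t)) r.
have e0 : 0 < kappa * (N t)%:R by rewrite mulr_gt0// ltr0n.
set M := mxrv (Z (t:=t)) om.
have A0E : A0 t M - (- (kappa * (N t)%:R))%:M = wgram (sub_weight (g (t:=t)) (S' t)) M +
  (kappa * (N t)%:R)%:M.
  by rewrite raddfN/= opprK.
have := @barrier_lower_bound R (N t) (p t) m4 m4_ge0 phi a (g (t:=t)) (@A0 t) (- (kappa * (N
  t)%:R)) phi0 a0 (ga (t:=t)) (rs t) M (k t).
rewrite A0E => /(_ (ridge_posdef (psd_wgram _ w0) e0)) /(_ _ nE').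
rewrite barrier_mx_split => lb; apply: (posdef_shift_le _ (lb _)).
  rewrite -/delta /kappa.
  have h : delta * (c1 * (N t)%:R) <= delta * (k t)%:R by rewrite ler_pM2l.
  lra.
move: tr2; rewrite ler_norml => /andP[_ h]; rewrite /phi; move: h;
  rewrite /ridge_tr /ridge_inv => h; lra.
Unshelve. all: by end_near.
Qed.

End lower_bound.
End asymptotics.

Section chebyshev.
Context d (Omega : measurableType d) {R : realType} (P : probability Omega R).

Lemma chebyshev_sqr (f : Omega -> R) (e K : R) : measurable_fun setT f -> 0 < e ->
  (\int[P]_x (f x ^+ 2)%:E <= K%:E)%E ->
  (P [set x | (e <= `|f x|)%R] <= (K / e ^+ 2)%:E)%E.
Proof.
move=> mf e0 fK.
have mE : measurable [set x | e <= `|f x|].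
  rewrite -[X in measurable X]setTI.
  apply: (measurable_fun_ler _ _ measurableT (Y := [set true])) => //.
  exact: measurableT_comp.
rewrite -[X in (P X <= _)%E]setIT -integral_indic//.
have mf2 : measurable_fun setT (fun x => f x ^+ 2) by exact: measurable_funX.
apply: (@le_trans _ _ (\int[P]_x (e ^- 2 * f x ^+ 2)%:E)%E).
  apply: le_integral_EFin => //.
  - exact: measurable_funM.
  move=> x; rewrite indicE; have [|_] := boolP (x \in _);
    last by rewrite mulr_ge0 ?invr_ge0 ?sqr_ge0.
  rewrite inE /= => h; rewrite mulrC ler_pdivlMr ?exprn_gt0// mul1r -[leRHS]real_normK ?num_real//.
  by rewrite lerXn2r ?nnegrE ?(ltW e0).
rewrite integral_EFinZ// ?invr_ge0 ?sqr_ge0//; last by move=> x; exact: sqr_ge0.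
by rewrite mulrC EFinM; apply: lee_wpmul2l => //; rewrite lee_fin invr_ge0 sqr_ge0.
Qed.

End chebyshev.

(** * Deterministic comparison and stability of the equation *)

Section deterministic.
Context {R : realType} {n p : nat}.

Lemma mxtrace_mul_wgram_ge0 (B : 'M[R]_p) (w : 'I_n -> R) (M : 'M[R]_(n, p)) :
  possemidefmx B -> (forall r, 0 <= w r) -> 0 <= \tr (B *m wgram w M).
Proof.
move=> [_ pB] w0; rewrite mxtrace_mul_wgram sumr_ge0// => r _.
by rewrite mulr_ge0//; exact: pB.
Qed.

Lemma ridge_sandwich (w w' : 'I_n -> R) (M : 'M[R]_(n, p)) (c e : R) :
  (forall r, 0 <= w' r) -> 0 < c -> 0 < e -> posdefmx (wgram w M - c%:M) ->
  \tr (ridge_inv w e M *m wgram w' M) <= \tr (invmx (wgram w M) *m wgram w' M)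
    <= (1 + e / c) * \tr (ridge_inv w e M *m wgram w' M).
Proof.
move=> w'0 c0 e0 pAc; rewrite /ridge_inv; set A := wgram w M in pAc *; set C := wgram w' M.
have pA : posdefmx A.
  by rewrite -[A](subrK c%:M); apply: posdefDl => //; apply: psd_scalar; exact: ltW.
have pAe : posdefmx (A + e%:M) by apply: ridge_posdef => //; exact: posdef_psd.
set y := 1 + e / c; have y0 : 0 < y by rewrite addr_gt0// divr_gt0.
have pyAe : posdefmx (y^-1 *: (A + e%:M)).
  split; first by rewrite linearZ/= pAe.1.
  by move=> x x0; have := pAe.2 x x0; rewrite -/(qform _ _) -/(qform _ _) qformZ => h;
    rewrite mulr_gt0// invr_gt0.
apply/andP; split.
  rewrite -subr_ge0 -raddfB/= -mulmxBl; apply: mxtrace_mul_wgram_ge0 => //.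
  by apply: inv_antitone => //; rewrite addrC addKr; apply: psd_scalar; exact: ltW.
rewrite -subr_ge0 -linearZ/= -raddfB/= scalemxAl -mulmxBl; apply: mxtrace_mul_wgram_ge0 => //.
have -> : y *: invmx (A + e%:M) = invmx (y^-1 *: (A + e%:M)).
  apply/esym/mulmx1_inv; rewrite -scalemxAl -scalemxAr scalerA mulVf ?gt_eqF// scale1r.
  by rewrite mulmxV// posdef_unit.
apply: inv_antitone => //.
(* That is, [y A - (A + e) = (e / c) (A - c)], which fixes the value of [y]. *)
have -> : A - y^-1 *: (A + e%:M) = (y^-1 * (e / c)) *: (A - c%:M).
  apply/matrixP => i j; rewrite !mxE.
  have -> : A i j = y^-1 * (y * A i j) by rewrite mulKf ?gt_eqF.
  rewrite /y; case: (i == j); rewrite ?mulr1n ?mulr0n; field; rewrite !gt_eqF// addr_gt0//.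
apply: psdZ; last exact: posdef_psd.
by rewrite mulr_ge0 ?invr_ge0 ?(ltW y0)// divr_ge0 ?ltW.
Qed.

(** Between [x] and [f] each summand over [S] has slope at least [a / ((1 + b X) (1 + b F))]. An
    approximate root of the regularized equation is therefore close to an approximate root of the
    equation at [kappa = 0]. *)
Lemma slope_bound (g : 'I_n -> R) (S : {set 'I_n}) (a b X F x f kappa err1 err2 s0 : R) :
  (0 < n)%N -> 0 < a -> (forall r, a <= g r <= b) -> 0 <= x <= X -> 0 <= f <= F -> 0 < kappa ->
  s0 * n%:R <= #|S|%:R ->
  `|p%:R / n%:R - kappa * x - n%:R^-1 * \sum_r satur (sub_weight g S r) x| <= err1 ->
  `|p%:R / n%:R - n%:R^-1 * \sum_r satur (sub_weight g S r) f| <= err2 ->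
  s0 * (a / ((1 + b * X) * (1 + b * F))) * `|x - f| <= err1 + err2 + kappa * X.
Proof.
move=> n0 a0 gab /andP[x0 xX] /andP[f0 fF] k0 sn.
rewrite !sum_satur_sub; have N0 : 0 < n%:R :> R by rewrite ltr0n.
set Tx := \sum_(r in S) _; set Tf := \sum_(r in S) _ => h1 h2.
set s := a / _.
pose c r := g r / ((1 + g r * x) * (1 + g r * f)).
have g0 r : 0 < g r by have /andP[h _] := gab r; exact: lt_le_trans h.
have b0 : 0 <= b by have /andP[_] := gab (Ordinal n0); apply: le_trans; rewrite ltW.
have X0 : 0 <= X by exact: le_trans xX.
have F0 : 0 <= F by exact: le_trans fF.
have TT : Tx - Tf = (\sum_(r in S) c r) * (x - f).
  rewrite -sumrB mulr_suml; apply: eq_bigr => r _.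
  by rewrite saturB// ?ltW// /c mulrAC.
have cs r : s <= c r.
  have /andP[h h'] := gab r.
  have u1 : 0 < 1 + g r * x by rewrite ltr_wpDr// mulr_ge0// ltW.
  have u2 : 0 < 1 + g r * f by rewrite ltr_wpDr// mulr_ge0// ltW.
  apply: ler_pM => //; rewrite ?invr_ge0 ?mulr_ge0 ?addr_ge0 ?mulr_ge0 ?(ltW a0)//.
  rewrite lef_pV2 ?posrE ?mulr_gt0//; try by rewrite ltr_wpDr// mulr_ge0.
  by apply: ler_pM; rewrite ?(ltW u1) ?(ltW u2)// lerD2l; apply: ler_pM; rewrite ?(ltW (g0 r)).
have sge0 : 0 <= s by rewrite divr_ge0 ?(ltW a0)// mulr_ge0// addr_ge0// mulr_ge0.
have CS : s0 * s <= n%:R^-1 * \sum_(r in S) c r.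
  rewrite ler_pdivlMl//.
  apply: (@le_trans _ _ (#|S|%:R * s)); first by rewrite mulrA [n%:R * s0]mulrC ler_wpM2r.
  by rewrite mulr_natl -sumr_const; apply: ler_sum.
apply: (@le_trans _ _ `|n%:R^-1 * (Tx - Tf)|).
  have CS' := le_trans CS (ler_norm _).
  by rewrite TT [n%:R^-1 * _]mulrA normrM; exact: (ler_wpM2r (normr_ge0 _) CS').
have -> : n%:R^-1 * (Tx - Tf) =
  (p%:R / n%:R - n%:R^-1 * Tf) - (p%:R / n%:R - kappa * x - n%:R^-1 * Tx) - kappa * x by ring.
apply: le_trans (ler_normB _ _) _; apply: lerD.
  by apply: le_trans (ler_normB _ _) _; rewrite addrC lerD.
by rewrite ger0_norm ?ler_pM2l// mulr_ge0// ltW.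
Qed.

End deterministic.

(** * Limit of the trace ratio for one set of rows and its complement *)

Section limit.
Context d (Omega : measurableType d) {R : realType} (P : probability Omega R).
Variables (N p : nat -> nat) (Z : forall t, 'I_(N t) -> 'I_(p t) -> {RV P >-> R}).
Hypothesis tN : forall t, (t <= N t)%N.
Hypothesis Zind : forall t,
  mutual_independence (fun ij : 'I_(N t) * 'I_(p t) => Z ij.1 ij.2).
Variable m4 : R.
Hypothesis m4_ge0 : 0 <= m4.
Hypothesis Zmom : forall t (i : 'I_(N t)) (j : 'I_(p t)) (x y s : R),
  (\int[P]_w ((x + y * Z i j w + s * (Z i j w ^+ 2 - 1)) ^+ 2)%:E <=
   (x ^+ 2 + 2 * y ^+ 2 + 2 * m4 * s ^+ 2)%:E)%E.
Variables (a b : R) (g : forall t, 'I_(N t) -> R).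
Hypotheses (a0 : 0 < a) (gab : forall t (r : 'I_(N t)), a <= g r <= b).
Variables (S : forall t, {set 'I_(N t)}) (theta s0 : R).
Hypotheses (theta1 : theta < 1) (s00 : 0 < s0).
Hypothesis pS : \forall t \near \oo, (p t)%:R <= theta * #|S t|%:R.
Hypothesis SN : \forall t \near \oo, s0 * (N t)%:R <= #|S t|%:R.
Let w t := sub_weight (g (t:=t)) (S t).
Let w' t := sub_weight (g (t:=t)) (~: S t).
Variable f : R.
Hypothesis f0 : 0 <= f.
Hypothesis f_eq : forall e, 0 < e -> \forall t \near \oo,
  `|(p t)%:R / (N t)%:R - (N t)%:R^-1 * \sum_r satur (@w t r) f| <= e.

Let g0b t (r : 'I_(N t)) : 0 <= g r <= b.
Proof. by have /andP[h ->] := gab r; rewrite (le_trans (ltW a0) h). Qed.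

Let w0b t r : 0 <= @w t r <= b.
Proof. by apply: sub_weight_bounds; exact: g0b. Qed.

Let w'0b t r : 0 <= @w' t r <= b.
Proof. by apply: sub_weight_bounds; exact: g0b. Qed.

Let N_gt0 : \forall t \near \oo, (0 < N t)%N.
Proof. by exists 1%N => // t /= t0; exact: leq_trans (tN t). Qed.

Let S_leN t : (#|S t| <= N t)%N.
Proof. by rewrite -[leqRHS]card_ord max_card. Qed.

Let pN : \forall t \near \oo, (p t <= N t)%N.
Proof.
near=> t; rewrite -(ler_nat R); apply: (@le_trans _ _ (theta * #|S t|%:R)); first by near: t.
apply: (@le_trans _ _ #|S t|%:R); last by rewrite ler_nat.
by rewrite ler_piMl// ltW.
Unshelve. all: by end_near.
Qed.

Let b_ge0 : 0 <= b.
Proof.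
have [T _ /(_ T (leqnn T)) h] := N_gt0.
by have /andP[h1 h2] := g0b (Ordinal h); exact: le_trans h2.
Qed.

Let B kappa t om := ridge_inv (@w t) (kappa * (N t)%:R) (mxrv (Z (t:=t)) om).
Let A t om := wgram (@w t) (mxrv (Z (t:=t)) om).
Let C t om := wgram (@w' t) (mxrv (Z (t:=t)) om).

(** [K] comes before [kappa] because [kappa] later tends to 0; it is the a priori bound divided by
    the slope. *)
Lemma ridge_tr_limit : exists2 K : R, 0 <= K & forall kappa e, 0 < kappa -> 0 < e ->
  almost_eventually P (fun t om => `|\tr (B kappa t om) - f| <= K * kappa + e).
Proof.
pose X := mean_bound a theta; have X0 : 0 < X by exact: mean_bound_gt0.
pose s := s0 * (a / ((1 + b * X) * (1 + b * f))).
have s_gt0 : 0 < s.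
  by rewrite mulr_gt0// divr_gt0// mulr_gt0// ltr_wpDr// mulr_ge0// ltW.
exists (X / s) => [|kappa e k0 e0]; first by rewrite divr_ge0 ?ltW.
have e20 : 0 < e / 2 by rewrite divr_gt0.
have se0 : 0 < s * (e / 4) by rewrite mulr_gt0// divr_gt0.
have tr1 := ridge_tr_cvg tN Zind a0 gab S k0 e20.
have mn := ridge_mean_le tN Zind m4_ge0 Zmom a0 gab theta1 s00 pS SN k0.
have fe := f_eq se0.
have er := ridge_error_small tN m4 b k0 se0.
pose x t := ridge_mean (Z (t:=t)) (@w t) (kappa * (N t)%:R).
have xf : \forall t \near \oo, `|x t - f| <= X / s * kappa + e / 2.
  near=> t.
  have n0 : (0 < N t)%N by near: t.
  have pn : (p t <= N t)%N by near: t.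
  have kn0 : 0 < kappa * (N t)%:R by rewrite mulr_gt0// ltr0n.
  have /andP[x0 _] := ridge_mean_bound (Z (t:=t)) (w0b (t:=t)) kn0.
  have xX : x t <= X by near: t.
  have h1 := ridge_equation (@Zind t) m4_ge0 (Zmom (t:=t)) (w0b (t:=t)) n0 pn k0.
  have h1' : ridge_error m4 b kappa (N t) <= s * (e / 4) by near: t.
  have h2 : `|(p t)%:R / (N t)%:R - (N t)%:R^-1 * \sum_r satur (@w t r) f| <=
    s * (e / 4) by near: t.
  have sn : s0 * (N t)%:R <= #|S t|%:R by near: t.
  have xb : 0 <= x t <= X by rewrite x0.
  have fb : 0 <= f <= f by rewrite f0 lexx.
  have := slope_bound n0 a0 (gab (t:=t)) xb fb k0 sn (le_trans h1 h1') h2.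
  rewrite -/s => h; rewrite -(ler_pM2l s_gt0); apply: le_trans h _.
  rewrite le_eqVlt; apply/orP; left; apply/eqP; field; rewrite gt_eqF//.
apply: (ae_eventually_near xf _ tr1) => t om h1 h2.
rewrite (_ : \tr (B kappa t om) - f = (\tr (B kappa t om) - x t) + (x t - f)); last by ring.
apply: le_trans (ler_normD _ _) _.
rewrite (_ : _ + e = e / 2 + (X / s * kappa + e / 2)); last by field; rewrite gt_eqF.
exact: lerD.
Unshelve. all: by end_near.
Qed.

(** [B] does not involve the rows outside [S], and [tr B^2 <= p / (kappa n)^2]. The sum over at most
    [n] rows thus has bounded variance, and a deviation of order [n] has probability of order
    [n^-2]. *)
Lemma cross_term kappa e : 0 < kappa -> 0 < e -> almost_eventually P (fun t om =>
  `|\tr (B kappa t om *m C t om) - (\sum_r @w' t r) * \tr (B kappa t om)| <= e * (N t)%:R).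
Proof.
move=> k0 e0.
pose s t := enum (~: S t).
pose F t om := \sum_(r <- s t) g r *
  (qform (B kappa t om) (row r (mxrv (Z (t:=t)) om)) - \tr (B kappa t om)).
have FE t om : \tr (B kappa t om *m C t om) - (\sum_r @w' t r) * \tr (B kappa t om) = F t om.
  rewrite mxtrace_mul_wgram mulr_suml -sumrB /F /s big_enum [RHS]big_mkcond/=.
  apply: eq_bigr => r _; rewrite /w' /sub_weight; case: ifP => _; last by rewrite !mul0r subrr.
  by rewrite mulrBr.
have mF t : measurable_fun setT (F t).
  apply: measurable_sum => r; apply: measurable_funM => //.
  have mB : mxmeas (B kappa t).
    apply: mxmeas_inv; apply: mxmeasD; last exact: mxmeas_cst.
    by apply: mxmeas_wgram; exact: mxmeas_mxrv.
  apply: measurable_funB; last exact: measurable_mxtrace.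
  by apply: measurable_qform => //; apply: mxmeas_row; exact: mxmeas_mxrv.
pose E t : set Omega := [set om | e * (N t)%:R <= `|F t om|].
have mE t : measurable (E t).
  rewrite -[X in measurable X]setTI.
  apply: (measurable_fun_ler _ _ measurableT (Y := [set true])) => //.
  exact: measurableT_comp.
have C0 : 0 <= 8 + 2 * m4 by rewrite addr_ge0// mulr_ge0.
have nE : \forall t \near \oo,
    (P (E t) <= ((b ^+ 2 * (8 + 2 * m4) / (kappa ^+ 2 * e ^+ 2)) / (N t)%:R ^+ 2)%:E)%E.
  near=> t.
  have n0 : (0 < N t)%N by near: t.
  have pn : (p t <= N t)%N by near: t.
  have N0 : 0 < (N t)%:R :> R by rewrite ltr0n.
  have kn0 : 0 < kappa * (N t)%:R by rewrite mulr_gt0.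
  pose T : R := (p t)%:R / (kappa * (N t)%:R) ^+ 2.
  have T0 : 0 <= T by rewrite divr_ge0// sqr_ge0.
  have pA M : possemidefmx (wgram (@w t) M : 'M[R]_(p t)).
    by apply: psd_wgram => r; have /andP[] := w0b r.
  apply: le_trans (chebyshev_sqr (mF t) _ _) _; first by rewrite mulr_gt0.
    apply: (@sum_qform_variance _ _ _ _ _ _ _ (@Zind t) m4 m4_ge0 (Zmom (t:=t)) (s t) (g (t:=t)) b T
      (ridge_inv (@w t) (kappa * (N t)%:R))).
    - exact: enum_uniq.
    - exact: mxmeas_ridge_inv.
    - by move=> M; have [] := ridge_inv_posdef (pA M) kn0.
    - by move=> M; apply: ridge_trace_sqr_le.
    - move=> r M M'; rewrite mem_enum inE => rS; rewrite /ridge_inv wgram_resample// /w /sub_weight.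
      by rewrite (negbTE rS).
    - exact: g0b.
  rewrite lee_fin.
  apply: (@le_trans _ _ ((N t)%:R * (b ^+ 2 * ((8 +
    2 * m4) * ((N t)%:R / (kappa * (N t)%:R) ^+ 2))) / (e * (N t)%:R) ^+ 2)).
    apply: ler_wpM2r; first by rewrite invr_ge0 sqr_ge0.
    apply: ler_pM => //.
    - by rewrite mulr_ge0 ?sqr_ge0// mulr_ge0.
    - by rewrite ler_nat -cardE -[leqRHS]card_ord max_card.
    - rewrite ler_wpM2l ?sqr_ge0// ler_wpM2l// ler_wpM2r ?invr_ge0 ?sqr_ge0// ler_nat//.
  by rewrite le_eqVlt; apply/orP; left; apply/eqP; field; rewrite !gt_eqF.
apply: ae_eventuallyS (borel_cantelli_sqr tN mE nE) => t om /negP; rewrite -ltNge => h.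
by rewrite FE ltW.
Unshelve. all: by end_near.
Qed.

(** A mean weight of the complementary rows, not a sample point. *)
Let om_ t : R := (N t)%:R^-1 * \sum_r @w' t r.

(** The regularization and the accuracy of both limits are all set to [e], so that a single error
    [K e] remains. *)
Lemma trace_ratio_bound : exists2 K : R, 0 <= K & forall e, 0 < e -> e <= 1 ->
  almost_eventually P (fun t om => A t om \in unitmx /\
    `|(N t)%:R^-1 * \tr (invmx (A t om) *m C t om) - om_ t * f| <= K * e).
Proof.
have [K K0 trf] := ridge_tr_limit.
have [c c0 lb] := gram_lower_bound tN Zind m4_ge0 Zmom a0 gab theta1 s00 pS SN.
pose D := 1 + b * (K + 1); have D0 : 0 <= D by rewrite addr_ge0// mulr_ge0// addr_ge0.
exists (D + c^-1 * (D + b * f)) => [|e e0 e1].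
  by rewrite addr_ge0// mulr_ge0 ?invr_ge0 ?(ltW c0)// addr_ge0// mulr_ge0.
have h1 := trf e e e0 e0; have h2 := cross_term e0 e0.
apply: (ae_eventually_near N_gt0 _ (ae_eventuallyS2 (fun t om => @conj _ _) lb
  (ae_eventuallyS2 (fun t om => @conj _ _) h1 h2))) => t om n0 [pA [{}h1 {}h2]].
have N0 : 0 < (N t)%:R :> R by rewrite ltr0n.
have cn0 : 0 < c * (N t)%:R by rewrite mulr_gt0.
have en0 : 0 < e * (N t)%:R by rewrite mulr_gt0.
have pA' : posdefmx (A t om).
  by rewrite -[A t om]subr0 -(raddf0 (@scalar_mx R (p t))); apply: posdef_shift_le pA; exact: ltW.
split; first exact: posdef_unit.
have w'0 r : 0 <= @w' t r by have /andP[] := w'0b r.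
have := ridge_sandwich w'0 cn0 en0 pA.
rewrite -/(A t om) -/(C t om) -/(B e t om).
rewrite (_ : e * (N t)%:R / (c * (N t)%:R) = e / c); last by field; rewrite !gt_eqF.
set u := \tr (invmx _ *m _); set v := \tr (B e t om *m _) in h2 *; move=> /andP[vu uv].
set x := \tr (B e t om) in h1 h2.
have om0 : 0 <= om_ t by rewrite mulr_ge0 ?invr_ge0// sumr_ge0.
have omb : om_ t <= b.
  rewrite /om_ ler_pdivrMl//; apply: (@le_trans _ _ (\sum_(r < N t) b)).
    by apply: ler_sum => r _; have /andP[] := w'0b r.
  by rewrite sumr_const card_ord mulr_natl.
pose v' := (N t)%:R^-1 * v; pose u' := (N t)%:R^-1 * u.
have hv : `|v' - om_ t * f| <= D * e.
  rewrite (_ : v' - _ = (N t)%:R^-1 * (v - (\sum_r @w' t r) * x) + om_ t * (x - f)); last first.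
    by rewrite /v' /om_; ring.
  apply: le_trans (ler_normD _ _) _; rewrite /D mulrDl mul1r; apply: lerD.
    by rewrite normrM (gtr0_norm (_ : 0 < (N t)%:R^-1)) ?invr_gt0// ler_pdivrMl// [_ * e]mulrC.
  rewrite normrM ger0_norm// -mulrA; apply: ler_pM => //.
  by rewrite mulrDl mul1r.
have vu' : v' <= u' by rewrite ler_pM2l// invr_gt0.
have uv' : u' <= (1 + e / c) * v' by rewrite /u' /v' mulrCA ler_pM2l// invr_gt0.
have omf : om_ t * f <= b * f by rewrite ler_wpM2r.
have v'le : v' <= D + b * f.
  move: hv; rewrite ler_norml => /andP[_ h].
  have De : D * e <= D by rewrite ler_piMr.
  lra.
have ec0 : 0 <= e / c by rewrite divr_ge0 ?ltW.
have ev : e / c * v' <= e / c * (D + b * f) by rewrite ler_wpM2l.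
rewrite (_ : (D + c^-1 * (D + b * f)) * e = D * e + e / c * (D + b * f)); last by ring.
move: hv; rewrite -/u' !ler_norml => /andP[h3 h4].
have ee : 0 <= e / c * (D + b * f) by rewrite mulr_ge0// addr_ge0// mulr_ge0.
rewrite mulrDl mul1r in uv'.
by apply/andP; split; lra.
Qed.

(** Accuracies [1 / (m + 1)] suffice, which leaves countably many null sets. *)
Lemma trace_ratio_cvg : {ae P, forall om,
  (\forall t \near \oo, A t om \in unitmx) /\
  ((N t)%:R^-1 * \tr (invmx (A t om) *m C t om) - om_ t * f) @[t --> \oo] --> 0}.
Proof.
have [K K0 hK] := trace_ratio_bound.
have h : {ae P, forall om, forall m : nat, \forall t \near \oo, A t om \in unitmx /\
    `|(N t)%:R^-1 * \tr (invmx (A t om) *m C t om) - om_ t * f| <= K * m.+1%:R^-1}.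
  apply: ae_foralln => m; apply: hK; first by rewrite invr_gt0.
  by rewrite invf_le1// ler1n.
apply: filterS h => om hm; split; first by apply: filterS (hm 0%N) => t [].
apply/cvgr0Pnorm_le => e e0.
have [m _ /(_ m (leqnn m)) me] := nbhs_infty_ger (K / e).
apply: filterS (hm m) => t [_ h]; apply: le_trans h _.
rewrite ler_pdivrMr// mulrC -ler_pdivrMr//; apply: le_trans me _.
by rewrite ler_nat.
Qed.

End limit.

Section block_combinatorics.
Context {R : realType} {k : nat} (n_ : 'I_k -> nat).
Let n := (\sum_(i < k) n_ i)%N.

Definition block_rows i : {set 'I_n} := [set r : 'I_n | tagnat.sig1 r == i].

Lemma sum_block_rows (V : nmodType) (f : 'I_n -> V) i :
  \sum_(r in block_rows i) f r = \sum_(j < n_ i) f (tagnat.Rank i j).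
Proof. by rewrite sum_block; apply: eq_bigl => r; rewrite inE. Qed.

Lemma card_block_rows i : #|block_rows i| = n_ i.
Proof. by rewrite -sum1_card (sum_block_rows (fun=> 1%N)) sum1_card card_ord. Qed.

Lemma block_weightE (Gamma : 'M[R]_n) i :
  block_weight Gamma i = sub_weight (diag_weight Gamma) (block_rows i).
Proof. by apply/funext => r; rewrite /sub_weight inE. Qed.

Lemma coblock_weightE (Gamma : 'M[R]_n) i :
  coblock_weight Gamma i = sub_weight (diag_weight Gamma) (~: block_rows i).
Proof. by apply/funext => r; rewrite /sub_weight !inE /coblock_weight; case: eqP. Qed.

Lemma submxblock_diag (Gamma : 'M[R]_n) i :
  is_diag_mx Gamma -> is_diag_mx (submxblock Gamma i i).
Proof.
move=> /is_diag_mxP dG; apply/is_diag_mxP => j j' jj'; rewrite mxE; apply: dG.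
by rewrite tagnat.eq_Rank eqxx.
Qed.

End block_combinatorics.

(** * The elliptical model: limits of the blocks and of [FE] *)

Section elliptical.
Context d (Omega : measurableType d) {R : realType} (P : probability Omega R).
Variables (k : nat) (n_ : nat -> 'I_k -> nat) (p : nat -> nat).
Hypothesis hn : forall s t, (s < t)%N ->
  (\sum_(i < k) n_ s i < \sum_(i < k) n_ t i)%N.
Variables (Gamma : forall t, 'M[R]_(\sum_(i < k) n_ t i)) (Sigma : forall t, 'M[R]_(p t)).
Variable Z : forall t, 'I_(\sum_(i < k) n_ t i) -> 'I_(p t) -> {RV P >-> R}.
Hypothesis hGamma : forall t, is_diag_mx (Gamma t).
Hypothesis hSigma : forall t, posdefmx (Sigma t).
Hypothesis Zind : forall t,
  mutual_independence (fun ij : 'I_(\sum_(i < k) n_ t i) * 'I_(p t) => Z ij.1 ij.2).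
Variable m4 : R.
Hypothesis m4_ge0 : 0 <= m4.
Hypothesis Zmom : forall t (i : 'I_(\sum_(i < k) n_ t i)) (j : 'I_(p t)) (x y s : R),
  (\int[P]_w ((x + y * Z i j w + s * (Z i j w ^+ 2 - 1)) ^+ 2)%:E <=
   (x ^+ 2 + 2 * y ^+ 2 + 2 * m4 * s ^+ 2)%:E)%E.
Variables (a b : R).
Hypotheses (a0 : 0 < a)
  (hGammab : forall t (r : 'I_(\sum_(i < k) n_ t i)), a <= Gamma t r r <= b).
Variables (gamma : R) (gamma_ : 'I_k -> R).
Hypothesis hn_oo : forall i, (n_ t i)%:R @[t --> \oo] --> (+oo : set_system R).
Hypothesis hp_oo : (p t)%:R @[t --> \oo] --> (+oo : set_system R).
Hypothesis hgamma_01 : forall i, 0 < gamma_ i < 1.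
Hypothesis hgamma_ : forall i, (p t)%:R / (n_ t i)%:R @[t --> \oo] --> gamma_ i.
Hypothesis hgamma : (p t)%:R / (\sum_(i < k) n_ t i)%N%:R @[t --> \oo] --> gamma.
Variables (G : probability R R) (G_ : 'I_k -> probability R R).
Hypothesis hG : weak_cvg (fun t => esd (Gamma t)) G.
Hypothesis hG_ : forall i, weak_cvg (fun t => esd (submxblock (Gamma t) i i)) (G_ i).

Let N t := (\sum_(i < k) n_ t i)%N.

Let tN t : (t <= N t)%N.
Proof. by elim: t => // t IH; exact: leq_ltn_trans (hn (ltnSn t)). Qed.

Let N_gt0 : \forall t \near \oo, (0 < N t)%N.
Proof. by exists 1%N => // t /= t0; exact: leq_trans (tN t). Qed.

Let p_gt0 : \forall t \near \oo, (0 < p t)%N.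
Proof.
have h : \forall t \near \oo, 0 < (p t)%:R :> R by have /cvgryPgt := hp_oo; exact.
by near=> t; rewrite -(ltr0n R); near: t.
Unshelve. all: by end_near.
Qed.

Let n_gt0 i : \forall t \near \oo, (0 < n_ t i)%N.
Proof.
have h : \forall t \near \oo, 0 < (n_ t i)%:R :> R by have /cvgryPgt := hn_oo i; exact.
by near=> t; rewrite -(ltr0n R); near: t.
Unshelve. all: by end_near.
Qed.

Let gamma_gt0 i : 0 < gamma_ i. Proof. by have /andP[] := hgamma_01 i. Qed.

Let ab : a <= b.
Proof.
have [T _ /(_ T (leqnn T)) h] := N_gt0.
by have /andP[h1 h2] := hGammab (Ordinal h); exact: le_trans h2.
Qed.

(** [n / p] is the sum of the ratios of the blocks, and a single block already contributes more than
    1. *)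
Lemma aspect_ratio_sum : gamma^-1 = \sum_i (gamma_ i)^-1 /\ 0 < gamma < 1.
Proof.
have h1 : (N t)%:R / (p t)%:R @[t --> \oo] --> \sum_i (gamma_ i)^-1.
  rewrite (_ : (fun t => _) = (fun t => \sum_(i <- index_enum 'I_k) (n_ t i)%:R / (p t)%:R));
    last first.
    by apply/funext => t; rewrite /N natr_sum mulr_suml.
  apply: cvg_sumr => i.
  rewrite (_ : (fun t => _) = (fun t => ((p t)%:R / (n_ t i)%:R)^-1)); last first.
    by apply/funext => t; rewrite invf_div.
  by apply: cvgV => //; rewrite gt_eqF.
(* Without blocks all sample sizes would be 0, against their strict growth. *)
have k0 : (0 < k)%N.
  rewrite lt0n; apply/eqP => k0; have := tN 1; rewrite /N big1// => i _.
  by have := ltn_ord i; rewrite {2}k0.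
have s1 : 1 < \sum_i (gamma_ i)^-1.
  rewrite (bigD1 (Ordinal k0))//= ltr_wpDr//.
    by apply: sumr_ge0 => i _; rewrite invr_ge0 ltW.
  by have /andP[h h'] := hgamma_01 (Ordinal k0); rewrite invf_gt1.
have s0 : 0 < \sum_i (gamma_ i)^-1 by exact: lt_trans s1.
have h2 : (p t)%:R / (N t)%:R @[t --> \oo] --> (\sum_i (gamma_ i)^-1)^-1.
  rewrite (_ : (fun t => _) = (fun t => ((N t)%:R / (p t)%:R)^-1)); last first.
    by apply/funext => t; rewrite invf_div.
  by apply: cvgV => //; rewrite gt_eqF.
have -> : gamma = (\sum_i (gamma_ i)^-1)^-1 by exact: (cvg_unique _ hgamma h2).
by rewrite invrK invr_gt0 s0 invf_lt1.
Qed.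

Let gamma_n0 : gamma != 0.
Proof. by have [_ /andP[/gt_eqF ->]] := aspect_ratio_sum. Qed.

Lemma block_proportion i : (n_ t i)%:R / (N t)%:R @[t --> \oo] --> gamma / gamma_ i.
Proof.
have h : (p t)%:R / (N t)%:R / ((p t)%:R / (n_ t i)%:R) @[t --> \oo] --> gamma / gamma_ i.
  by apply: cvgM => //; apply: cvgV => //; rewrite gt_eqF.
apply: cvg_trans h; apply: near_eq_cvg; near=> t.
have p0 : (0 < p t)%N by near: t.
have n0 : (0 < n_ t i)%N by near: t.
have N0 : (0 < N t)%N by near: t.
by field; rewrite !pnatr_eq0 -!lt0n N0 n0 p0.
Unshelve. all: by end_near.
Qed.

Let avg_G (f : R -> R) : continuous f -> (exists M : R, forall x : R, `|f x| <= M) -> (forall x,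
  0 <= f x) ->
  (N t)%:R^-1 * \sum_(i < N t) f (Gamma t i i) @[t --> \oo] --> \int[G]_x f x.
Proof.
move=> cf bf f0; have := hG cf bf.
have mf := continuous_measurable_fun cf.
rewrite (_ : (fun t => _) = (fun t => (N t)%:R^-1 * \sum_(i < N t) f (Gamma t i i)))//.
by apply/funext => t; rewrite esd_integral.
Qed.

Let avg_G_ i (f : R -> R) : continuous f -> (exists M : R, forall x : R,
  `|f x| <= M) -> (forall x, 0 <= f x) ->
  (n_ t i)%:R^-1 * \sum_(j < n_ t i) f (Gamma t (tagnat.Rank i j) (tagnat.Rank i j)) @[t --> \oo]
    -->
  \int[G_ i]_x f x.
Proof.
move=> cf bf f0; have := @hG_ i f cf bf.
have mf := continuous_measurable_fun cf.
rewrite (_ : (fun t => _) = (fun t => (n_ t i)%:R^-1 * \sum_(j < n_ t i) f (Gamma t (tagnat.Rank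
  i j) (tagnat.Rank i j))))//.
apply/funext => t; rewrite esd_integral//; last exact: submxblock_diag.
by congr (_ * _); apply: eq_bigr => j _; rewrite mxE.
Qed.

Let Gab_ i t (j : 'I_(n_ t i)) : a <= Gamma t (tagnat.Rank i j) (tagnat.Rank i j) <= b.
Proof. exact: hGammab. Qed.

Let f i := eta_f (gamma_ i) (G_ i).

Lemma eta_f_block i : 0 <= f i /\ Defs.eta (G_ i) (f i) = 1 - gamma_ i.
Proof. exact: (eta_f_spec a0 ab (@Gab_ i) (avg_G_ (i := i)) (hgamma_01 i)). Qed.

(** This is the equation at [kappa = 0], solved by [f i]: block [i] holds a fraction
    [gamma / gamma_ i] of the rows, and each contributes [1 - (1 - gamma_ i)] on average. *)
Lemma satur_block_cvg i :
  (N t)%:R^-1 * \sum_r satur (block_weight (Gamma t) i r) (f i) @[t --> \oo] --> gamma.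
Proof.
have [f0 fE] := eta_f_block i.
have h := weak_limit_eta a0 ab (@Gab_ i) (avg_G_ (i := i)) f0.
rewrite fE in h.
have -> : gamma = gamma / gamma_ i * (1 - (1 - gamma_ i)).
  by rewrite opprB addrC subrK divfK// gt_eqF.
apply: cvg_trans (cvgM (block_proportion (i := i)) (cvgB (cvg_cst (1 : R)) h)).
apply: near_eq_cvg; near=> t => /=; rewrite !fctE/=.
have n0 : (0 < n_ t i)%N by near: t.
have N0 : (0 < N t)%N by near: t.
rewrite block_weightE sum_satur_sub sum_block_rows.
have -> : \sum_(j < n_ t i) satur (diag_weight (Gamma t) (tagnat.Rank i j)) (f i) =
    \sum_(j < n_ t i) (1 - (1 + f i * Gamma t (tagnat.Rank i j) (tagnat.Rank i j))^-1).
  apply: eq_bigr => j _; rewrite saturE//; first by rewrite mulrC.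
  by have /andP[h1 _] := hGammab (tagnat.Rank i j); exact: le_trans (ltW a0) h1.
rewrite sumrB sumr_const card_ord.
by field; rewrite !pnatr_eq0 -!lt0n N0 n0.
Unshelve. all: by end_near.
Qed.

Let L i := mean G - gamma / gamma_ i * mean (G_ i).

Lemma coblock_cvg i :
  (N t)%:R^-1 * \sum_r coblock_weight (Gamma t) i r @[t --> \oo] --> L i.
Proof.
have h1 := weak_limit_mean a0 ab hGammab avg_G.
have h2 := weak_limit_mean a0 ab (@Gab_ i) (avg_G_ (i := i)).
apply: cvg_trans (cvgB h1 (cvgM (block_proportion (i := i)) h2)).
apply: near_eq_cvg; near=> t => /=; rewrite !fctE/=.
have n0 : (0 < n_ t i)%N by near: t.
have N0 : (0 < N t)%N by near: t.
have -> : \sum_(j < n_ t i) Gamma t (tagnat.Rank i j) (tagnat.Rank i j) =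
  \sum_r block_weight (Gamma t) i r.
  by rewrite (sum_block (fun r => Gamma t r r)) [LHS]big_mkcond.
have -> : \sum_r coblock_weight (Gamma t) i r = \sum_r Gamma t r r - \sum_r block_weight (Gamma
  t) i r.
  rewrite -sumrB; apply: eq_bigr => r _; rewrite /coblock_weight /block_weight.
  by case: ifP; rewrite ?subrr ?subr0.
by field; rewrite !pnatr_eq0 -!lt0n N0 n0.
Unshelve. all: by end_near.
Qed.

(** Keeps the denominators in the limit of [FE] at least 1, where inversion is continuous. *)
Lemma coblock_limit_ge0 i : 0 <= L i.
Proof.
rewrite -(cvg_lim _ (@coblock_cvg i))//; apply: limr_ge; first by apply: cvgP (@coblock_cvg i).
apply: nearW => t; rewrite mulr_ge0 ?invr_ge0//; apply: sumr_ge0 => r _.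
rewrite /coblock_weight; case: ifP => // _.
by have /andP[h1 _] := hGammab r; exact: le_trans (ltW a0) h1.
Qed.

Let A t i om := wgram (block_weight (Gamma t) i) (mxrv (Z (t:=t)) om).
Let C t i om := wgram (coblock_weight (Gamma t) i) (mxrv (Z (t:=t)) om).

Lemma block_trace_cvg i : {ae P, forall om,
  (\forall t \near \oo, A t i om \in unitmx) /\
  (N t)%:R^-1 * \tr (invmx (A t i om) *m C t i om) @[t --> \oo] --> L i * f i}.
Proof.
have [f0 _] := eta_f_block i.
(* Strictly between the limit ratio and 1, so that [p <= theta n_i] eventually; [s00] likewise takes
   half of the limit proportion of the block. *)
pose theta := (1 + gamma_ i) / 2.
have g1 : gamma_ i < 1 by have /andP[] := hgamma_01 i.
have theta1 : theta < 1 by rewrite /theta ltr_pdivrMr// mul1r -[ltRHS]/(1 + 1) ltrD2l.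
have theta2 : gamma_ i < theta by rewrite /theta; lra.
have [_ /andP[ggt0 _]] := aspect_ratio_sum.
have s00 : 0 < gamma / gamma_ i / 2 by rewrite !divr_gt0.
have pS : \forall t \near \oo, (p t)%:R <= theta * #|block_rows (n_ t) i|%:R.
  have h : \forall t \near \oo, (p t)%:R / (n_ t i)%:R <= theta.
    exact: cvgr_le _ (hgamma_ (i := i)) _ theta2.
  near=> t; rewrite card_block_rows -ler_pdivrMr; first by near: t.
  by rewrite ltr0n; near: t.
have SN : \forall t \near \oo, gamma / gamma_ i / 2 * (N t)%:R <= #|block_rows (n_ t) i|%:R.
  have lt2 : gamma / gamma_ i / 2 < gamma / gamma_ i.
    by rewrite ltr_pdivrMr// mulr_natr mulr2n ltrDl divr_gt0.
  have h : \forall t \near \oo, gamma / gamma_ i / 2 <= (n_ t i)%:R / (N t)%:R.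
    exact: cvgr_ge _ (block_proportion (i := i)) _ lt2.
  near=> t; rewrite card_block_rows -ler_pdivlMr; first by near: t.
  by rewrite ltr0n; near: t.
have f_eq e : 0 < e -> \forall t \near \oo, `|(p t)%:R / (N t)%:R - (N t)%:R^-1 *
    \sum_r satur (sub_weight (diag_weight (Gamma t)) (block_rows (n_ t) i) r) (f i)| <= e.
  move=> e0; have h : ((p t)%:R / (N t)%:R - (N t)%:R^-1 *
      \sum_r satur (block_weight (Gamma t) i r) (f i)) @[t --> \oo] --> gamma - gamma by exact:
        (cvgB hgamma (satur_block_cvg i)).
  rewrite subrr in h; have /cvgr0Pnorm_le/(_ e e0) := h.
  by apply: filterS => t; rewrite block_weightE.
have := trace_ratio_cvg tN Zind m4_ge0 Zmom a0 (g := fun t => diag_weight (Gamma t)) hGammab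
  theta1 s00 pS SN f0 f_eq.
apply: filterS => om [uA h]; split; first by apply: filterS uA => t; rewrite /A block_weightE.
rewrite -[L i * f i]add0r; apply: cvg_trans (cvgD h (cvgM (@coblock_cvg i) (cvg_cst (f i)))).
by apply: near_eq_cvg; near=> t => /=; rewrite !fctE/= /A /C block_weightE coblock_weightE subrK.
Unshelve. all: by end_near.
Qed.

Lemma FE_cvg : {ae P, forall om,
  FE (sqrtmx (Gamma t) *m mxrv (Z (t:=t)) om *m sqrtmx (Sigma t)) @[t --> \oo] -->
    \sum_i (1 + (gamma^-1 * mean G - (gamma_ i)^-1 * mean (G_ i)) * f i)^-1}.
Proof.
have : {ae P, forall om, forall i, (\forall t \near \oo, A t i om \in unitmx) /\
  (N t)%:R^-1 * \tr (invmx (A t i om) *m C t i om) @[t --> \oo] --> L i * f i}.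
  by apply: filter_forall => i; exact: block_trace_cvg.
apply: filterS => om h.
have h' : \sum_(i <- index_enum 'I_k) (1 + ((p t)%:R / (N t)%:R)^-1 * ((N t)%:R^-1 * \tr (invmx
  (A t i om) *m C t i om)))^-1
    @[t --> \oo] --> \sum_(i <- index_enum 'I_k) (1 +
      (gamma^-1 * mean G - (gamma_ i)^-1 * mean (G_ i)) * f i)^-1.
  apply: cvg_sumr => i.
  (* [L i] is normalized by the number of all rows and the summand by [p]; [gamma^-1] converts one
     into the other. *)
  have -> : (gamma^-1 * mean G - (gamma_ i)^-1 * mean (G_ i)) * f i = gamma^-1 * (L i * f i).
    by rewrite /L; field; rewrite gamma_n0 gt_eqF.
  have [f0 _] := eta_f_block i; have L0 := coblock_limit_ge0 i.
  have [_ /andP[ggt0 _]] := aspect_ratio_sum.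
  apply: cvgV; first by rewrite gt_eqF// ltr_wpDr// mulr_ge0 ?invr_ge0 ?(ltW ggt0)// mulr_ge0.
  apply: cvgD; first exact: cvg_cst.
  by apply: cvgM; [apply: cvgV|have [_] := h i].
apply: cvg_trans h'; apply: near_eq_cvg.
have uA : \forall t \near \oo, forall i, A t i om \in unitmx.
  by apply: filter_forall => i; have [] := h i.
near=> t.
have p0 : (0 < p t)%N by near: t.
have N0 : (0 < N t)%N by near: t.
rewrite FE_wgram//; last 2 first.
  by move=> r; have /andP[h1 _] := hGammab r; exact: lt_le_trans h1.
  by near: t.
apply: eq_bigr => i _; rewrite -/(A t i om) -/(C t i om).
set T := \tr _.
have -> : ((p t)%:R / (N t)%:R)^-1 * ((N t)%:R^-1 * T) = T / (p t)%:R.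
  by field; rewrite !pnatr_eq0 -!lt0n N0 p0.
rewrite -[(p t)%:R / (_ + T)]invf_div mulrDl divff ?pnatr_eq0 -?lt0n//.
Unshelve. all: by end_near.
Qed.

(** The averages are eventually constant in [t], so uniqueness of limits gives both means and the
    value [1 / (1 + f i)] of the transform, without identifying [G] and [G_ i] as point masses.
    Hence [f i = gamma_ i / (1 - gamma_ i)]. *)
Lemma FE_limit_identity : (forall t, Gamma t = 1%:M) ->
  \sum_i (1 + (gamma^-1 * mean G - (gamma_ i)^-1 * mean (G_ i)) * f i)^-1 =
  gamma / (1 - gamma) * \sum_i ((1 - gamma_ i) / gamma_ i).
Proof.
move=> G1; rewrite mulr_sumr; apply: eq_bigr => i _.
have [_ /andP[ggt0 glt1]] := aspect_ratio_sum.
have /andP[gi0 gi1] := hgamma_01 i.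
have mG : mean G = 1.
  have := weak_limit_mean a0 ab hGammab avg_G; set u := (X in X @ _ --> _) => hu.
  suff h : u @ \oo --> (1 : R) by exact: (cvg_unique _ hu h).
  apply: cvg_near_cst; near=> t; rewrite /u.
  have N0 : (0 < N t)%N by near: t.
  have -> : \sum_(r < N t) Gamma t r r = \sum_(r < N t) 1.
    by apply: eq_bigr => r _; rewrite G1 mxE eqxx.
  by rewrite sumr_const card_ord mulVf// pnatr_eq0 -lt0n.
have mGi : mean (G_ i) = 1.
  have := weak_limit_mean a0 ab (@Gab_ i) (avg_G_ (i := i)); set u := (X in X @ _ --> _) => hu.
  suff h : u @ \oo --> (1 : R) by exact: (cvg_unique _ hu h).
  apply: cvg_near_cst; near=> t; rewrite /u.
  have n0 : (0 < n_ t i)%N by near: t.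
  rewrite (eq_bigr (fun=> 1)) => [|j _]; last by rewrite G1 mxE eqxx.
  by rewrite sumr_const card_ord mulVf// pnatr_eq0 -lt0n.
have [f0 fE] := eta_f_block i.
have eG : Defs.eta (G_ i) (f i) = (1 + f i)^-1.
  have := weak_limit_eta a0 ab (@Gab_ i) (avg_G_ (i := i)) f0; set u := (X in X @ _ --> _) => hu.
  suff h : u @ \oo --> (1 + f i)^-1 by exact: (cvg_unique _ hu h).
  apply: cvg_near_cst; near=> t; rewrite /u.
  have n0 : (0 < n_ t i)%N by near: t.
  rewrite (eq_bigr (fun=> (1 + f i)^-1)) => [|j _]; last by rewrite G1 mxE eqxx mulr1.
  by rewrite sumr_const card_ord -[X in _ * X = _]mulr_natl mulKf// pnatr_eq0 -lt0n.
have fi : f i = gamma_ i / (1 - gamma_ i).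
  have e1 : 1 + f i = (1 - gamma_ i)^-1 by rewrite -fE eG invrK.
  rewrite -[LHS](addKr 1) e1; field; rewrite subr_eq0 gt_eqF//.
rewrite mG mGi fi.
have u : 1 + (gamma^-1 * 1 - (gamma_ i)^-1 * 1) * (gamma_ i / (1 - gamma_ i)) =
    gamma_ i * (1 - gamma) / (gamma * (1 - gamma_ i)).
  by field; rewrite gamma_n0 subr_eq0 !gt_eqF.
rewrite u invf_div.
by field; rewrite !subr_eq0 !gt_eqF.
Unshelve. all: by end_near.
Qed.

End elliptical.
Theorem theorem5p2
  (R : realType) (d : measure_display) (Omega : measurableType d)
  (P : probability Omega R)
  (* sizes of the t-th problem: k blocks of n_ t i rows, and p t columns; the
     problems are indexed by distinct total sample sizes n = \sum_i n_ t i *)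
  (k : nat) (n_ : nat -> 'I_k -> nat) (p : nat -> nat)
  (hn : forall s t, (s < t)%N ->
     (\sum_(i < k) n_ s i < \sum_(i < k) n_ t i)%N)
  (* X = Gamma^{1/2} Z Sigma^{1/2} *)
  (Gamma : forall t, 'M[R]_(\sum_(i < k) n_ t i))
  (Sigma : forall t, 'M[R]_(p t))
  (Z : forall t, 'I_(\sum_(i < k) n_ t i) -> 'I_(p t) -> {RV P >-> R})
  (X : forall t, Omega -> 'M[R]_(\sum_(i < k) n_ t i, p t))
  (hX : forall t w,
     X t w = sqrtmx (Gamma t) *m (\matrix_(i, j) Z t i j w)
                              *m sqrtmx (Sigma t))
  (hGamma : forall t, is_diag_mx (Gamma t))
  (hGamma0 : forall t i, 0 <= Gamma t i i)
  (hSigma : forall t, posdefmx (Sigma t))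
  (* iid entries with a fixed law *)
  (law : probability R R) (c : R) (hc : 0 < c)
  (hlaw0 : ('E_law[fun z => z] = 0)%E)
  (hlaw1 : ('V_law[fun z => z] = 1)%E)
  (hlaw8 : ('E_law[fun z => (`|z| `^ (8 + c))%R] < +oo)%E)
  (hZlaw : forall t i j (B : set R), measurable B ->
     distribution P (Z t i j) B = law B)
  (hZind : forall t,
     mutual_independence (fun ij : 'I_(\sum_(i < k) n_ t i) * 'I_(p t) =>
                            Z t ij.1 ij.2))
  (* uniform bounds *)
  (a b : R) (ha : 0 < a)
  (hSigmab : forall t x, eigenvalue (Sigma t) x -> a <= x <= b)
  (hGammab : forall t i, a <= Gamma t i i <= b)
  (* aspect ratios *)
  (gamma : R) (gamma_ : 'I_k -> R)
  (hn_oo : forall i, (n_ t i)%:R @[t --> \oo] --> (+oo : set_system R))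
  (hp_oo : (p t)%:R @[t --> \oo] --> (+oo : set_system R))
  (hgamma_01 : forall i, 0 < gamma_ i < 1)
  (hgamma_ : forall i, (p t)%:R / (n_ t i)%:R @[t --> \oo] --> gamma_ i)
  (hgamma : (p t)%:R / (\sum_(i < k) n_ t i)%N%:R @[t --> \oo] --> gamma)
  (* limiting spectral distributions *)
  (G H : probability R R) (G_ : 'I_k -> probability R R)
  (hG : weak_cvg (fun t => esd (Gamma t)) G)
  (hG_ : forall i, weak_cvg (fun t => esd (submxblock (Gamma t) i i)) (G_ i))
  (hH : weak_cvg (fun t => esd (Sigma t)) H)
  (hHc : compact (msupport H)) (hH0 : ~ msupport H 0)
  (hGc : compact (msupport G)) (hG0 : G [set 0] = 0%E) :
  {ae P, forall w,
     FE (X t w) @[t --> \oo] -->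
       \sum_(i < k) (1 + (gamma^-1 * mean G - (gamma_ i)^-1 * mean (G_ i))
                           * eta_f (gamma_ i) (G_ i))^-1}
  /\
  ((forall t, Gamma t = 1%:M) ->
   {ae P, forall w,
      FE (X t w) @[t --> \oo] -->
        gamma / (1 - gamma) * \sum_(i < k) ((1 - gamma_ i) / gamma_ i)}).

Proof.
have [m4 m40 lm] := law_moments hc hlaw0 hlaw1 hlaw8.
have Zmom t (i : 'I_(\sum_(i < k) n_ t i)) (j : 'I_(p t)) (x y s : R) :
    (\int[P]_w ((x + y * Z t i j w + s * (Z t i j w ^+ 2 - 1)) ^+ 2)%:E <=
     (x ^+ 2 + 2 * y ^+ 2 + 2 * m4 * s ^+ 2)%:E)%E.
  apply: le_trans (lm x y s); rewrite -(ge0_integral_law (hZlaw t i j))//.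
    apply/measurable_EFinP; apply: measurable_funX; apply: measurable_funD.
      by apply: measurable_funD => //; apply: measurable_funM.
    by apply: measurable_funM => //; apply: measurable_funB => //; apply: measurable_funX.
  by move=> z; rewrite lee_fin sqr_ge0.
have main : {ae P, forall w,
     FE (X t w) @[t --> \oo] -->
       \sum_(i < k) (1 + (gamma^-1 * mean G - (gamma_ i)^-1 * mean (G_ i))
                           * eta_f (gamma_ i) (G_ i))^-1}.
  have := FE_cvg hn hGamma hSigma hZind m40 Zmom ha hGammab hn_oo hp_oo hgamma_01 hgamma_ hgamma
    hG hG_.
  apply: filterS => w; apply: cvg_trans; apply: near_eq_cvg; apply: nearW => t.
  by rewrite hX.
split=> // G1.
by rewrite -(FE_limit_identity hn hGamma ha hGammab hn_oo hgamma_01 hgamma_ hgamma hG hG_ G1).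
Qed.
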